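(* Fix $A>0$ and $c>1$. Let $\alpha$ be chosen from the uniform distribution on $[0,1]$. For an integer $N\ge 1$ let $\operatorname{EST}(A,c,N)$ be the number of rationals $p/q$ (with $p\in\mathbb Z$, $q\in\mathbb Z_{\ge1}$, $\gcd(p,q)=1$) such that $N\le q\le cN$ and $\left|\alpha-\frac pq\right|\le \frac{A}{q^2}$, and let $K(A,N)$ be the number of pairs $(p,q)\in\mathbb Z^2$ with $\gcd(p,q)=1$ such that $1\le q\le N$ and $|\alpha q-p|\le \frac AN$. Then for every integer $k\ge 0$ the limits $\lim_{N\to\infty}P(\operatorname{EST}(A,c,N)=k)$ and $\lim_{N\to\infty}P(K(A,N)=k)$ exist, and $$\lim_{N\to\infty}P(\operatorname{EST}(A,c,N)=k)=\mu_2\big(\{\Lambda\in X_2:\#(\Lambda_{\mathrm{prim}}\cap H_{A,c})=k\}\big),$$ $$\lim_{N\to\infty}P(K(A,N)=k)=\mu_2\big(\{\Lambda\in X_2:\#(\Lambda_{\mathrm{prim}}\cap R_{A})=k\}\big),$$ where $H_{A,c}=\{(x,y)\in\mathbb R^2: |x|y\le A,\ 1\le y\le c\}$ and $R_A=\{(x,y)\in\mathbb R^2:|x|\le A,\ 0\le y\le 1\}$.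
   Context: $X_2=\mathrm{SL}(2,\mathbb R)/\mathrm{SL}(2,\mathbb Z)$ is identified with the space of unimodular lattices in $\mathbb R^2$ via $g\,\mathrm{SL}(2,\mathbb Z)\mapsto g\mathbb Z^2$, and $\mu_2$ is the Haar probability measure on $X_2$. For $\Lambda=g\mathbb Z^2$, $\Lambda_{\mathrm{prim}}=\{gw: w\in\mathbb Z^2\setminus\{0\},\ \gcd(w)=1\}$ is the set of primitive vectors of $\Lambda$. *)

(* Defs.v *)
From HB Require Import structures.
From mathcomp Require Import all_boot all_order all_algebra.
From mathcomp Require Import all_classical all_reals all_analysis.
Set Implicit Arguments. Unset Strict Implicit. Unset Printing Implicit Defensive.
Import Order.TTheory GRing.Theory Num.Theory.
Local Open Scope classical_set_scope.
Local Open Scope ring_scope.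

Section Defs.
Variable R : realType.

Definition has_card (T : eqType) (S : set T) (k : nat) : Prop :=
  exists s : seq T, [/\ uniq s, size s = k & forall v, S v <-> v \in s].

Definition mx2 (a b c d : R) : 'M[R]_2 :=
  \matrix_(i < 2, j < 2)
    if i == 0 :> nat then (if j == 0 :> nat then a else b)
    else (if j == 0 :> nat then c else d).

Definition latpt (g : 'M[R]_2) (w : int * int) : R * R :=
  (g 0 0 * w.1%:~R + g 0 1 * w.2%:~R, g 1 0 * w.1%:~R + g 1 1 * w.2%:~R).

Definition prim_vecs (g : 'M[R]_2) : set (R * R) :=
  [set v | exists w : int * int, gcdz w.1 w.2 = 1%Z /\ v = latpt g w].

Definition H_set (A c : R) : set (R * R) :=
  [set v | `|v.1| * v.2 <= A /\ 1 <= v.2 <= c].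
Definition R_set (A : R) : set (R * R) :=
  [set v | `|v.1| <= A /\ 0 <= v.2 <= 1].

(** Haar probability measure mu_2 on X_2 = SL(2,R)/SL(2,Z), realised via
    Iwasawa coordinates on a fundamental domain.  For (x,y) in the standard
    fundamental domain D of SL(2,Z) acting on the upper half plane and
    theta in [0,pi), the matrix  n(x) a(y) k(theta)  runs over a fundamental
    domain for SL(2,Z)\SL(2,R), hence its inverse
      k(theta)^-1 a(y)^-1 n(x)^-1
    runs over a fundamental domain for SL(2,R)/SL(2,Z).  Haar measure in
    these coordinates is dx dy / y^2 dtheta, of total mass (pi/3)*pi. *)
Definition fund_mat (v : (R * R) * R) : 'M[R]_2 :=
  let x := v.1.1 in let y := v.1.2 in let t := v.2 in
  (mx2 (cos t) (sin t) (- sin t) (cos t))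
  *m (mx2 (Num.sqrt y)^-1 0 0 (Num.sqrt y))
  *m (mx2 1 (- x) 0 1).

Definition fund_dom : set ((R * R) * R) :=
  [set v | `|v.1.1| <= 2^-1 /\ 1 <= v.1.1 ^+ 2 + v.1.2 ^+ 2 /\ 0 < v.1.2
           /\ 0 <= v.2 < pi].

Definition leb3 := ((@lebesgue_measure R \x @lebesgue_measure R)
                     \x @lebesgue_measure R)%E.

(** mu_2 of the set of lattices { g Z^2 : P g } (P is a property of lattices,
    i.e. invariant under g |-> g gamma, gamma in SL(2,Z)). *)
Definition mu2 (P : 'M[R]_2 -> Prop) : \bar R :=
  ((3 / pi ^+ 2)%:E *
   \int[leb3]_(v in fund_dom)
      ((v.1.2 ^- 2) * \1_[set u | P (fund_mat u)] v)%:E)%E.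

Definition EST_set (A c : R) (N : nat) (alpha : R) : set (int * int) :=
  [set pq | gcdz pq.1 pq.2 = 1%Z /\ (1 <= pq.2)%R
     /\ (N%:R : R) <= pq.2%:~R <= c * N%:R
     /\ `|alpha - pq.1%:~R / pq.2%:~R| <= A / pq.2%:~R ^+ 2].

Definition K_set (A : R) (N : nat) (alpha : R) : set (int * int) :=
  [set pq | gcdz pq.1 pq.2 = 1%Z /\ (1 <= pq.2)%R /\ (pq.2 <= N%:Z)%R
     /\ `|alpha * pq.2%:~R - pq.1%:~R| <= A / N%:R].

Definition prob_EST (A c : R) (N k : nat) : \bar R :=
  lebesgue_measure [set alpha : R | `[0%R, 1%R]%classic alpha /\ has_card (EST_set A c N alpha) k].
Definition prob_K (A : R) (N k : nat) : \bar R :=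
  lebesgue_measure [set alpha : R | `[0%R, 1%R]%classic alpha /\ has_card (K_set A N alpha) k].

End Defs.

(* Main.v *)
(* Let v be the vector (N (alpha q - p), q / N) of the lattice Lambda_N(alpha)
   attached to alpha in [0, 1[ at scale N; both counts are numbers of primitive
   vectors of Lambda_N(alpha) in a fixed region of the plane.  Outside a set of
   measure O(d), Lambda_N(alpha) has a Gauss-reduced basis v = (u, a), v' = (u', b)
   with a > d, where u' = (u b - 1) / a.  Here a = q / N and b = q' / N for a
   coprime pair (q, q'), and u runs through an interval at speed N q as alpha
   varies, so that the probability of an event E is, up to O(d), the sum over
   coprime pairs of (N q)^-1 |{u : (a, b, u) reduced and in E}|.

   Replacing coprimality by coprimality to z! makes the condition periodic, and
   the sum converges to x(z) times the integral over E of da db du / a, where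
   x(z) is the density of the sieved pairs.  The value of x(z) is never
   computed: taking the sure event shows that x(z) times the total volume
   pi^2 / 6 is close to 1.  Finally, polar coordinates (x, y, t) on the
   fundamental domain carry dx dy dt / y^2 to twice da db du / a. *)
Require Import Defs.
From HB Require Import structures.
From mathcomp Require Import all_boot all_order all_algebra.
From mathcomp Require Import all_classical all_reals all_analysis.
From mathcomp Require Import measurable_realfun.
From mathcomp Require Import ring lra zify.
Set Implicit Arguments. Unset Strict Implicit. Unset Printing Implicit Defensive.
Import Order.TTheory GRing.Theory Num.Theory.
Import numFieldNormedType.Exports.
Local Open Scope classical_set_scope.
Local Open Scope ring_scope.

(** * Changes of variables *)

(** The sum over coprime pairs is a Riemann sum in [(a, b)] only: [u] is integrated exactly, because
    it is affine in the uniform variable [alpha]. The cutoff [a > d] answers the weight [1/a] and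
    the coordinate [b], both unbounded as [a] tends to 0; once [a > d], reducedness gives [a <= 2]
    and [|b| <= 1 + 1/d], so the summands are bounded with compact support.

    Reduced bases always exist but are unique only away from boundary cases. The upper bound
    therefore counts reduced bases and the lower bound strictly reduced ones; for fixed [(a, b)]
    they differ by countably many [u], so both bounds lead to the same sum.

    For the limit, the event is shown to be locally constant in [(a, b)] off countable sets nested
    as [a], then [b], then [u]. Dominated convergence in one variable at a time turns this into
    convergence of the sums, with no study of boundaries in space.

    The parameters are chosen in the order [d], then [z] depending on [d] (the sieve error is of
    order [d^-3 / z]), then [N]. *)

Section subst.
Context {R : realType}.
Notation mu := (@lebesgue_measure R).
Local Open Scope ereal_scope.
Local Notation mR := (measurableTypeR R).
Variables (D J : set mR) (phi : mR -> mR) (w : mR -> R).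
Hypotheses (mD : measurable D) (mJ : measurable J).
Hypothesis mphi : measurable_fun D phi.
Hypothesis mw : measurable_fun D w.
Hypothesis w0 : forall x, D x -> (0 <= w x)%R.

Let mDphi (B : set mR) : measurable B -> measurable (D `&` phi @^-1` B).
Proof. by move=> mB; exact: mphi. Qed.

(** The image under [phi] of the measure [w dx] on [D]. Half-open intervals determine a measure that
    is finite on each []-n, n]], so the interval computation [hw] identifies it with Lebesgue
    measure on [J]. *)
Let dens (B : set mR) : \bar R := \int[mu]_(x in D `&` phi @^-1` B) (w x)%:E.

Let dens0 : dens set0 = 0.
Proof. by rewrite /dens preimage_set0 setI0 integral_set0. Qed.

Let dens_ge0 B : 0 <= dens B.
Proof. by apply: integral_ge0 => x [Dx _]; rewrite lee_fin w0. Qed.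

Let dens_sigma : semi_sigma_additive dens.
Proof.
move=> F mF tF mUF; rewrite /dens preimage_bigcup setI_bigcupr.
rewrite ge0_integral_bigcup//=.
- by apply: is_cvg_nneseries => n _ _; apply: integral_ge0 => x [Dx _]; rewrite lee_fin w0.
- by move=> k; apply: mDphi; exact: mF.
- rewrite -setI_bigcupr; apply/measurable_EFinP.
  by apply: measurable_funS mw => //; apply: subIsetl.
- by move=> x [k _ [Dx _]]; rewrite lee_fin w0.
- apply/trivIsetP => i j _ _ ij; apply/seteqP; split=> // x [[_ Fi] [_ Fj]].
  by move/trivIsetP : tF => /(_ i j I I ij)/seteqP[+ _] => /(_ (phi x)); apply; split.
Qed.

HB.instance Definition _ := isMeasure.Build _ _ _ dens dens0 dens_ge0 dens_sigma.

Hypothesis hw : forall c d : R, (c <= d)%R ->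
  \int[mu]_(x in D `&` phi @^-1` `]c, d]) (w x)%:E = mu (J `&` `]c, d]).

Let densE B : measurable B -> dens B = mu (J `&` B).
Proof.
move=> mB; rewrite setIC.
have -> : mu (B `&` J) = mrestr mu mJ B by [].
apply: (@measure_unique _ R (measurableTypeR R) (@ocitv R)
  (fun n => `](- n%:R)%R, n%:R%R]%classic) _ _ _ _ dens (mrestr mu mJ)) => //.
- exact: (@ocitvI R).
- by move=> n; exists (- n%:R, n%:R)%R.
- apply/seteqP; split=> // x _; exists (Num.truncn `|x|).+1 => //=.
  rewrite in_itv/=; have := truncnS_gt `|x|; rewrite ltr_norml => /andP[-> /ltW ->//].
- move=> A [[a b] _ <-]/=; have [ab|ba] := leP a b.
    by rewrite /mrestr setIC; exact: hw.
  by rewrite set_itv_ge ?measure0// bnd_simp -leNgt ltW.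
- move=> k; have kk : (- k%:R <= k%:R :> R)%R by rewrite ge0_cp// ler0n.
  have H : dens `](- k%:R)%R, k%:R%R] = _ := hw kk.
  rewrite [X in X < _]H.
  rewrite (@le_lt_trans _ _ (mu `](- k%:R)%R, k%:R]))//.
    by apply: le_measure; [apply/mem_set; exact: measurableI|apply/mem_set|exact: subIsetr].
  by rewrite lebesgue_measure_itv/=; case: ifP => //; rewrite ltry.
Qed.

Import HBNNSimple.

(** Monotone convergence reduces the claim to simple functions, and there it is [densE] on each
    level set. *)
Lemma ge0_substitution (f : mR -> \bar R) : measurable_fun setT f ->
  (forall x, 0 <= f x) ->
  \int[mu]_(x in D) (f (phi x) * (w x)%:E) = \int[mu]_(x in J) f x.
Proof.
move=> mf f0.
pose g := nnsfun_approx measurableT mf.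
have gf x : EFin \o g ^~ x @ \oo --> f x by apply: cvg_nnsfun_approx.
have mg n : measurable_fun D (fun x => (g n (phi x) * w x)%:E).
  apply/measurable_EFinP; apply: measurable_funM => //.
  by exact: measurableT_comp.
have -> : \int[mu]_(x in J) f x = limn (fun n => \int[mu]_(x in J) (g n x)%:E).
  rewrite -monotone_convergence//.
  - by apply: eq_integral => x _; apply/esym/cvg_lim => //; exact: gf.
  - by move=> n; apply/measurable_EFinP; apply: measurable_funTS; exact: measurable_funP. 
  - by move=> n x _; rewrite lee_fin; exact: fun_ge0.
  - by move=> x _ a b ab; rewrite lee_fin; exact/lefP/nd_nnsfun_approx.
have -> : \int[mu]_(x in D) (f (phi x) * (w x)%:E) =
    limn (fun n => \int[mu]_(x in D) (g n (phi x) * w x)%:E).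
  rewrite -monotone_convergence//.
  - apply: eq_integral => x _; apply/esym/cvg_lim => //.
    under eq_fun do rewrite EFinM; apply: cvgeMr => //; exact: gf.
  - by move=> n x Dx; rewrite lee_fin mulr_ge0 ?w0//; exact: fun_ge0.
  - move=> x Dx a b ab; rewrite lee_fin ler_wpM2r ?w0//.
    exact/lefP/nd_nnsfun_approx.
rewrite [X in limn X = _](_ : _ = (fun n => \int[mu]_(x in J) (g n x)%:E))//; apply/funext => n.
under eq_integral do rewrite fimfunE mulr_fsuml -fsumEFin//.
rewrite ge0_integral_fsum//; last 2 first.
- move=> r; apply/measurable_EFinP; apply: measurable_funM => //.
  apply: measurable_funM => //;
  exact: measurableT_comp.
- move=> r x Dx; rewrite EFinM mule_ge0 ?lee_fin ?w0//.
  exact: nnfun_muleindic_ge0.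
under [RHS]eq_integral do rewrite fimfunE -fsumEFin//.
rewrite ge0_integral_fsum//; last 2 first.
- move=> r; apply/measurable_EFinP; apply: measurable_funM => //.
- by move=> r x Dx; exact: nnfun_muleindic_ge0.
apply: eq_fsbigr => r /set_mem[t _ grt].
have r0 : (0 <= r)%R by rewrite -grt; exact: fun_ge0.
under eq_integral do rewrite -mulrA EFinM.
rewrite ge0_integralZl//; last 2 first.
- apply/measurable_EFinP; apply: measurable_funM => //.
  by exact: measurableT_comp.
- by move=> x Dx; rewrite lee_fin mulr_ge0 ?w0.
under [RHS]eq_integral do rewrite EFinM.
rewrite ge0_integralZl//; last exact/measurable_EFinP.
congr (_ * _).
transitivity (dens (g n @^-1` [set r])); last first.
  by rewrite densE// integral_indic// setIC.
rewrite /dens integral_mkcondr.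
apply: eq_integral => x _; rewrite patchE indicE.
have -> : (x \in phi @^-1` (g n @^-1` [set r])) = (phi x \in g n @^-1` [set r]).
  by apply/idP/idP => /set_mem h; apply/mem_set.
by case: ifPn => h; rewrite ?mul1r ?mul0r.
Qed.
End subst.

Section substs.
Context {R : realType}.
Notation mu := (@lebesgue_measure R).
Local Open Scope ereal_scope.
Local Notation mR := (measurableTypeR R).

Lemma ge0_integral_affine (s t : R) (f : R -> \bar R) : s != 0%R ->
  measurable_fun setT f -> (forall x, 0 <= f x) ->
  \int[mu]_x f (s * x + t)%R = (`|s|^-1)%:E * \int[mu]_x f x.
Proof.
move=> s0 mf f0.
have sg0 : (0 < `|s|)%R by rewrite normr_gt0.
have mphi : measurable_fun [set: mR] (fun x : mR => (s * x + t)%R : mR).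
  exact: measurable_funD.
have mfphi : measurable_fun [set: mR] (fun x : mR => f (s * x + t)%R).
  exact: (measurableT_comp mf).
rewrite -[RHS](congr1 (fun z => _ * z) (@ge0_substitution R setT setT (fun x => s * x + t)%R
  (cst `|s|%R) _ _ _ _ _ _ f _ _))//.
- rewrite -ge0_integralZl//=.
  + apply: eq_integral => x _ /=.
    by rewrite muleC -muleA -EFinM divff ?mule1// normr_eq0.
  + by apply: emeasurable_funM => //; exact: measurable_cst.
  + by move=> x _; rewrite mule_ge0// lee_fin.
- move=> c d cd; rewrite !setTI (_ : (fun x : mR => (cst `|s|%R x)%:E) = cst `|s|%:E)//.
  rewrite integral_cst//=; last first.
    by rewrite -[X in measurable X]setTI; exact: mphi.
  rewrite lebesgue_measure_itv/= lte_fin.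
  have [sp|sn|] := ltgtP 0%R s; last by move=> /esym/eqP; rewrite (negbTE s0).
  + have -> : (fun x => s * x + t)%R @^-1` `]c, d] = `]((c - t) / s)%R, ((d - t) / s)%R]%classic.
      apply/seteqP; split=> x/=; rewrite !in_itv/= => /andP[h1 h2]; apply/andP; split.
      * by rewrite ltr_pdivrMr// ltrBlDr mulrC.
      * by rewrite ler_pdivlMr// lerBrDr mulrC.
      * by rewrite -ltrBlDr mulrC -ltr_pdivrMr.
      * by rewrite -lerBrDr mulrC -ler_pdivlMr.
    rewrite lebesgue_measure_itv/= lte_fin ltr_pM2r ?invr_gt0// ltrD2r.
    case: ifPn => _; last by rewrite mule0.
    rewrite -?EFinN -?EFinD -EFinM; congr EFin.
    by rewrite gtr0_norm//; field.
  + have -> : (fun x => s * x + t)%R @^-1` `]c, d] = `[((d - t) / s)%R, ((c - t) / s)%R[%classic.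
      apply/seteqP; split=> x/=; rewrite !in_itv/= => /andP[h1 h2]; apply/andP; split.
      * by rewrite ler_ndivrMr// lerBrDr mulrC.
      * by rewrite ltr_ndivlMr// ltrBlDr mulrC.
      * by rewrite -ltrBlDr mulrC -ltr_ndivlMr.
      * by rewrite -lerBrDr mulrC -ler_ndivrMr.
    rewrite lebesgue_measure_itv/= lte_fin ltr_nM2r ?invr_lt0// ltrD2r.
    case: ifPn => _; last by rewrite mule0.
    rewrite -?EFinN -?EFinD -EFinM; congr EFin.
    by rewrite ltr0_norm//; field.
Qed.

Lemma FTC_is_derive (f F : R -> R) (p q : R) : (p <= q)%R ->
  (forall x, (p <= x <= q)%R -> is_derive x 1%R F (f x)) ->
  (forall x, (p <= x <= q)%R -> {for x, continuous f}) ->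
  \int[mu]_(x in `[p, q]) (f x)%:E = (F q - F p)%:E.
Proof.
rewrite le_eqVlt => /predU1P[<- _ _|pq dF cf].
  by rewrite set_itv1 integral_set1 subrr.
have cF x : (p <= x <= q)%R -> {for x, continuous F}.
  move=> pxq; apply/differentiable_continuous/derivable1_diffP.
  by have [] := dF x pxq.
rewrite (@continuous_FTC2 _ f F)//.
- apply: continuous_in_subspaceT => x /set_mem/=; rewrite in_itv/=; exact: cf.
- split.
  + move=> x; rewrite in_itv/= => /andP[/ltW px /ltW xq].
    by have [] := dF x (introT andP (conj px xq)).
  + by apply: cvg_at_right_filter; apply: cF; rewrite lexx ltW.
  + by apply: cvg_at_left_filter; apply: cF; rewrite lexx ltW.
- move=> x; rewrite in_itv/= => /andP[/ltW px /ltW xq].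
  have h := dF x (introT andP (conj px xq)).
  by rewrite derive1E; exact: derive_val.
Qed.

(** Used with [S = sin t] to pass from [y] to [a = sin t / sqrt y] at a fixed angle. The weight is
    the derivative of [- S^2 / a^2], the opposite of the substitution, which decreases in [a]. *)
Lemma ge0_subst_invsq (S : R) (g : R -> \bar R) : (0 < S)%R ->
  measurable_fun setT g -> (forall x, 0 <= g x) ->
  \int[mu]_(a in `]0%R, +oo[) (g (S ^+ 2 / a ^+ 2)%R * (2 * S ^+ 2 / a ^+ 3)%:E) =
  \int[mu]_(y in `]0%R, +oo[) g y.
Proof.
move=> S0 mg g0.
have dF (x : R) : (0 < x)%R ->
    is_derive x 1%R (fun a : R => - (S ^+ 2) * (a ^+ 2)^-1)%R (2 * S ^+ 2 / x ^+ 3)%R.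
  move=> x0; have xn0 : (x ^+ 2 != 0)%R by rewrite expf_neq0// gt_eqF.
  have H : is_derive x 1%R (fun a : R => a ^+ 2)%R _ := is_deriveX 2 (is_derive_id x 1%R).
  have H2 : is_derive x 1%R (fun a : R => - (S ^+ 2) * (a ^+ 2)^-1)%R _ :=
    is_deriveZ (- (S ^+ 2))%R (@is_deriveV _ (fun a : R => a ^+ 2)%R x _ _ xn0 H).
  apply: is_derive_eq H2 _.
  by rewrite /GRing.scale/= expr1; field; rewrite gt_eqF.
have cf (x : R) : (0 < x)%R -> {for x, continuous (fun a : R => 2 * S ^+ 2 / a ^+ 3)%R}.
  move=> x0; apply: continuousM; first exact: cvg_cst.
  by apply: continuousV; [rewrite expf_neq0// gt_eqF|exact: exprn_continuous].
have cphi (x : R) : (0 < x)%R -> {for x, continuous (fun a : R => S ^+ 2 / a ^+ 2)%R}.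
  move=> x0; apply: continuousM; first exact: cvg_cst.
  by apply: continuousV; [rewrite expf_neq0// gt_eqF|exact: exprn_continuous].
have lee (a e : R) : (0 < a)%R -> (0 < e)%R -> (S ^+ 2 / a ^+ 2 <= e)%R = (S / Num.sqrt e <= a)%R.
  move=> a0 e0; rewrite ler_pdivrMr ?exprn_gt0// ler_pdivrMr ?sqrtr_gt0//.
  rewrite -[in RHS]ler_sqr ?nnegrE ?mulr_ge0 ?sqrtr_ge0 ?(ltW a0) ?(ltW S0)//.
  by rewrite exprMn sqr_sqrtr ?(ltW e0)// mulrC.
have lte (a e : R) : (0 < a)%R -> (0 < e)%R -> (e < S ^+ 2 / a ^+ 2)%R = (a < S / Num.sqrt e)%R.
  by move=> a0 e0; rewrite !ltNge lee.
have re (e : R) : (0 < e)%R -> (0 < S / Num.sqrt e)%R.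
  by move=> e0; rewrite divr_gt0// sqrtr_gt0.
have Fr (e : R) : (0 < e)%R -> (- (S ^+ 2) * ((S / Num.sqrt e) ^+ 2)^-1 = - e)%R.
  by move=> e0; rewrite exprMn exprVn sqr_sqrtr ?(ltW e0)//; field; rewrite !gt_eqF.
apply: (@ge0_substitution R `]0%R, +oo[ `]0%R, +oo[
   (fun a => S ^+ 2 / a ^+ 2)%R (fun a => 2 * S ^+ 2 / a ^+ 3)%R) => //.
- apply: open_continuous_measurable_fun => // x /set_mem/=.
  by rewrite in_itv/= andbT; exact: cphi.
- apply: open_continuous_measurable_fun => // x /set_mem/=.
  by rewrite in_itv/= andbT; exact: cf.
- move=> x /=; rewrite in_itv/= andbT => x0.
  by rewrite divr_ge0 ?mulr_ge0 ?exprn_ge0// ltW.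
move=> c d cd; have [d0|d0] := leP d 0%R.
  rewrite [X in mu X](_ : _ = set0); last first.
    rewrite -subset0 => x [/=]; rewrite !in_itv/= andbT => x0 /andP[_ xd].
    by have := lt_le_trans x0 (le_trans xd d0); rewrite ltxx.
  rewrite [X in integral _ X _](_ : _ = set0) ?integral_set0 ?measure0//.
  rewrite -subset0 => x [/=]; rewrite !in_itv/= andbT => x0 /andP[_ xd].
  have := le_trans xd d0; rewrite leNgt divr_gt0 ?exprn_gt0//.
(* For [c <= 0 < d] the preimage is a ray and the integral is improper; for [c > 0] it is a bounded
   interval. *)
have [c0|c0] := leP c 0%R.
  rewrite [X in mu X](_ : _ = `]0%R, d]%classic); last first.
    apply/seteqP; split=> x /=; rewrite !in_itv/= andbT.
      by move=> [-> /andP[_ ->]].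
    by move=> /andP[x0 ->]; rewrite x0 (le_lt_trans c0 x0).
  rewrite [X in integral _ X _](_ : _ = `[(S / Num.sqrt d)%R, +oo[%classic); last first.
    apply/seteqP; split=> x /=; rewrite !in_itv/= !andbT.
      by move=> [x0 /andP[_]]; rewrite lee.
    move=> rx; have x0 := lt_le_trans (re _ d0) rx.
    split=> //; rewrite lee// rx andbT (le_lt_trans c0)//.
    by rewrite divr_gt0 ?exprn_gt0.
  rewrite (@ge0_continuous_FTC2y _ _ (fun a : R => - (S ^+ 2) * (a ^+ 2)^-1)%R _ 0%R).
  + by rewrite Fr// lebesgue_measure_itv/= lte_fin d0 opprK oppr0 add0e adde0.
  + move=> x rx; have x0 := lt_le_trans (re _ d0) rx.
    by rewrite divr_ge0 ?mulr_ge0 ?exprn_ge0// ltW.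
  + apply: continuous_in_subspaceT => x /set_mem/=; rewrite in_itv/= andbT => rx.
    by apply: cf; exact: lt_le_trans (re _ d0) rx.
  + rewrite -[X in _ --> X](mulr0 (- (S ^+ 2))%R); apply: cvgMr.
    apply/cvgrPdist_lt => e e0; near=> x.
    have x1 : (1 <= x)%R by near: x; exact: nbhs_pinfty_ge.
    have x0 : (0 < x)%R by exact: lt_le_trans x1.
    rewrite sub0r normrN gtr0_norm ?invr_gt0 ?exprn_gt0//.
    rewrite invf_plt ?posrE ?exprn_gt0//.
    apply: (@lt_le_trans _ _ x); first by near: x; apply: nbhs_pinfty_gt; rewrite num_real.
    by rewrite expr2 ler_pMr.
  + move=> x rx; have x0 := lt_trans (re _ d0) rx.
    by have [] := dF x x0.
  + apply: cvg_at_right_filter.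
    have cF : {for (S / Num.sqrt d)%R,
        continuous (fun a : R => - (S ^+ 2) * (a ^+ 2)^-1)%R}.
      apply/differentiable_continuous/derivable1_diffP.
      by have [] := dF _ (re _ d0).
    exact: cF.
  + move=> x; rewrite in_itv/= andbT => rx.
    have h := dF x (lt_trans (re _ d0) rx).
    by rewrite derive1E; exact: derive_val.
have rdc : (S / Num.sqrt d <= S / Num.sqrt c)%R.
  by rewrite ler_pM2l// lef_pV2 ?posrE ?sqrtr_gt0// ler_wsqrtr.
rewrite [X in mu X](_ : _ = `]c, d]%classic); last first.
  apply/seteqP; split=> x /=; rewrite !in_itv/= andbT; first by case.
  by move=> /andP[cx xd]; rewrite cx xd (lt_trans c0 cx).
rewrite [X in integral _ X _](_ : _ = `[(S / Num.sqrt d)%R, (S / Num.sqrt c)%R[%classic); last first.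
  apply/seteqP; split=> x /=; rewrite !in_itv/= !andbT.
    by move=> [x0]; rewrite lee// lte// => /andP[-> ->].
  move=> /andP[rx xr]; have x0 := lt_le_trans (re _ d0) rx.
  by rewrite lee// lte// rx xr.
rewrite integral_itv_bndo_bndc.
  have H1 x : (S / Num.sqrt d <= x <= S / Num.sqrt c)%R -> _ :=
    fun h => dF x (lt_le_trans (re _ d0) (proj1 (andP h))).
  have H2 x : (S / Num.sqrt d <= x <= S / Num.sqrt c)%R -> _ :=
    fun h => cf x (lt_le_trans (re _ d0) (proj1 (andP h))).
  rewrite (FTC_is_derive rdc H1 H2) !Fr// lebesgue_measure_itv/= lte_fin.
  case: ltgtP cd => // [cd _|-> _]; first by rewrite opprK addrC.
  by rewrite subrr.
have mw : measurable_fun (`]0%R, +oo[%classic : set R) (fun a : R => 2 * S ^+ 2 / a ^+ 3)%R.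
  apply: open_continuous_measurable_fun => // x /set_mem/=.
  by rewrite in_itv/= andbT; exact: cf.
apply/measurable_EFinP; apply: measurable_funS mw => //.
move=> x /=; rewrite !in_itv/= andbT => /andP[rx _].
exact: lt_le_trans (re _ d0) rx.
Unshelve. all: by end_near. Qed.

(** Passes from the angle [t] to [u = - a cot t] at fixed [a]; this increases over the whole line as
    [t] runs through []0, pi[]. *)
Lemma ge0_subst_cot (a : R) (g : R -> \bar R) : (0 < a)%R ->
  measurable_fun setT g -> (forall x, 0 <= g x) ->
  \int[mu]_(t in `]0%R, pi[) (g (- a * cos t / sin t)%R * (a / sin t ^+ 2)%:E) =
  \int[mu]_u g u.
Proof.
move=> a0 mg g0.
have sg (x : R) : (0 < x < pi)%R -> (0 < sin x)%R by exact: sin_gt0_pi.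
have dF (x : R) : (0 < x < pi)%R ->
    is_derive x 1%R (fun t : R => - a * cos t / sin t)%R (a / sin x ^+ 2)%R.
  move=> xpi; have sx := sg x xpi; have sn0 : (sin x != 0)%R by rewrite gt_eqF.
  have H2 : is_derive x 1%R (fun t : R => - a * cos t / sin t)%R _ :=
    is_deriveM (is_deriveZ (- a)%R (is_derive_cos x))
      (@is_deriveV _ (@sin R) x _ _ sn0 (is_derive_sin x)).
  apply: is_derive_eq H2 _.
  rewrite /GRing.scale/=.
  rewrite (_ : a / sin x ^+ 2 = a * (cos x ^+ 2 + sin x ^+ 2) / sin x ^+ 2)%R; last first.
    by rewrite cos2Dsin2 mulr1.
  rewrite (_ : (- a *: cos x = - a * cos x)%R)//. by field.
have cf (x : R) : (0 < x < pi)%R -> {for x, continuous (fun t : R => a / sin t ^+ 2)%R}.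
  move=> xpi; have sx := sg x xpi; apply: continuousM; first exact: cvg_cst.
  apply: continuousV; first by rewrite expf_neq0// gt_eqF.
  by apply: (@continuous_comp _ _ _ (@sin R) (fun z : R => z ^+ 2)%R); [exact: continuous_sin|exact: exprn_continuous].
have cphi (x : R) : (0 < x < pi)%R -> {for x, continuous (fun t : R => - a * cos t / sin t)%R}.
  move=> xpi; apply/differentiable_continuous/derivable1_diffP.
  by have [] := dF x xpi.
have tanE (x : R) : (0 < x < pi)%R -> (- a * cos x / sin x = a * tan (x - pi / 2))%R.
  move=> xpi; rewrite /tan sinBpihalf cosBpihalf; ring.
(* [r] inverts the substitution, because [- cot t = tan (t - pi/2)]. *)
pose r (e : R) := (pi / 2 + atan (e / a))%R.
have r01 e : (0 < r e < pi)%R.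
  rewrite /r; apply/andP; split.
    by have := atan_gtNpi2 (e / a)%R; lra.
  by have := atan_ltpi2 (e / a)%R; lra.
have Fr e : (- a * cos (r e) / sin (r e) = e)%R.
  rewrite tanE// /r addrC addrA addNr add0r atanK; field; by rewrite gt_eqF.
have in2 x : (0 < x < pi)%R -> (x - pi / 2)%R \in `](- (pi / 2))%R, (pi / 2)%R[.
  by move=> /andP[x0 xpi]; rewrite in_itv/=; lra.
have lte (x e : R) : (0 < x < pi)%R -> (e < - a * cos x / sin x)%R = (r e < x)%R.
  move=> xpi; rewrite -[in LHS](Fr e) !tanE// ltr_pM2l//.
  by rewrite ltr_tan ?in2// ltrD2r.
have lee (x e : R) : (0 < x < pi)%R -> (- a * cos x / sin x <= e)%R = (x <= r e)%R.
  by move=> xpi; rewrite !leNgt lte.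
apply: (@ge0_substitution R `]0%R, pi[ setT
   (fun t => - a * cos t / sin t)%R (fun t => a / sin t ^+ 2)%R) => //.
- apply: open_continuous_measurable_fun => // x /set_mem/=.
  by rewrite in_itv/=; exact: cphi.
- apply: open_continuous_measurable_fun => // x /set_mem/=.
  by rewrite in_itv/=; exact: cf.
- move=> x /=; rewrite in_itv/= => x0.
  by rewrite divr_ge0 ?exprn_ge0// ltW// sg.
move=> c d cd.
have rdc : (r c <= r d)%R.
  by rewrite lerD2l; apply: le_atan; rewrite ler_pM2r// invr_gt0.
rewrite setTI.
rewrite [X in integral _ X _](_ : _ = `](r c), (r d)]%classic); last first.
  apply/seteqP; split=> x /=; rewrite !in_itv/=.
    by move=> [x0]; rewrite lee// lte// => /andP[-> ->].
  move=> /andP[rx xr].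
  have x0 : (0 < x < pi)%R.
    have /andP[rc0 _] := r01 c; have /andP[_ rd0] := r01 d.
    by rewrite (lt_trans rc0 rx) (le_lt_trans xr rd0).
  by rewrite lee// lte// rx xr.
have sub x : (r c <= x <= r d)%R -> (0 < x < pi)%R.
  move=> /andP[rx xr].
  have /andP[rc0 _] := r01 c; have /andP[_ rd0] := r01 d.
  by rewrite (lt_le_trans rc0 rx) (le_lt_trans xr rd0).
rewrite integral_itv_obnd_cbnd.
  rewrite (FTC_is_derive rdc (fun x h => dF x (sub x h)) (fun x h => cf x (sub x h))).
  rewrite !Fr// lebesgue_measure_itv/= lte_fin.
  by case: ltgtP cd => // -> _; rewrite subrr.
have mw : measurable_fun (`]0%R, pi[%classic : set R) (fun t : R => a / sin t ^+ 2)%R.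
  apply: open_continuous_measurable_fun => // x /set_mem/=.
  by rewrite in_itv/=; exact: cf.
apply/measurable_EFinP; apply: measurable_funS mw => //.
move=> x /=; rewrite !in_itv/= => /andP[/ltW rx rr].
by apply: sub; rewrite rx rr.
Qed.
End substs.

(** * Reduced bases and the fundamental domain *)
Section core.
Context {R : realType}.
Implicit Types a b u : R.

(* A unimodular basis (u, a), (u', b), with u b - u' a = 1, is determined by
   (a, b, u): its remaining coordinate is u' = top2 a b u. *)
Definition top2 a b u : R := (u * b - 1) / a.
Definition dotv a b u : R := u * top2 a b u + a * b.
(** The Lagrange-Gauss conditions [2 |v.v'| <= |v|^2 <= |v'|^2], with [a > 0] choosing between [v]
    and [-v]. The closed form ensures existence ([red_exists]), the strict form [sred] uniqueness
    ([sred_unique]). *)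
Definition red a b u : bool :=
  [&& 0 < a, 2 * `|dotv a b u| <= u ^+ 2 + a ^+ 2
    & u ^+ 2 + a ^+ 2 <= top2 a b u ^+ 2 + b ^+ 2].
Definition sred a b u : bool :=
  [&& 0 < a, 2 * `|dotv a b u| < u ^+ 2 + a ^+ 2
    & u ^+ 2 + a ^+ 2 < top2 a b u ^+ 2 + b ^+ 2].
End core.

(** * Measurability of elementary functions and sets *)

Section meas.
Context {R : realType}.

Lemma measurable_inv : measurable_fun [set: R] (@GRing.inv R).
Proof.
(* The factor [x] restores the sign and settles [x = 0], where the inverse is 0 by convention. *)
rewrite (_ : @GRing.inv R = fun x => x * powR (x ^+ 2) (-1)).
  apply: measurable_funM => //.
  apply: (measurableT_comp (measurable_powR (-1))).
  exact: measurable_funX.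
apply/funext => x; have [->|x0] := eqVneq x 0; first by rewrite invr0 mul0r.
by rewrite powR_inv1 ?sqr_ge0// expr2 invfM mulrA divff// mul1r.
Qed.

Context d (T : measurableType d).
Implicit Types f g : T -> R.

Lemma measurable_funVr f : measurable_fun setT f ->
  measurable_fun setT (fun x => (f x)^-1).
Proof. exact: (measurableT_comp measurable_inv). Qed.

Lemma measurable_fun_cos f : measurable_fun setT f ->
  measurable_fun setT (fun x => cos (f x)).
Proof.
apply: measurableT_comp; apply: continuous_measurable_fun; exact: continuous_cos.
Qed.

Lemma measurable_fun_sin f : measurable_fun setT f ->
  measurable_fun setT (fun x => sin (f x)).
Proof.
apply: measurableT_comp; apply: continuous_measurable_fun; exact: continuous_sin.
Qed.

Lemma measurable_fun_sqrt f : measurable_fun setT f ->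
  measurable_fun setT (fun x => Num.sqrt (f x)).
Proof.
apply: measurableT_comp; apply: continuous_measurable_fun; exact: sqrt_continuous.
Qed.

Lemma measurable_fun_norm f : measurable_fun setT f ->
  measurable_fun setT (fun x => `|f x|).
Proof. exact: measurableT_comp. Qed.

Lemma measurable_set_bool (h : T -> bool) : measurable_fun setT h ->
  measurable [set x | h x].
Proof.
move=> mh; have := mh measurableT [set true] I; rewrite setTI.
by congr (measurable _); apply/funext => x; apply/propext; split.
Qed.

Lemma measurable_set_le f g : measurable_fun setT f -> measurable_fun setT g ->
  measurable [set x | f x <= g x].
Proof. by move=> mf mg; apply: measurable_set_bool; exact: measurable_fun_ler. Qed.

Lemma measurable_set_lt f g : measurable_fun setT f -> measurable_fun setT g ->
  measurable [set x | f x < g x].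
Proof. by move=> mf mg; apply: measurable_set_bool; exact: measurable_fun_ltr. Qed.
End meas.

Ltac mfun := repeat first
  [ assumption | exact: measurable_cst | exact: measurable_id
  | exact: measurable_fst | exact: measurable_snd
  | apply: measurable_funD | apply: measurable_funB | apply: measurable_funN
  | apply: measurable_funM | apply: measurable_funX | apply: measurable_funVr
  | apply: measurable_fun_cos | apply: measurable_fun_sin
  | apply: measurable_fun_sqrt | apply: measurable_fun_norm
  | apply: (measurableT_comp measurable_fst) | apply: (measurableT_comp measurable_snd)
  | apply: measurable_fun_pair ].

Section measurable_red.
Context {R : realType}.

Lemma measurable_red : measurable [set z : R * R * R | red z.1.1 z.1.2 z.2].
Proof.
rewrite /red /dotv /top2.
rewrite (_ : mkset _ = [set z : R * R * R | 0 < z.1.1] `&`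
  ([set z : R * R * R | 2 * `|dotv z.1.1 z.1.2 z.2| <= z.2 ^+ 2 + z.1.1 ^+ 2]
  `&` [set z : R * R * R | z.2 ^+ 2 + z.1.1 ^+ 2 <= top2 z.1.1 z.1.2 z.2 ^+ 2 + z.1.2 ^+ 2])).
  apply: measurableI; [apply: measurable_set_lt|apply: measurableI; apply: measurable_set_le]; rewrite /dotv /top2; mfun.
by apply/seteqP; split=> z /=; [move=> /and3P[]|move=> [? [? ?]]; apply/and3P].
Qed.
End measurable_red.

Section fund.
Context {R : realType}.
Notation mu := (@lebesgue_measure R).

(* Coordinates of the basis - fund_mat ((x, y), t); see fund_matE. *)
Definition fa (y t : R) : R := sin t / Num.sqrt y.
Definition fu (y t : R) : R := - cos t / Num.sqrt y.
Definition fb (x y t : R) : R := - fa y t * x - cos t * Num.sqrt y.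

Lemma fund_top2 x y t : 0 < y -> 0 < t < pi ->
  top2 (fa y t) (fb x y t) (fu y t) = x * cos t / Num.sqrt y - sin t * Num.sqrt y.
Proof.
move=> y0 tpi; have s0 := sin_gt0_pi tpi.
have q0 : 0 < Num.sqrt y by rewrite sqrtr_gt0.
have cs := cos2Dsin2 t.
rewrite /top2 /fu /fb /fa.
rewrite (_ : 1 = cos t ^+ 2 + sin t ^+ 2)//.
by field; rewrite ?gt_eqF.
Qed.

Lemma fund_norm y t : 0 < y -> fu y t ^+ 2 + fa y t ^+ 2 = y^-1.
Proof.
move=> y0; rewrite /fu /fa !exprMn !exprVn sqr_sqrtr ?ltW// sqrrN -mulrDl.
by rewrite cos2Dsin2 mul1r.
Qed.

Lemma fund_dot x y t : 0 < y -> 0 < t < pi ->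
  dotv (fa y t) (fb x y t) (fu y t) = - x / y.
Proof.
move=> y0 tpi; rewrite /dotv fund_top2//.
have q0 : 0 < Num.sqrt y by rewrite sqrtr_gt0.
rewrite -(mulr1 (- x)) -(cos2Dsin2 t) -[in RHS](sqr_sqrtr (ltW y0)).
by rewrite /fu /fb /fa; field; rewrite ?gt_eqF.
Qed.

Lemma fund_norm2 x y t : 0 < y -> 0 < t < pi ->
  top2 (fa y t) (fb x y t) (fu y t) ^+ 2 + fb x y t ^+ 2 = (x ^+ 2 + y ^+ 2) / y.
Proof.
move=> y0 tpi; rewrite fund_top2//.
have q0 : 0 < Num.sqrt y by rewrite sqrtr_gt0.
rewrite -(mulr1 (x ^+ 2 + y ^+ 2)) -(cos2Dsin2 t) -[in RHS](sqr_sqrtr (ltW y0)).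
by rewrite /fu /fb /fa; field; rewrite ?gt_eqF.
Qed.

(** Here [|v|^2 = 1/y], [v.v' = -x/y] and [|v'|^2 = (x^2 + y^2)/y], so that after multiplication by
    [y] Gauss reduction is membership in the standard fundamental domain. *)
Lemma fund_red x y t : 0 < y -> 0 < t < pi ->
  red (fa y t) (fb x y t) (fu y t) = (`|x| <= 2^-1) && (1 <= x ^+ 2 + y ^+ 2).
Proof.
move=> y0 tpi; rewrite /red fund_norm2// fund_dot// fund_norm//.
rewrite divr_gt0 ?sin_gt0_pi ?sqrtr_gt0//=; congr (_ && _).
  rewrite normrM normrN (gtr0_norm (x := y^-1)) ?invr_gt0// mulrA.
  by rewrite ger_pMl ?invr_gt0// mulrC -ler_pdivlMr// mul1r.
by rewrite ler_pdivlMr// mulVf// gt_eqF.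
Qed.

Local Open Scope ereal_scope.

(* da db du / a is Haar measure in the coordinates (a, b, u) of a basis. *)
Definition basis_vol (S : set (R * R * R)) : \bar R :=
  \int[mu]_(a in `]0%R, +oo[) \int[mu]_b ((a^-1)%:E * \int[mu]_u (\1_S ((a, b), u))%:E).

Variable S : set (R * R * R).
Hypothesis mS : measurable S.
Hypothesis S0 : forall a b u, S ((a, b), u) -> (0 < a)%R.

Let mG d (T : measurableType d) (f : T -> R * R * R) : measurable_fun setT f ->
  measurable_fun setT (fun z => (\1_S (f z) : R)%:E).
Proof.
move=> mf; apply/measurable_EFinP; apply: (measurableT_comp _ mf).
exact: measurable_indic.
Qed.

(** [fund_integral] needs [b] innermost, since [x] enters the coordinates through [b] only. *)
Lemma basis_vol_swap : basis_vol S =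
  \int[mu]_(a in `]0%R, +oo[) \int[mu]_u ((a^-1)%:E * \int[mu]_b (\1_S ((a, b), u))%:E).
Proof.
apply: eq_integral => a /set_mem/=; rewrite in_itv/= andbT => a0.
have G0 z : 0 <= (\1_S z : R)%:E by rewrite lee_fin.
have m1 : measurable_fun [set: R * R] (fun bu => (\1_S ((a, bu.1), bu.2) : R)%:E).
  by apply: mG; mfun.
rewrite ge0_integralZl//.
- rewrite ge0_integralZl//.
  + congr (_ * _).
    exact: (@fubini_tonelli _ _ _ _ R mu mu (fun bu => (\1_S ((a, bu.1), bu.2) : R)%:E)).
  + exact: (@measurable_fun_fubini_tonelli_G _ _ (measurableTypeR R) (measurableTypeR R) R mu _ m1 (fun=> G0 _)).
  + by move=> u _; exact: integral_ge0.
  + by rewrite lee_fin invr_ge0 ltW.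
- exact: (@measurable_fun_fubini_tonelli_F _ _ (measurableTypeR R) (measurableTypeR R) R mu _ m1 (fun=> G0 _)).
- by move=> u _; exact: integral_ge0.
- by rewrite lee_fin invr_ge0 ltW.
Qed.
End fund.

Section tonelli.
Context {R : realType}.
Notation mu := (@lebesgue_measure R).
Local Open Scope ereal_scope.

Lemma measurable_int2 d (T : measurableType d) (f : T * R -> \bar R) :
  measurable_fun setT f -> (forall z, 0 <= f z) ->
  measurable_fun setT (fun x => \int[mu]_y f (x, y)).
Proof.
move=> mf f0.
exact: (@measurable_fun_fubini_tonelli_F _ _ T (measurableTypeR R) R mu f mf f0).
Qed.

Lemma tonelli_swap (f : R * R -> \bar R) :
  measurable_fun setT f -> (forall z, 0 <= f z) ->
  \int[mu]_x \int[mu]_y f (x, y) = \int[mu]_y \int[mu]_x f (x, y).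
Proof. by move=> mf f0; exact: (@fubini_tonelli _ _ _ _ R mu mu f). Qed.

Lemma tonelli_swap_in (A B : set R) (f : R * R -> \bar R) :
  measurable A -> measurable B ->
  measurable_fun setT f -> (forall z, 0 <= f z) ->
  \int[mu]_(x in A) \int[mu]_(y in B) f (x, y) =
  \int[mu]_(y in B) \int[mu]_(x in A) f (x, y).
Proof.
move=> mA mB mf f0.
pose g (z : R * R) := f z * (\1_A z.1 : R)%:E * (\1_B z.2 : R)%:E.
have mg : measurable_fun setT g.
  apply: emeasurable_funM; first apply: emeasurable_funM => //.
  - by apply/measurable_EFinP; apply: (measurableT_comp _ measurable_fst); exact: measurable_indic.
  - by apply/measurable_EFinP; apply: (measurableT_comp _ measurable_snd); exact: measurable_indic.
have g0 z : 0 <= g z by rewrite !mule_ge0// lee_fin.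
transitivity (\int[mu]_x \int[mu]_y g (x, y)).
  rewrite integral_mkcond; apply: eq_integral => x _; rewrite patchE.
  rewrite integral_mkcond; case: ifPn => xA; last first.
    by rewrite integral0_eq// => y _; rewrite /g/= indicE (negbTE xA) mule0 mul0e.
  apply: eq_integral => y _; rewrite patchE /g/= !indicE xA mule1.
  by case: ifPn; rewrite ?mule1 ?mule0.
rewrite tonelli_swap//; apply/esym.
rewrite integral_mkcond; apply: eq_integral => y _; rewrite patchE.
rewrite integral_mkcond; case: ifPn => yB; last first.
  by rewrite integral0_eq// => x _; rewrite /g/= [\1_B y]indicE (negbTE yB) mule0.
apply: eq_integral => x _; rewrite patchE /g/= !indicE yB mule1.
by case: ifPn; rewrite ?mule1 ?mule0.
Qed.
End tonelli.

Section lebesgue2.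
Context {R : realType}.
Notation mu := (@lebesgue_measure R).
Local Notation mR := (measurableTypeR R).

(* A named copy of the planar Lebesgue measure: the library only infers the
   sigma-finiteness of a product when both factors are subprobabilities. *)
Definition lebesgue2 : set (mR * mR) -> \bar R := (mu \x mu)%E.
HB.instance Definition _ := Measure.copy lebesgue2 (mu \x mu)%E.

Lemma lebesgue2_sigma_finite : sigma_finite [set: mR * mR] lebesgue2.
Proof.
pose F (n : nat) : set mR := `](- n%:R), n%:R]%classic.
have mF n : (mu (F n) < +oo)%E.
  by rewrite lebesgue_measure_itv/=; case: ifP => //; rewrite ltry.
exists (fun n => F n `*` F n).
  apply/seteqP; split=> // -[x y] _.
  exists (Num.truncn (Num.max `|x| `|y|)).+1 => //; split=> /=; rewrite /F/= in_itv/=.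
    have := le_lt_trans _ (truncnS_gt (Num.max `|x| `|y|)) => /(_ `|x|).
    by rewrite le_max lexx => /(_ isT); rewrite ltr_norml => /andP[-> /ltW ->].
  have := le_lt_trans _ (truncnS_gt (Num.max `|x| `|y|)) => /(_ `|y|).
  by rewrite le_max lexx orbT => /(_ isT); rewrite ltr_norml => /andP[-> /ltW ->].
move=> n; split; first by apply: measurableX; exact: measurable_itv.
have -> : lebesgue2 (F n `*` F n) = (mu (F n) * mu (F n))%E.
  by apply: (@product_measure1E _ _ mR mR R mu mu); exact: measurable_itv.
by rewrite lte_mul_pinfty// ge0_fin_numE.
Qed.
HB.instance Definition _ := Measure_isSigmaFinite.Build _ _ _ lebesgue2 lebesgue2_sigma_finite.
End lebesgue2.

(** * Haar measure in the coordinates of a basis *)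

Section fund_int.

Context {R : realType}.
Notation mu := (@lebesgue_measure R).
Local Open Scope ereal_scope.

Lemma measurable_fund_dom : measurable (@fund_dom R).
Proof.
rewrite (_ : @fund_dom R = [set v | `|v.1.1| <= 2^-1]%R `&`
  ([set v | 1 <= v.1.1 ^+ 2 + v.1.2 ^+ 2]%R `&` ([set v | 0 < v.1.2]%R `&`
  ([set v : R * R * R | 0 <= v.2]%R `&` [set v | v.2 < pi]%R)))).
  apply: measurableI; first by apply: measurable_set_le; mfun.
  apply: measurableI; first by apply: measurable_set_le; mfun.
  apply: measurableI; first by apply: measurable_set_lt; mfun.
  apply: measurableI; first by apply: measurable_set_le; mfun.
  by apply: measurable_set_lt; mfun.
apply/seteqP; split=> v /=; rewrite /fund_dom/=.
  by move=> [? [? [? /andP[]]]].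
by move=> [? [? [? [? ?]]]]; do 3!split=> //; apply/andP.
Qed.

Local Notation mR := (measurableTypeR R).
Variables (S P : set (R * R * R)).
Hypothesis mS : measurable S.
Hypothesis mP : measurable P.
Hypothesis S0 : forall a b u, S ((a, b), u) -> (0 < a)%R.
Hypothesis SP : forall x y t, (0 < y)%R -> (0 < t < pi)%R ->
  (fund_dom ((x, y), t) /\ P ((x, y), t)) <-> S ((fa y t, fb x y t), fu y t).

Let mG d (T : measurableType d) (f : T -> R * R * R) : measurable_fun setT f ->
  measurable_fun setT (fun z => (\1_S (f z) : R)%:E).
Proof.
move=> mf; apply/measurable_EFinP; apply: (measurableT_comp _ mf).
exact: measurable_indic.
Qed.

Let Psi (z : R * R) : \bar R := (z.1^-1)%:E * \int[mu]_b (\1_S ((z.1, b), z.2))%:E.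

Let Psi0 z : 0 <= Psi z.
Proof.
have [a0|a0] := ltP 0%R z.1.
  rewrite /Psi; apply: mule_ge0; first by rewrite lee_fin invr_ge0 ltW.
  by apply: integral_ge0 => b _; rewrite lee_fin.
rewrite /Psi integral0_eq ?mule0// => b _.
rewrite indicE memNset// => /S0; rewrite ltNge a0//.
Qed.

Let mPsi : measurable_fun setT Psi.
Proof.
apply: emeasurable_funM; first by apply/measurable_EFinP; mfun.
apply: (@measurable_int2 R _ _ (fun zb => (\1_S ((zb.1.1, zb.2), zb.1.2))%:E)) => //.
by apply: mG; mfun.
Qed.

(** One variable is changed at a time: [x] to [b] at fixed [y, t] (factor [1/a]), then
    [y = sin^2 t / a^2] at fixed [t], where [dy / y^2] becomes [2 a da / sin^2 t], then [t] to
    [u = - a cot t] at fixed [a], where [a dt / sin^2 t] becomes [du]. The second change produces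
    the factor 2. *)
Lemma fund_integral :
  \int[@leb3 R]_(v in @fund_dom R) ((v.1.2 ^- 2) * \1_P v)%:E = 2%:E * basis_vol S.
Proof.
have mD := measurable_fund_dom.
pose H (v : R * R * R) : \bar R := (v.1.2 ^- 2 * \1_(@fund_dom R `&` P) v)%:E.
have mH : measurable_fun setT H.
  apply/measurable_EFinP; apply: measurable_funM; first by mfun.
  by apply: measurable_indic; exact: measurableI.
have H0 v : 0 <= H v.
  by rewrite lee_fin mulr_ge0// invr_ge0 sqr_ge0.
have -> : \int[@leb3 R]_(v in @fund_dom R) ((v.1.2 ^- 2) * \1_P v)%:E = \int[@leb3 R]_v H v.
  rewrite integral_mkcond; apply: eq_integral => v _.
  rewrite patchE /H !indicE in_setI; case: ifPn => //=.
  by rewrite mulr0.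
transitivity (\int[mu]_t \int[@lebesgue2 R]_xy H (xy, t)).
  have E1 := @fubini_tonelli1 _ _ (mR * mR)%type mR R lebesgue2 mu H mH H0.
  have E2 := @fubini_tonelli _ _ (mR * mR)%type mR R lebesgue2 mu H mH H0.
  exact: etrans E1 E2.
transitivity (\int[mu]_(t in `]0%R, pi[) \int[mu]_(a in `]0%R, +oo[)
    (Psi (a, - a * cos t / sin t)%R * (2 * `|a| / sin t ^+ 2)%:E)).
  have mHt : measurable_fun setT (fun t => \int[@lebesgue2 R]_xy H (xy, t)).
    exact: (@measurable_fun_fubini_tonelli_G _ _ (mR * mR)%type mR R lebesgue2 H mH H0).
  transitivity (\int[mu]_(t in `[0%R, pi[) \int[@lebesgue2 R]_xy H (xy, t)).
    rewrite [RHS]integral_mkcond; apply: eq_integral => t _; rewrite patchE.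
    case: ifPn => // /negP ht; rewrite integral0_eq// => xy _.
    rewrite /H indicE memNset ?mulr0// => -[[_ [_ [_ h]]] _].
    by apply: ht; apply/mem_set; rewrite /= in_itv.
  (* The angle [t = 0], where [sin t] vanishes, is null and is dropped. *)
  rewrite -integral_itv_obnd_cbnd; last exact: measurable_funTS.
  apply: eq_integral => t /set_mem/=; rewrite in_itv/= => tpi.
  have s0 := sin_gt0_pi tpi.
  pose g (y : R) := (y ^- 2)%:E * Psi (fa y t, fu y t).
  have g0 y : 0 <= g y.
    by apply: mule_ge0 => //; rewrite lee_fin invr_ge0 sqr_ge0.
  have mg : measurable_fun setT g.
    apply: emeasurable_funM; first by apply/measurable_EFinP; mfun.
    by apply: (measurableT_comp mPsi); rewrite /fa /fu; mfun.
  transitivity (\int[mu]_(y in `]0%R, +oo[) g y); last first.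
    rewrite -(ge0_subst_invsq s0 mg g0).
    apply: eq_integral => a /set_mem/=; rewrite in_itv/= andbT => a0.
    have sq : (Num.sqrt (sin t ^+ 2 / a ^+ 2) = sin t / a)%R.
      by rewrite -expr_div_n sqrtr_sqr ger0_norm// divr_ge0// ltW.
    rewrite /g /fa /fu sq.
    rewrite (_ : sin t / (sin t / a) = a)%R; last by field; rewrite !gt_eqF.
    rewrite (_ : - cos t / (sin t / a) = - a * cos t / sin t)%R; last first.
      by field; rewrite !gt_eqF.
    rewrite muleAC -EFinM muleC gtr0_norm//; congr (_ * _%:E).
    by field; rewrite !gt_eqF.
  have mHt' : measurable_fun setT (fun xy => H (xy, t)).
    by apply: (measurableT_comp mH); mfun.
  have E1 := @fubini_tonelli1 _ _ mR mR R mu mu _ mHt' (fun=> H0 _).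
  have E2 := @fubini_tonelli _ _ mR mR R mu mu _ mHt' (fun=> H0 _).
  apply: etrans E1 _; apply: etrans E2 _; rewrite /fubini_G.
  rewrite [RHS]integral_mkcond; apply: eq_integral => y _; rewrite patchE.
  case: ifPn => [|/negP hy]; last first.
    rewrite integral0_eq// => x _.
    rewrite /H indicE memNset ?mulr0// => -[[_ [_ [h _]]] _].
    by apply: hy; apply/mem_set; rewrite /= in_itv/= h.
  move=> /set_mem/=; rewrite in_itv/= andbT => y0.
  have a0 : (0 < fa y t)%R by rewrite divr_gt0// sqrtr_gt0.
  rewrite /g /Psi/=.
  (* At fixed [y, t] the coordinate [b] is affine in [x] with slope [- fa y t]. *)
  have := @ge0_integral_affine R (- fa y t) (- (cos t * Num.sqrt y))
    (fun b => (\1_S ((fa y t, b), fu y t))%:E).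
  rewrite oppr_eq0 gt_eqF// normrN gtr0_norm// => /(_ isT) <-.
  - rewrite -ge0_integralZl//.
    + apply: eq_integral => x _; rewrite /H/= -EFinM; congr ((_ * _)%:E).
      rewrite !indicE; congr (_%:R); congr (nat_of_bool _).
      apply/idP/idP => /set_mem h; apply/mem_set.
        by move/(SP x y0 tpi) : h; rewrite /fb.
      by apply/(SP x y0 tpi).
    + by apply: mG; mfun.
    + by rewrite lee_fin invr_ge0 sqr_ge0.
  - by apply: mG; mfun.
  - by move=> x; rewrite lee_fin.
(* The absolute value makes [f] nonnegative on the whole plane, as Tonelli requires; it is invisible
   on [a > 0]. *)
pose f (z : R * R) := Psi (z.2, - z.2 * cos z.1 / sin z.1)%R * (2 * `|z.2| / sin z.1 ^+ 2)%:E.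
have f0 z : 0 <= f z.
  by apply: mule_ge0 => //; rewrite lee_fin divr_ge0 ?sqr_ge0// mulr_ge0.
have mf : measurable_fun setT f.
  apply: emeasurable_funM; last by apply/measurable_EFinP; mfun.
  by apply: (measurableT_comp mPsi); mfun.
rewrite -[LHS]/(\int[mu]_(t in `]0%R, pi[) \int[mu]_(a in `]0%R, +oo[) f (t, a)).
rewrite (tonelli_swap_in _ _ mf f0)//.
have mPu : measurable_fun setT (fun a : R => \int[mu]_u Psi (a, u)).
  exact: (measurable_int2 mPsi Psi0).
rewrite (basis_vol_swap mS) -ge0_integralZl//; last 2 first.
- exact: measurable_funTS.
- by move=> a _; apply: integral_ge0 => u _; exact: (Psi0 (a, u)).
apply: eq_integral => a /set_mem/=; rewrite in_itv/= andbT => a0.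
have mPa : measurable_fun setT (fun u => Psi (a, u)).
  by apply: (measurableT_comp mPsi); mfun.
rewrite -[X in _ = _ * X](ge0_subst_cot a0 mPa (fun=> Psi0 _)).
rewrite -ge0_integralZl//.
- apply: eq_integral => t _; rewrite /f/= gtr0_norm// muleCA -EFinM.
  by congr (_ * _%:E); rewrite mulrA.
- apply: measurable_funTS; apply: emeasurable_funM; last by apply/measurable_EFinP; mfun.
  by apply: (measurableT_comp mPsi); mfun.
- move=> t _; apply: mule_ge0 => //; rewrite lee_fin divr_ge0 ?sqr_ge0// ltW//.
Qed.
End fund_int.

(** * Volume of the fundamental domain *)

Section volume.
Context {R : realType}.
Notation mu := (@lebesgue_measure R).
Local Notation mR := (measurableTypeR R).
Local Open Scope ereal_scope.

Lemma asin_half : asin (2^-1 : R)%R = (pi / 6)%R.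
Proof.
have pi0 := pi_gt0 R.
have cx : (0 < cos (pi / 6 : R))%R by apply: cos_gt0_pihalf; lra.
have sx : (sin (pi / 6) = 2^-1 :> R)%R.
  (* For [x = pi/6], [sin 2x = cos x] since [2x = pi/2 - x]; dividing [2 sin x cos x = cos x] by
     [cos x] gives [sin x = 1/2]. *)
  have h : (sin (pi / 6 + pi / 6) = cos (pi / 6 : R))%R.
    rewrite (_ : pi / 6 + pi / 6 = pi / 2 - pi / 6)%R; last by field.
    by rewrite sinB sin_pihalf cos_pihalf mul1r mul0r subr0.
  have : (cos (pi / 6) * (2 * sin (pi / 6) - 1) = 0 :> R)%R.
    by rewrite mulrBr mulr1 -[X in (_ - X)%R = _]h sinD; ring.
  move/eqP; rewrite mulf_eq0 gt_eqF//= subr_eq0 => /eqP h2.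
  by rewrite -[LHS](mulKf (_ : (2 != 0 :> R)%R))// h2 mulr1.
by rewrite -sx sinK// in_itv/=; lra.
Qed.

Lemma integral_invsq (s : R) : (0 < s)%R ->
  \int[mu]_(y in `[s, +oo[) (y ^- 2)%:E = (s^-1)%:E.
Proof.
move=> s0.
have dF (x : R) : (0 < x)%R -> is_derive x 1%R (fun y : R => - y^-1)%R (x ^- 2)%R.
  move=> x0; have xn0 : (x != 0)%R by rewrite gt_eqF.
  have H2 : is_derive x 1%R (fun y : R => - y^-1)%R _ :=
    is_deriveN (@is_deriveV _ id x _ _ xn0 (is_derive_id x 1%R)).
  apply: is_derive_eq H2 _.
  by rewrite /GRing.scale/= mulr1 opprK.
have cf (x : R) : (0 < x)%R -> {for x, continuous (fun y : R => y ^- 2)%R}.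
  by move=> x0; apply: continuousV; [rewrite expf_neq0// gt_eqF|exact: exprn_continuous].
rewrite (@ge0_continuous_FTC2y _ _ (fun y : R => - y^-1)%R _ 0%R).
- by rewrite sub0e -EFinN opprK.
- by move=> x _; rewrite invr_ge0 sqr_ge0.
- apply: continuous_in_subspaceT => x /set_mem/=; rewrite in_itv/= andbT => rx.
  by apply: cf; exact: lt_le_trans rx.
- rewrite -[X in _ --> X]oppr0; apply: cvgN.
  apply/cvgrPdist_lt => e e0; near=> x.
  have x0 : (0 < x)%R by near: x; apply: nbhs_pinfty_gt; rewrite num_real.
  rewrite sub0r normrN gtr0_norm ?invr_gt0//.
  rewrite invf_plt ?posrE//.
  by near: x; apply: nbhs_pinfty_gt; rewrite num_real.
- by move=> x rx; have [] := dF x (lt_trans s0 rx).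
- apply: cvg_at_right_filter.
  have cF : {for s, continuous (fun y : R => - y^-1)%R}.
    apply/differentiable_continuous/derivable1_diffP.
    by have [] := dF _ s0.
  exact: cF.
- move=> x; rewrite in_itv/= andbT => rx.
  have h := dF x (lt_trans s0 rx).
  by rewrite derive1E; exact: derive_val.
Unshelve. all: by end_near. Qed.

Lemma integral_asin :
  \int[mu]_(x in `[(- 2^-1)%R, 2^-1%R]) ((Num.sqrt (1 - x ^+ 2))^-1)%:E = (pi / 3 : R)%:E.
Proof.
have h01 (x : R) : (- 2^-1 <= x <= 2^-1)%R -> (-1 < x < 1)%R by lra.
have d (x : R) : (- 2^-1 <= x <= 2^-1)%R -> is_derive x 1%R (@asin R) ((Num.sqrt (1 - x ^+ 2))^-1)%R.
  by move=> /h01 h; exact: is_derive1_asin.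
have c (x : R) : (- 2^-1 <= x <= 2^-1)%R -> {for x, continuous (fun x : R => (Num.sqrt (1 - x ^+ 2))^-1)%R}.
  move=> /h01 /andP[h1 h2]; apply: continuousV.
    by rewrite gt_eqF// sqrtr_gt0 subr_gt0 expr2; nra.
  apply: (@continuous_comp _ _ _ (fun x : R => 1 - x ^+ 2)%R (@Num.sqrt R)); last exact: sqrt_continuous.
  by apply: continuousB; [exact: cvg_cst|exact: exprn_continuous].
rewrite (FTC_is_derive _ d c); last by lra.
have pi0 := pi_gt0 R.
have -> : asin (- 2^-1)%R = (- (pi / 6) : R)%R.
  rewrite -(@asinK R 2^-1)%R ?asin_half; last by rewrite in_itv/=; lra.
  by rewrite -sinN sinK// in_itv/=; lra.
by rewrite asin_half; congr EFin; field.
Qed.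

(** For fixed [x] the variable [y] runs over [[sqrt(1 - x^2), +oo[], of weight [1 / sqrt(1 - x^2)];
    integrated over [|x| <= 1/2] this gives [2 asin(1/2) = pi/3], and the angle contributes [pi]. *)
Lemma fund_volume : \int[@leb3 R]_(v in @fund_dom R) (v.1.2 ^- 2)%:E = (pi ^+ 2 / 3 : R)%:E.
Proof.
have mD := @measurable_fund_dom R.
pose H (v : R * R * R) : \bar R := (v.1.2 ^- 2 * \1_(@fund_dom R) v)%:E.
have mH : measurable_fun setT H.
  apply/measurable_EFinP; apply: measurable_funM; first by mfun.
  exact: measurable_indic.
have H0 v : 0 <= H v.
  by rewrite lee_fin mulr_ge0// invr_ge0 sqr_ge0.
transitivity (\int[@leb3 R]_v H v).
  rewrite integral_mkcond; apply: eq_integral => v _.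
  by rewrite patchE /H indicE; case: ifPn; rewrite ?mulr1 ?mulr0.
transitivity (\int[mu]_t \int[@lebesgue2 R]_xy H (xy, t)).
  have E1 := @fubini_tonelli1 _ _ (mR * mR)%type mR R lebesgue2 mu H mH H0.
  have E2 := @fubini_tonelli _ _ (mR * mR)%type mR R lebesgue2 mu H mH H0.
  exact: etrans E1 E2.
transitivity (\int[mu]_(t in `[0%R, (pi : R)[) cst (pi / 3 : R)%:E t); last first.
  rewrite integral_cst//= lebesgue_measure_itv/= lte_fin pi_gt0 oppr0 adde0 -EFinM.
  by congr EFin; field.
rewrite [RHS]integral_mkcond; apply: eq_integral => t _; rewrite patchE.
case: ifPn => [|/negP ht]; last first.
  rewrite integral0_eq// => xy _.
  rewrite /H indicE memNset ?mulr0// => -[_ [_ [_ h]]].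
  by apply: ht; apply/mem_set; rewrite /= in_itv.
move=> /set_mem/=; rewrite in_itv/= => tpi.
have mHt' : measurable_fun setT (fun xy => H (xy, t)).
  by apply: (measurableT_comp mH); mfun.
have E1 := @fubini_tonelli1 _ _ mR mR R mu mu _ mHt' (fun=> H0 _).
apply: etrans E1 _; rewrite /fubini_F -integral_asin.
rewrite [RHS]integral_mkcond; apply: eq_integral => x _; rewrite patchE.
case: ifPn => [|/negP hx]; last first.
  rewrite integral0_eq// => y _.
  rewrite /H indicE memNset ?mulr0// => -[/= h _].
  by apply: hx; apply/mem_set; rewrite /= in_itv/= -ler_norml.
move=> /set_mem/=; rewrite in_itv/= => xh.
have s0 : (0 < Num.sqrt (1 - x ^+ 2))%R by rewrite sqrtr_gt0; nra.
rewrite -(integral_invsq s0) [RHS]integral_mkcond; apply: eq_integral => y _.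
rewrite patchE /H/= indicE.
have -> : ((x, y, t) \in @fund_dom R) = (y \in `[(Num.sqrt (1 - x ^+ 2))%R, +oo[%classic).
  apply/idP/idP => /set_mem/= h; apply/mem_set; move: h; rewrite /fund_dom/= in_itv/= andbT.
    move=> [_ [h [y0 _]]]; rewrite -(@ger0_norm _ y) ?(ltW y0)// -sqrtr_sqr ler_wsqrtr//; lra.
  move=> h; split; first by rewrite ler_norml.
  have y0 : (0 < y)%R := lt_le_trans s0 h.
  split; last by [].
  have : (Num.sqrt (1 - x ^+ 2) ^+ 2 <= y ^+ 2)%R.
    by rewrite ler_sqr ?nnegrE ?sqrtr_ge0 ?(ltW y0).
  by rewrite sqr_sqrtr; [lra|nra].
by case: ifPn; rewrite ?mulr1 ?mulr0.
Qed.
End volume.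

(** * Reduced bases of the lattices Lambda_N(alpha) *)
Section reduction.
Context {R : realType}.
Variables (N : nat) (alpha : R).
Hypothesis N0 : (0 < N)%N.
Let NR : R := N%:R.
Let NR0 : 0 < NR. Proof. by rewrite ltr0n. Qed.

(* (vtop p q, vbot q) is the vector of Lambda_N(alpha) with coordinates (p, q). *)
Definition vtop (p q : int) : R := N%:R * (alpha * q%:~R - p%:~R).
Definition vbot (q : int) : R := q%:~R / N%:R.
Definition vnorm p q : R := vtop p q ^+ 2 + vbot q ^+ 2.

Lemma top2_basis (p q p' q' : int) : 0 < q -> p' * q - p * q' = 1 ->
  top2 (vbot q) (vbot q') (vtop p q) = vtop p' q'.
Proof.
move=> q0 det; rewrite /top2 /vbot /vtop.
have detR : p'%:~R * q%:~R - p%:~R * q'%:~R = 1 :> R.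
  by rewrite -!intrM -intrB det.
have qn0 : q%:~R != 0 :> R by rewrite intr_eq0 gt_eqF.
have Nn0 : N%:R != 0 :> R by rewrite gt_eqF.
rewrite -[X in _ - X]detR; field.
by rewrite Nn0 qn0.
Qed.

Definition vdot (p q p' q' : int) : R := vtop p q * vtop p' q' + vbot q * vbot q'.

Lemma redE (p q p' q' : int) : 0 < q -> p' * q - p * q' = 1 ->
  red (vbot q) (vbot q') (vtop p q) =
  (2 * `|vdot p q p' q'| <= vnorm p q) && (vnorm p q <= vnorm p' q').
Proof.
move=> q0 det; rewrite /red /dotv (top2_basis q0 det).
by rewrite {1}/vbot divr_gt0 ?ltr0z.
Qed.

Lemma sredE (p q p' q' : int) : 0 < q -> p' * q - p * q' = 1 ->
  sred (vbot q) (vbot q') (vtop p q) =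
  (2 * `|vdot p q p' q'| < vnorm p q) && (vnorm p q < vnorm p' q').
Proof.
move=> q0 det; rewrite /sred /dotv (top2_basis q0 det).
by rewrite {1}/vbot divr_gt0 ?ltr0z.
Qed.

Lemma vnorm_comb (m n p q p' q' : int) :
  vnorm (m * p + n * p') (m * q + n * q') =
  m%:~R ^+ 2 * vnorm p q + 2 * m%:~R * n%:~R * vdot p q p' q' + n%:~R ^+ 2 * vnorm p' q'.
Proof. rewrite /vnorm /vdot /vtop /vbot !intrD !intrM; ring. Qed.

Lemma vnorm_gt0 p q : (p != 0) || (q != 0) -> 0 < vnorm p q.
Proof.
move=> pq; rewrite lt_def addr_ge0 ?sqr_ge0// andbT.
rewrite paddr_eq0 ?sqr_ge0// !sqrf_eq0 negb_and.
have [q0|q0] := eqVneq q 0.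
  move: pq; rewrite q0 eqxx orbF => p0.
  by rewrite /vtop mulr0 sub0r mulrN oppr_eq0 mulf_neq0 ?intr_eq0// gt_eqF.
by rewrite orbC /vbot mulf_neq0 ?intr_eq0// invr_eq0 gt_eqF.
Qed.

(** The form is at least [(m^2 - |m n| + n^2) W], strictly so because [n != 0], and the integer in
    front of [W] is at least 1. *)
Lemma sred_shorter (m n p q p' q' : int) :
  2 * `|vdot p q p' q'| < vnorm p q -> vnorm p q < vnorm p' q' -> n != 0 ->
  vnorm p q < vnorm (m * p + n * p') (m * q + n * q').
Proof.
move=> hd hn n0; rewrite vnorm_comb.
set W := vnorm p q in hd hn *; set W' := vnorm p' q' in hn *; set d := vdot _ _ _ _ in hd *.
have W0 : 0 < W by apply: le_lt_trans hd; rewrite mulr_ge0.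
have hmn : (1 : R) <= m%:~R ^+ 2 - `|m%:~R| * `|n%:~R| + n%:~R ^+ 2.
  rewrite -!intr_norm -!rmorphXn/= -intrM -intrB -intrD ler1z.
  rewrite -[m ^+ 2]real_normK ?num_real// -[n ^+ 2]real_normK ?num_real//.
  have : 1 <= `|n| by rewrite -gtz0_ge1 normr_gt0.
  have [m0|m0] := eqVneq m 0; first by rewrite m0 normr0; nia.
  have : 1 <= `|m| by rewrite -gtz0_ge1 normr_gt0.
  by nia.
have h1 : - (`|m%:~R| * `|n%:~R| * W) <= 2 * m%:~R * n%:~R * d.
  have : `|2 * m%:~R * n%:~R * d| <= `|m%:~R| * `|n%:~R| * W.
    rewrite !normrM (@ger0_norm _ 2)//.
    rewrite (_ : _ * _ * _ * _ = `|m%:~R| * `|n%:~R| * (2 * `|d|)); last by ring.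
    by apply: ler_wpM2l; rewrite ?mulr_ge0// ltW.
  by rewrite ler_norml => /andP[].
have n2 : (0 : R) < n%:~R ^+ 2 by rewrite exprn_even_gt0//= intr_eq0.
have h2 : n%:~R ^+ 2 * W < n%:~R ^+ 2 * W' by rewrite ltr_pM2l.
have h3 : W <= (m%:~R ^+ 2 - `|m%:~R| * `|n%:~R| + n%:~R ^+ 2) * W.
  by rewrite ler_pMl.
by lra.
Qed.

(** If the first vectors were independent, each would be strictly longer than the other by
    [sred_shorter]. So they agree up to sign, [q > 0] fixes the sign, and the second vectors then
    differ by a multiple [k] of the first. *)
Lemma sred_unique (p q p' q' P Q P' Q' : int) :
  0 < q -> 0 < Q -> p' * q - p * q' = 1 -> P' * Q - P * Q' = 1 ->
  sred (vbot q) (vbot q') (vtop p q) -> sred (vbot Q) (vbot Q') (vtop P Q) ->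
  [/\ p = P, q = Q, p' = P' & q' = Q'].
Proof.
move=> q0 Q0 det Det; rewrite (sredE q0 det) (sredE Q0 Det) => /andP[d1 n1] /andP[d2 n2].
pose n := P * q - Q * p; pose m := Q * p' - P * q'.
have eP : P = m * p + n * p'.
  by rewrite /m /n -[LHS]mulr1 -det; ring.
have eQ : Q = m * q + n * q'.
  by rewrite /m /n -[LHS]mulr1 -det; ring.
have n0 : n = 0.
  apply/eqP/negP => /negP n0.
  have := sred_shorter m d1 n1 n0; rewrite -eP -eQ => lt1.
  pose m' := q * P' - p * Q'.
  have nn0 : - n != 0 by rewrite oppr_eq0.
  have ep : p = m' * P + (- n) * P'.
    by rewrite /m' /n -[LHS]mulr1 -Det; ring.
  have eq : q = m' * Q + (- n) * Q'.
    by rewrite /m' /n -[LHS]mulr1 -Det; ring.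
  have := sred_shorter m' d2 n2 nn0; rewrite -ep -eq => lt2.
  by have := lt_trans lt1 lt2; rewrite ltxx.
rewrite n0 !mul0r !addr0 in eP eQ.
have m1 : m = 1.
  have := Det; rewrite eP eQ (_ : _ - _ = m * (P' * q - p * Q')); last by ring.
  move=> h; have : (m %| 1)%Z by apply/dvdzP; exists (P' * q - p * Q'); rewrite mulrC h.
  rewrite dvdz1 => /eqP h1.
  have : 0 < m by move: Q0; rewrite eQ pmulr_lgt0.
  by lia.
rewrite m1 !mul1r in eP eQ; subst P Q.
pose k := p' * (Q' - q') - q' * (P' - p').
have eQ' : Q' = q' + k * q.
  apply/eqP; rewrite addrC -subr_eq; apply/eqP.
  have h : (P' - p') * q = p * (Q' - q') by move: det Det; lia.
  rewrite -[LHS]mulr1 -det (_ : _ * _ = p' * q * (Q' - q') - q' * (p * (Q' - q'))); last by ring.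
  by rewrite -h /k; ring.
have eP' : P' = p' + k * p.
  apply/eqP; rewrite addrC -subr_eq; apply/eqP.
  have h : (P' - p') * q = p * (Q' - q') by move: det Det; lia.
  rewrite -[LHS]mulr1 -det (_ : _ * _ = p' * ((P' - p') * q) - q' * p * (P' - p')); last by ring.
  by rewrite h /k; ring.
(* Both scalar products are below half of [|v|^2] in absolute value, while they differ by
   [k |v|^2]. *)
clearbody k; have k0 : k = 0.
  have dd : vdot p q P' Q' = vdot p q p' q' + k%:~R * vnorm p q.
    by rewrite eP' eQ' /vdot /vnorm /vtop /vbot !intrD !intrM; ring.
  rewrite dd in d2.
  have W0 : 0 < vnorm p q by apply: le_lt_trans d1; rewrite mulr_ge0.
  have : `|k%:~R * vnorm p q| < 1 * vnorm p q.
    rewrite (_ : k%:~R * _ = (vdot p q p' q' + k%:~R * vnorm p q) - vdot p q p' q'); last by ring.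
    by apply: le_lt_trans (ler_normB _ _) _; lra.
  rewrite normrM (gtr0_norm W0) ltr_pM2r// -intr_norm ltrz1.
  by lia.
by rewrite eP' eQ' k0 !mul0r !addr0.
Qed.

Lemma seq_argmin (T : eqType) (f : T -> R) (x0 : T) (s : seq T) : x0 \in s ->
  exists2 x, x \in s & forall y, y \in s -> f x <= f y.
Proof.
elim: s x0 => // a s IH x0 _.
case: s IH => [_|b s IH].
  by exists a; rewrite ?mem_head// => y; rewrite inE => /eqP ->.
have [x xs hx] := IH b (mem_head _ _).
have [ax|xa] := leP (f a) (f x).
  exists a; first exact: mem_head.
  move=> y; rewrite in_cons => /predU1P[->//|/hx]; exact: le_trans.
exists x; first by rewrite in_cons xs orbT.
by move=> y; rewrite in_cons => /predU1P[->|/hx//]; exact: ltW.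
Qed.

Lemma sq_le (x y : R) : 0 <= y -> x ^+ 2 <= y ^+ 2 -> `|x| <= y.
Proof. by move=> y0; rewrite -(real_normK (num_real x)) ler_sqr ?nnegrE. Qed.

(** The vector [(1, 0)] has square norm [N^2], and one that is no longer has [|q| <= N^2] and
    [|alpha q - p| <= 1]; so the minimum is taken over a finite box. *)
Lemma vnorm_min : exists p q, ((p != 0) || (q != 0)) /\
  forall p' q', (p' != 0) || (q' != 0) -> vnorm p q <= vnorm p' q'.
Proof.
pose K := (Num.truncn ((`|alpha| + 1) * NR ^+ 2 + 1)).+1.
pose rg := [seq i%:Z - K%:Z | i <- iota 0 (2 * K).+1].
have in_rg (z : int) : `|z| <= K%:Z -> z \in rg.
  move=> zK; apply/mapP; exists (absz (z + K%:Z)); first by rewrite mem_iota; lia.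
  by lia.
pose s := [seq w <- [seq (i, j) | i <- rg, j <- rg] | (w.1 != 0) || (w.2 != 0)].
have in_s p q : (p != 0) || (q != 0) -> vnorm p q <= NR ^+ 2 -> (p, q) \in s.
  move=> pq hn; rewrite mem_filter pq/=.
  have hq : `|vbot q| <= NR.
    by apply: sq_le; [exact: ltW|apply: le_trans hn; rewrite lerDr sqr_ge0].
  have hp : `|vtop p q| <= NR.
    by apply: sq_le; [exact: ltW|apply: le_trans hn; rewrite lerDl sqr_ge0].
  have hq' : `|q%:~R : R| <= NR ^+ 2.
    move: hq; rewrite /vbot normrM normfV (gtr0_norm NR0) ler_pdivrMr//.
  have hp' : `|p%:~R : R| <= `|alpha| * NR ^+ 2 + 1.
    have h1 : `|alpha * q%:~R - p%:~R| <= 1.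
      by move: hp; rewrite /vtop normrM (gtr0_norm NR0) ger_pMr.
    rewrite (_ : p%:~R = alpha * q%:~R - (alpha * q%:~R - p%:~R)); last by ring.
    apply: le_trans (ler_normB _ _) _; rewrite lerD// normrM ler_wpM2l//.
  have KK : (`|alpha| + 1) * NR ^+ 2 + 1 <= K%:R by rewrite ltW// truncnS_gt.
  have N2 : 0 <= NR ^+ 2 by rewrite sqr_ge0.
  apply/(@allpairsP _ _ _ pair rg rg (p, q)); exists (p, q); split=> //=; apply: in_rg.
    by rewrite -(ler_int R) intr_norm; apply: le_trans hp' _; apply: le_trans KK; nra.
  rewrite -(ler_int R) intr_norm; apply: le_trans hq' _; apply: le_trans KK.
  have : 0 <= `|alpha| * NR ^+ 2 by rewrite mulr_ge0.
  by nra.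
have n10 : vnorm 1 0 = NR ^+ 2.
  by rewrite /vnorm /vtop /vbot mul0r expr0n addr0 mulr0 sub0r mulrN1 sqrrN.
have [|[p q] pqs hmin] := @seq_argmin _ (fun w => vnorm w.1 w.2) (1, 0) s.
  by apply: in_s => //; rewrite n10.
exists p, q; split; first by move: pqs; rewrite mem_filter => /andP[].
move=> p' q' pq'; have [h|h] := leP (vnorm p' q') (NR ^+ 2).
  exact: (hmin (p', q') (in_s _ _ pq' h)).
apply: le_trans (ltW h); rewrite -n10.
by apply: (hmin (1, 0)); apply: in_s => //; rewrite n10.
Qed.

Lemma round_int (x : R) : exists k : int, `|x - k%:~R| <= 2^-1.
Proof.
exists (Num.floor (x + 2^-1)).
have := floor_le_tmp (x + 2^-1); have := floorD1_gt (x + 2^-1).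
rewrite intrD ler_norml; lra.
Qed.

Lemma red_exists : (1 < N)%N -> exists p q p' q' : int,
  [/\ 0 < q, p' * q - p * q' = 1 & red (vbot q) (vbot q') (vtop p q)].
Proof.
move=> N1; have [p [q [pq0 hmin]]] := vnorm_min.
have NR2 : 2 <= NR by rewrite ler_nat.
wlog q0 : p q pq0 hmin / 0 <= q.
  move=> H; have [|q0] := leP 0 q; first exact: (H p q).
  apply: (H (- p) (- q)); rewrite ?oppr_eq0// ?oppr_ge0 ?ltW//.
  move=> p' q' h; rewrite (_ : vnorm (- p) (- q) = vnorm p q); first exact: hmin.
  by rewrite /vnorm /vtop /vbot !intrN; ring.
(* A shortest vector is not horizontal: [(p, 0)] has square norm at least [N^2], whereas [(k, 1)]
   with [k] nearest to [alpha] has at most [N^2/4 + 1/4]. *)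
have {}q0 : 0 < q.
  rewrite lt_neqAle q0 andbT eq_sym; apply/eqP => qe0; subst q.
  have [k hk] := round_int alpha.
  have := hmin k 1 (orbT _).
  rewrite /vnorm /vtop /vbot mul0r expr0n addr0 mulr0 sub0r mulr1 leNgt => /negP; apply.
  have p1 : (1 : R) <= p%:~R ^+ 2.
    have -> : p%:~R ^+ 2 = (p ^+ 2)%:~R :> R by rewrite rmorphXn.
    by rewrite ler1z; move: pq0; rewrite orbF; nia.
  have hk2 : (alpha - k%:~R) ^+ 2 <= 2^-1 ^+ 2.
    by rewrite -real_normK ?num_real// ler_sqr ?nnegrE.
  rewrite mulrN sqrrN !exprMn expr1n mul1r.
  have : (N%:R : R)^-1 ^+ 2 <= 2^-1 ^+ 2.
    by rewrite ler_sqr ?nnegrE ?invr_ge0// lef_pV2 ?posrE.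
  have : NR ^+ 2 * (alpha - k%:~R) ^+ 2 <= NR ^+ 2 * 2^-1 ^+ 2.
    by rewrite ler_wpM2l// sqr_ge0.
  have : NR ^+ 2 * 1 <= NR ^+ 2 * p%:~R ^+ 2 by rewrite ler_wpM2l// sqr_ge0.
  by rewrite -/NR; nra.
have W0 : 0 < vnorm p q by exact: vnorm_gt0.
(* A common divisor could be divided out, leaving a shorter vector. *)
have cop : gcdz p q = 1.
  set g := gcdz p q.
  have [p1 ep] : exists p1, p = p1 * g by apply/dvdzP; exact: dvdz_gcdl.
  have [q1 eq] : exists q1, q = q1 * g by apply/dvdzP; exact: dvdz_gcdr.
  have g0 : 0 <= g by [].
  have nz : (p1 != 0) || (q1 != 0).
    by apply/orP; right; apply/eqP => h; move: q0; rewrite eq h mul0r ltxx.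
  have := hmin _ _ nz; rewrite {1}ep {1}eq.
  rewrite (_ : vnorm (p1 * g) (q1 * g) = g%:~R ^+ 2 * vnorm p1 q1); last first.
    by rewrite /vnorm /vtop /vbot !intrM; ring.
  rewrite ger_pMl ?vnorm_gt0// => h.
  have : g ^+ 2 <= 1 by rewrite -(lerz1 R) rmorphXn.
  have : g != 0 by apply/eqP => h0; move: q0; rewrite eq h0 mulr0 ltxx.
  by nia.
(* Bezout completes the shortest vector to a basis; subtracting the right integer multiple of it
   brings the scalar product within half of its square norm. *)
have [x [y hxy]] := Bezoutz p q; rewrite cop in hxy.
pose q1 := - x; pose p1 := y.
have det1 : p1 * q - p * q1 = 1 by rewrite /p1 /q1; lia.
have [k hk] := round_int (vdot p q p1 q1 / vnorm p q).
exists p, q, (p1 - k * p), (q1 - k * q).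
have det : (p1 - k * p) * q - p * (q1 - k * q) = 1 by rewrite -det1; ring.
split=> //; rewrite (redE q0 det); apply/andP; split.
  rewrite (_ : vdot _ _ _ _ = (vdot p q p1 q1 / vnorm p q - k%:~R) * vnorm p q); last first.
    rewrite mulrBl divfK ?gt_eqF// /vdot /vnorm /vtop /vbot !intrB !intrM; ring.
  by rewrite normrM (gtr0_norm W0) mulrA ger_pMl//; lra.
apply: hmin; rewrite -negb_and; apply/negP => /andP[/eqP h1 /eqP h2].
by move: det; rewrite h1 h2 mulr0 mul0r subr0.
Qed.

(** Lagrange's identity reads [W W' - (v.v')^2 = 1]; with [W <= W'] and [2 |v.v'| <= W] it yields
    [3 W^2 <= 4]. *)
Lemma red_norm_bound (a b u : R) : red a b u -> u ^+ 2 + a ^+ 2 <= 2.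
Proof.
move=> /and3P[a0 h1 h2].
have lag : (u ^+ 2 + a ^+ 2) * (top2 a b u ^+ 2 + b ^+ 2) - dotv a b u ^+ 2 = 1.
  by rewrite /dotv /top2; field; rewrite gt_eqF.
set W := u ^+ 2 + a ^+ 2 in h1 h2 lag *; set W' := top2 _ _ _ ^+ 2 + _ in h2 lag.
have : (2 * `|dotv a b u|) ^+ 2 <= W ^+ 2.
  rewrite ler_sqr ?nnegrE ?mulr_ge0//; apply: le_trans h1; by rewrite mulr_ge0.
rewrite exprMn real_normK ?num_real// => h3.
have W0 : 0 <= W by rewrite addr_ge0 ?sqr_ge0.
by rewrite leNgt; apply/negP => h; nra.
Qed.
End reduction.

(** * Unfolding the integral over [alpha] into a sum over pairs *)

Section unfold.
Context {R : realType}.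
Notation mu := (@lebesgue_measure R).
Local Notation mR := (measurableTypeR R).

Lemma ge0_integral_fin (I : finType) (P : pred I) (D : set mR) (f : I -> R -> R) :
  measurable D -> (forall i, P i -> measurable_fun setT (f i)) ->
  (forall i x, P i -> 0 <= f i x) ->
  (\int[mu]_(x in D) (\sum_(i | P i) f i x)%:E =
   \sum_(i | P i) \int[mu]_(x in D) (f i x)%:E)%E.
Proof.
move=> mD mf f0.
pose h i (x : mR) : \bar R := (if P i then f i x else 0)%:E.
have mh i : measurable_fun D (h i).
  apply/measurable_EFinP/measurable_funTS; rewrite /h; case Pi : (P i) => //.
  exact: mf.
have h0 i x : D x -> (0 <= h i x)%E.
  by move=> _; rewrite lee_fin; case: ifPn => // Pi; exact: f0.
apply: etrans (_ : _ = \int[mu]_(x in D) \sum_(i <- index_enum I) h i x)%E _.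
  by apply: eq_integral => x _; rewrite /h sumEFin; congr EFin; exact: big_mkcond.
rewrite (ge0_integral_sum mu mD mh h0); apply/esym.
rewrite big_mkcond; apply: eq_bigr => i _.
by rewrite /h; case: ifPn => // _; rewrite integral0.
Qed.

Lemma ge0_integral_period (K : nat) (f : R -> R) :
  measurable_fun setT f -> (forall x, 0 <= f x) ->
  (forall x, f x != 0 -> 0 <= x < K%:R) ->
  (\sum_(m < K) \int[mu]_(x in `[0%R, 1%R[) (f (x + m%:R)%R)%:E = \int[mu]_x (f x)%:E)%E.
Proof.
move=> mf f0 supp.
pose g (m : 'I_K) (x : R) := f x * \1_(`[m%:R, m.+1%:R[%classic : set R) x.
have mg m : measurable_fun setT (g m).
  by apply: measurable_funM => //; exact: measurable_indic.
have g0 m x : 0 <= g m x by rewrite mulr_ge0.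
transitivity (\sum_(m < K) \int[mu]_x (g m x)%:E)%E.
  apply: eq_bigr => m _.
  have := @ge0_integral_affine R 1 m%:R (fun x => (g m x)%:E) (oner_neq0 _).
  rewrite normr1 invr1 mul1e => <-//.
  - rewrite integral_mkcond; apply: eq_integral => x _.
    rewrite patchE mul1r /g indicE.
    have -> : (x + m%:R \in (`[m%:R, m.+1%:R[%classic : set R)) = (x \in (`[0, 1[%classic : set R)).
      by apply/idP/idP => /set_mem/= h; apply/mem_set; move: h; rewrite /= !in_itv/= -natr1; lra.
    by case: ifPn; rewrite ?mulr1 ?mulr0.
  - exact/measurable_EFinP.
  - by move=> x; rewrite lee_fin.
rewrite -ge0_integral_fin//.
apply: eq_integral => x _; congr EFin.
  rewrite /g -mulr_sumr; have [->|fx] := eqVneq (f x) 0; first by rewrite mul0r.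
  have /andP[x0 xK] := supp _ fx.
  have tK : (Num.truncn x < K)%N by rewrite truncn_lt_nat.
  have := truncn_itv x0 => /andP[t1 t2].
  rewrite (bigD1 (Ordinal tK))//= big1 ?addr0.
    by rewrite indicE mem_set/= ?mulr1// in_itv/= t1 t2.
  move=> m mt; rewrite indicE memNset//= in_itv/= => /andP[h1 h2].
  move/eqP: mt; apply; apply/val_inj => /=.
  by apply/esym; apply: truncn_def; rewrite h1 h2.
Qed.

Lemma sum_bool_le1 (I : finType) (P : pred I) (F : I -> bool) (e : bool) :
  (forall i, P i -> F i -> e) ->
  (forall i j, P i -> P j -> F i -> F j -> i = j) ->
  \sum_(i | P i) (F i)%:R <= e%:R :> R.
Proof.
move=> Fe uniq; have [[i Pi Fi]|nF] := pselect (exists2 i, P i & F i).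
  rewrite (bigD1 i)//= big1 ?addr0; first by rewrite Fi (Fe i).
  move=> j /andP[Pj ji]; case Fj : (F j) => //.
  by move: ji; rewrite (uniq j i)// eqxx.
rewrite big1// => i Pi; case Fi : (F i) => //.
by exfalso; apply: nF; exists i.
Qed.

Lemma sum_bool_ge1 (I : finType) (P : pred I) (F : I -> bool) (i : I) :
  P i -> F i -> 1 <= \sum_(i | P i) (F i)%:R :> R.
Proof. by move=> Pi Fi; rewrite (bigD1 i)//= Fi lerDl sumr_ge0. Qed.

Lemma bezout_window (q q' : int) : 0 < q -> gcdz q q' = 1 ->
  exists p, 2 * q <= p < 3 * q /\ exists p', p' * q - p * q' = 1.
Proof.
move=> q0 g1; have [x [y hxy]] := Bezoutz q q'; rewrite g1 in hxy.
exists ((- y %% q)%Z + 2 * q); split.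
  have := modz_ge0 (- y) (lt0r_neq0 q0); have := ltz_pmod (- y) q0; lia.
have h := divz_eq (- y) q.
exists (x - (- y %/ q)%Z * q' + 2 * q').
rewrite (_ : (- y %% q)%Z = - y - (- y %/ q)%Z * q); last by rewrite {2}h; ring.
by rewrite -hxy; ring.
Qed.

(* The window [2q, 3q[ makes every cell lie in [0, 5[, see cell_supp, so that
   five unit translates cover it. *)
Definition p0 (q q' : int) : int :=
  xget 0 [set p | 2 * q <= p < 3 * q /\ exists p', p' * q - p * q' = 1].

Lemma p0P (q q' : int) : 0 < q -> gcdz q q' = 1 ->
  2 * q <= p0 q q' < 3 * q /\ exists p', p' * q - p0 q q' * q' = 1.
Proof.
move=> q0 g1; have [p hp] := bezout_window q0 g1.
have := @xgetPex _ 0 [set p | 2 * q <= p < 3 * q /\ exists p', p' * q - p * q' = 1].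
by apply; exists p.
Qed.

Variable N : nat.
Hypothesis N1 : (1 < N)%N.
Let N0 : (0 < N)%N. Proof. exact: ltnW. Qed.

Definition sgi (s : bool) (j : nat) : int := (-1) ^+ s * j%:Z.
(** An index [(s, q, j)] stands for the pair [q], [q' = (-1)^s j]; [goodi] keeps the coprime pairs
    with nonzero entries. *)
Definition idx n := (bool * 'I_n * 'I_n)%type.
Definition goodi n (i : idx n) : bool :=
  [&& (0 < i.1.2)%N, (0 < i.2)%N & coprime i.1.2 i.2].

Lemma goodi_gcd n (i : idx n) : goodi i -> 0 < i.1.2%:Z /\ gcdz i.1.2%:Z (sgi i.1.1 i.2) = 1.
Proof.
case: i => -[s q] j /and3P[/= q0 j0 cop]; split; first by [].
rewrite /sgi; case: s; rewrite ?expr1 ?expr0 ?mulN1r ?mul1r ?gcdzN /gcdz/=;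
  by move: cop; rewrite /coprime => /eqP ->.
Qed.

(** For given [(q, q')] the admissible [p] form one class modulo [q], and [p - m q] at [alpha] is
    the same as [p] at [alpha + m]. So the single numerator [p0] accounts for all of them once
    [alpha] runs over the whole line. *)
Definition cell (X : set (R * R * R)) n (i : idx n) (alpha : R) : bool :=
  `[< X ((vbot N i.1.2%:Z, vbot N (sgi i.1.1 i.2)),
         vtop N alpha (p0 i.1.2%:Z (sgi i.1.1 i.2)) i.1.2%:Z) >].

Definition cellsum (X : set (R * R * R)) n : \bar R :=
  (\sum_(i : idx n | goodi i) ((N * i.1.2)%:R^-1)%:E *
     mu [set u | X ((vbot N i.1.2%:Z, vbot N (sgi i.1.1 i.2)), u)])%E.

Variable X : set (R * R * R).
Hypothesis mX : measurable X.
Hypothesis X2 : forall a b u, X ((a, b), u) -> `|u| <= 2.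

Lemma measurable_asboolR d (T : measurableType d) (A : set T) : measurable A ->
  measurable_fun setT (fun x => `[< A x >]%:R : R).
Proof.
move=> mA; rewrite (_ : (fun _ => _) = \1_A); first exact: measurable_indic.
by apply/funext => x; rewrite indicE; congr (nat_of_bool _)%:R; apply/asboolP/idP => [/mem_set|/set_mem].
Qed.

Lemma measurable_cell n (i : idx n) : measurable_fun setT (fun x => (cell X i x)%:R : R).
Proof.
apply: measurable_asboolR.
pose f (x : R) : R * R * R := ((vbot N i.1.2%:Z, vbot N (sgi i.1.1 i.2)),
         vtop N x (p0 i.1.2%:Z (sgi i.1.1 i.2)) i.1.2%:Z).
have mf : measurable_fun setT f by rewrite /f /vtop; mfun.
by rewrite -[X in measurable X]setTI; exact: (mf measurableT _ mX).
Qed.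

Lemma integral_cell n (i : idx n) : goodi i ->
  (\int[mu]_x ((cell X i x)%:R)%:E = ((N * i.1.2)%:R^-1)%:E *
     mu [set u | X ((vbot N i.1.2%:Z, vbot N (sgi i.1.1 i.2)), u)])%E.
Proof.
move=> gi; have [q0 g1] := goodi_gcd gi.
set q := i.1.2 in q0 g1 *; set q' := sgi _ _ in g1 *.
set U := [set u | _].
have mU : measurable U.
  pose f (x : R) : R * R * R := ((vbot N q%:Z, vbot N q'), x).
  have mf : measurable_fun setT f by rewrite /f; mfun.
  by rewrite -[X in measurable X]setTI; exact: (mf measurableT _ mX).
have Nq : (N * q)%:R != 0 :> R by rewrite pnatr_eq0 muln_eq0; lia.
have := @ge0_integral_affine R (N * q)%:R (- (N%:R * (p0 q q')%:~R))
  (fun u => (\1_U u)%:E) Nq.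
rewrite (ger0_norm (ler0n _ _)) => E.
have -> : mu U = (\int[mu]_x (\1_U x)%:E)%E by rewrite integral_indic// setIT.
rewrite -E//.
- apply: eq_integral => x _; congr EFin; rewrite indicE; congr (nat_of_bool _)%:R.
  rewrite (_ : _ - _ = vtop N x (p0 q q') q); last first.
    by rewrite /vtop natrM -pmulrn; ring.
  by apply/asboolP/idP => [/mem_set|/set_mem].
- by apply/measurable_EFinP; exact: measurable_indic.
Qed.

(** As [N >= 2], [|u| <= 2] gives [|x q - p0| <= 1], where [2 q <= p0 < 3 q]. *)
Lemma cell_supp n (i : idx n) x : goodi i -> cell X i x -> 0 <= x < 5.
Proof.
move=> gi; have [q0 g1] := goodi_gcd gi; rewrite /cell => /asboolP.
set q := i.1.2 in q0 g1 *; set q' := sgi _ _ in g1 *.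
move=> /X2 h; have [/andP[p2 p3] _] := p0P q0 g1.
have NR2 : 2 <= N%:R :> R by rewrite ler_nat.
have q1 : 1 <= q%:R :> R by rewrite ler1n; lia.
have {p2} p2 : 2 * q%:R <= (p0 q q')%:~R :> R.
  by rewrite -(ler_int R) intrM in p2.
have {p3} p3 : (p0 q q')%:~R < 3 * q%:R :> R.
  by rewrite -(ltr_int R) intrM in p3.
have {h} : `|x * q%:R - (p0 q q')%:~R| <= 1.
  move: h; rewrite /vtop normrM (ger0_norm (ler0n _ _)) -pmulrn => h.
  have : 2 * `|x * q%:R - (p0 q q')%:~R| <= N%:R * `|x * q%:R - (p0 q q')%:~R| by rewrite ler_wpM2r.
  by lra.
rewrite ler_norml => /andP[h1 h2].
by apply/andP; split; nra.
Qed.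

(** The five translates of the unit interval cover the support of each cell, so each cell is
    integrated over the whole line, where [u] has speed [N q]. *)
Lemma integral_cells n :
  (\int[mu]_(x in `[0%R, 1%R[) (\sum_(i : idx n | goodi i) \sum_(m < 5)
     (cell X i (x + m%:R))%:R)%:E = cellsum X n)%E.
Proof.
have mc (i : idx n) (m : 'I_5) : measurable_fun setT (fun x : R => (cell X i (x + m%:R))%:R : R).
  by apply: (measurableT_comp (@measurable_cell n i)); exact: measurable_funD.
rewrite ge0_integral_fin//; last 2 first.
- by move=> i _; apply: measurable_sum => m; exact: mc.
- by move=> i x _; rewrite sumr_ge0.
apply: eq_bigr => i gi; rewrite -integral_cell// ge0_integral_fin//.
apply: (@ge0_integral_period 5) => //; first exact: measurable_cell.
move=> x; case h : (cell X i x); last by rewrite eqxx.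
by move=> _; exact: cell_supp h.
Qed.
End unfold.

(** * The probability between two cell sums *)

Section sandwich.
Context {R : realType}.
Notation mu := (@lebesgue_measure R).
Local Notation mR := (measurableTypeR R).

Definition redset (d : R) (E : set (R * R * R)) : set (R * R * R) :=
  [set z | [/\ red z.1.1 z.1.2 z.2, E z & d < z.1.1]].
Definition sredset (d : R) (E : set (R * R * R)) : set (R * R * R) :=
  [set z | [/\ sred z.1.1 z.1.2 z.2, E z & d < z.1.1]].

Lemma sred_red (a b u : R) : sred a b u -> red a b u.
Proof. by move=> /and3P[h1 h2 h3]; apply/and3P; split=> //; exact: ltW. Qed.

Lemma red_u2 (a b u : R) : red a b u -> `|u| <= 2.
Proof.
move=> /red_norm_bound h; apply: sq_le => //.
by have := sqr_ge0 a; nra.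
Qed.

Lemma red_a2 (a b u : R) : red a b u -> 0 < a <= 2.
Proof.
move=> r; have /and3P[a0 _ _] := r; rewrite a0/=.
have := red_norm_bound r => h.
by have := sqr_ge0 u; nra.
Qed.

Lemma vtop_shift (N : nat) (alpha : R) (m : nat) (p q : int) :
  vtop N (alpha + m%:R) p q = vtop N alpha (p - m%:Z * q) q.
Proof. by rewrite /vtop intrB intrM -pmulrn; ring. Qed.

Lemma det_shift (m p q p' q' : int) : p' * q - p * q' = 1 ->
  (p' - m * q') * q - (p - m * q) * q' = 1.
Proof. by move=> <-; ring. Qed.

Lemma measurable_fin_sum (I : finType) (P : pred I) (h : I -> R -> R) :
  (forall i, P i -> measurable_fun setT (h i)) ->
  measurable_fun setT (fun x => \sum_(i | P i) h i x).
Proof.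
move=> mh; rewrite (_ : (fun _ => _) = (fun x => \sum_i (if P i then h i x else 0))).
  by apply: measurable_sum => i; case Pi : (P i) => //; exact: mh.
by apply/funext => x; exact: big_mkcond.
Qed.

Lemma measurable_cells (N n : nat) (X : set (R * R * R)) : measurable X ->
  measurable_fun setT (fun x : R => \sum_(i : idx n | goodi i) \sum_(m < 5)
     (cell N X i (x + m%:R))%:R : R).
Proof.
move=> mX; apply: measurable_fin_sum => i _; apply: measurable_sum => m.
by apply: (measurableT_comp (measurable_cell N mX i)); exact: measurable_funD.
Qed.

Variables (N : nat) (d : R) (E : set (R * R * R)) (EN : set R).
Hypothesis N1 : (1 < N)%N.
Let N0 : (0 < N)%N. Proof. exact: ltnW. Qed.
Hypothesis d0 : 0 < d.
Hypothesis mEN : measurable EN.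
Hypothesis EE : forall alpha (p q p' q' : int), 0 < q -> p' * q - p * q' = 1 ->
  (EN alpha <-> E ((vbot N q, vbot N q'), vtop N alpha p q)).
Hypothesis mr : measurable (redset d E).
Hypothesis ms : measurable (sredset d E).

Let mEN1 : measurable_fun setT (fun x => `[< EN x >]%:R : R).
Proof. exact: measurable_asboolR. Qed.

Lemma integral_EN : (\int[mu]_(x in `[0%R, 1%R[) (`[< EN x >]%:R)%:E =
  mu (`[0%R, 1%R[ `&` EN))%E.
Proof.
have -> : (fun x => (`[< EN x >]%:R : R)%:E) = (fun x => (\1_EN x : R)%:E).
  by apply/funext => x; rewrite indicE.
by rewrite integral_indic// setIC.
Qed.

(** For a given [alpha], at most one index with one translate gives a strictly reduced basis
    ([sred_unique]), so the sum of the indicators is at most the indicator of [EN]. *)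
Lemma sandwich_lower n : (cellsum N (sredset d E) n <= mu (`[0%R, 1%R[ `&` EN))%E.
Proof.
have X2 a b u : sredset d E ((a, b), u) -> `|u| <= 2.
  by move=> [/sred_red/red_u2].
rewrite -(integral_cells N1 ms X2) -integral_EN.
apply: ge0_le_integral => //=.
- by move=> x _; rewrite lee_fin; apply: sumr_ge0 => i _; exact: sumr_ge0.
- apply/measurable_EFinP/measurable_funTS; exact: measurable_cells.
- exact/measurable_EFinP/measurable_funTS.
move=> x _; rewrite lee_fin pair_big/=.
under eq_bigl do rewrite andbT.
apply: sum_bool_le1.
- move=> [i m]/= gi /asboolP[hs hE _]; apply/asboolP.
  have [q0 g1] := goodi_gcd gi.
  have [_ [p' det]] := p0P q0 g1.
  rewrite vtop_shift in hE.
  have det' := det_shift m%:Z det.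
  by apply/(EE x q0 det').
- move=> [i m] [i' m']/= gi gi' /asboolP[hs _ _] /asboolP[hs' _ _].
  have [q0 g1] := goodi_gcd gi; have [_ [p' det]] := p0P q0 g1.
  have [Q0 G1] := goodi_gcd gi'; have [_ [P' Det]] := p0P Q0 G1.
  rewrite /= vtop_shift in hs; rewrite /= vtop_shift in hs'.
  have [e1 e2 _ e3] := sred_unique N0 q0 Q0 (det_shift m%:Z det) (det_shift m'%:Z Det) hs hs'.
  have e4 : i = i'.
    move: i i' gi gi' e2 e3 {hs hs' det Det e1 g1 G1 q0 Q0} => [[s q] j] [[s' q'] j'] /=.
    move=> /and3P[/= _ j0 _] /and3P[/= _ j0' _] [eq]; rewrite /sgi => ej.
    have -> : q = q' by exact: val_inj.
    have [-> ejj] : s = s' /\ j = j' :> nat.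
      by move: ej; case: s; case: s'; rewrite ?expr1 ?expr0; lia.
    by congr (_, _, _); exact: val_inj.
  subst i'; congr (_, _); apply: val_inj => /=.
  have : m%:Z * i.1.2%:Z = m'%:Z * i.1.2%:Z by move: e1 => /addrI/oppr_inj.
  by move/(mulIf (lt0r_neq0 q0)) => -[].
Qed.

(** The index [i] stands for [p = i - 1]: [|alpha q - p| <= 1] with [0 <= alpha < 1] leaves only
    [-1 <= p <= q + 1], that is [q + 3] values. *)
Let tight (q : nat) (i : nat) (x : R) : bool := `|vtop N x (i%:Z - 1) q%:Z| <= 2.

Let measurable_tight q i : measurable_fun setT (fun x => (tight q i x)%:R : R).
Proof.
have := @measurable_asboolR R _ R [set x | tight q i x].
rewrite (_ : (fun x => `[< _ >]%:R : R) = (fun x => (tight q i x)%:R)); last first.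
  by apply/funext => x; rewrite asboolb.
by apply; rewrite /tight; apply: measurable_set_le; rewrite /vtop; mfun.
Qed.

Let integral_tight (q i : nat) : (0 < q)%N ->
  (\int[mu]_(x in `[0%R, 1%R[) ((tight q i x)%:R)%:E <= (4 / (N * q)%:R)%:E)%E.
Proof.
move=> q0.
have Nq : (N * q)%:R != 0 :> R by rewrite pnatr_eq0 muln_eq0; lia.
pose U : set R := `[(-2), 2]%classic.
have mU : measurable U by exact: measurable_itv.
have := @ge0_integral_affine R (N * q)%:R (- (N%:R * (i%:Z - 1)%:~R))
  (fun u => (\1_U u)%:E) Nq.
rewrite (ger0_norm (ler0n _ _)) => Ea.
apply: (@le_trans _ _ (\int[mu]_x ((tight q i x)%:R)%:E)%E).
  apply: ge0_subset_integral => //.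
  by apply/measurable_EFinP; exact: measurable_tight.
rewrite (_ : (\int[mu]_x _)%E = (\int[mu]_x (\1_U ((N * q)%:R * x - (N%:R * (i%:Z - 1)%:~R)))%:E)%E); last first.
  apply: eq_integral => x _; congr EFin; rewrite indicE; congr (nat_of_bool _)%:R.
  rewrite (_ : _ - _ = vtop N x (i%:Z - 1) q); last first.
    by rewrite /vtop natrM -pmulrn; ring.
  rewrite /tight ler_norml; apply/idP/idP => [h|/set_mem/=]; last by rewrite /U/= in_itv.
  by apply/mem_set; rewrite /U/= in_itv.
rewrite Ea//; last by apply/measurable_EFinP; exact: measurable_indic.
have -> : (\int[mu]_x (\1_U x)%:E = mu U)%E by rewrite integral_indic// setIT.
have -> : mu U = 4%:E.
  rewrite lebesgue_measure_itv/= lte_fin ifT; last by lra.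
  by rewrite -EFinD; congr EFin; ring.
by rewrite -EFinM lee_fin mulrC.
Qed.

(** Every [alpha] has a reduced basis. If [q > d N], some cell counts it. Otherwise [|u| <= 2]
    confines [alpha], for each [q], to [q + 3] intervals of length [4/(N q)], in all at most [16/N]
    since [q + 3 <= 4 q]; at most [d N] values of [q] make [16 d]. *)
Lemma sandwich_upper n : 1 <= d * N%:R ->
  (forall a b u, redset d E ((a, b), u) -> a * N%:R < n%:R /\ `|b| * N%:R < n%:R) ->
  (mu (`[0%R, 1%R[ `&` EN) <= cellsum N (redset d E) n + (16 * d)%:E)%E.
Proof.
move=> dN bnd.
have X2 a b u : redset d E ((a, b), u) -> `|u| <= 2.
  by move=> [/red_u2].
have NR2 : 2 <= N%:R :> R by rewrite ler_nat.
have dN0 : 0 <= d * N%:R by rewrite (le_trans _ dN).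
(* For an integer [q], [q < n'] means [q <= d N]. *)
pose n' := (Num.truncn (d * N%:R)).+1.
pose T (x : R) := \sum_(q < n' | (0 < q)%N) \sum_(i < q.+3) (tight q i x)%:R : R.
have mTq (q : 'I_n') : measurable_fun setT (fun x => \sum_(i < q.+3) (tight q i x)%:R : R).
  by apply: measurable_sum => i; exact: measurable_tight.
have mT : measurable_fun setT T by apply: measurable_fin_sum => q _; exact: mTq.
have T0 x : 0 <= T x by apply: sumr_ge0 => q _; exact: sumr_ge0.
have intT : (\int[mu]_(x in `[0%R, 1%R[) (T x)%:E <= (16 * d)%:E)%E.
  rewrite ge0_integral_fin//; last by move=> q x _; exact: sumr_ge0.
  apply: (@le_trans _ _ (\sum_(q < n' | (0 < q)%N) (16 / N%:R)%:E)%E).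
    apply: lee_sum => q q0; rewrite ge0_integral_fin//.
    apply: (@le_trans _ _ (\sum_(i < q.+3) (4 / (N * q)%:R)%:E)%E).
      by apply: lee_sum => i _; exact: integral_tight.
    rewrite sumEFin lee_fin sumr_const card_ord -[leLHS]mulr_natr.
    rewrite natrM -(addn3 q) [(q + 3)%:R]natrD.
    have q1 : 1 <= q%:R :> R by rewrite ler1n.
    have N0' : 0 < N%:R :> R by rewrite ltr0n.
    rewrite (_ : _ * (_ + _) = (4 * (q%:R + 3) / q%:R) / N%:R); last first.
      by field; rewrite !gt_eqF// (lt_le_trans _ q1).
    rewrite ler_pM2r ?invr_gt0// ler_pdivrMr ?(lt_le_trans _ q1)//.
    by lra.
  rewrite sumEFin lee_fin big_mkcond big_ord_recl/= add0r.
  rewrite sumr_const card_ord -[leLHS]mulr_natr mulrAC ler_pdivrMr ?ltr0n//.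
  rewrite -mulrA ler_wpM2l// truncn_le//.
apply: (@le_trans _ _ (\int[mu]_(x in `[0%R, 1%R[)
   (\sum_(i : idx n | goodi i) \sum_(m < 5) (cell N (redset d E) i (x + m%:R))%:R + T x)%:E)%E); last first.
  under eq_integral do rewrite EFinD.
  rewrite ge0_integralD//=.
  - by rewrite (integral_cells N1 mr X2); apply: leeD.
  - by move=> x _; rewrite lee_fin; apply: sumr_ge0 => i _; exact: sumr_ge0.
  - by apply/measurable_EFinP/measurable_funTS; exact: measurable_cells.
  - by move=> x _; rewrite lee_fin.
  - by apply/measurable_EFinP/measurable_funTS.
rewrite -integral_EN; apply: ge0_le_integral => //=.
- exact/measurable_EFinP/measurable_funTS.
- apply/measurable_EFinP/measurable_funTS; apply: measurable_funD => //.
  exact: measurable_cells.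
move=> x; rewrite in_itv/= => /andP[x0 x1]; rewrite lee_fin.
case: asboolP => [ENx|_]; last first.
  by apply: addr_ge0 => //; apply: sumr_ge0 => i _; exact: sumr_ge0.
have [p [q [p' [q' [q0 det rd]]]]] := red_exists x N0 N1.
have hu := red_u2 rd.
have up : `|x * q%:~R - p%:~R| <= 1.
  move: hu; rewrite /vtop normrM (ger0_norm (ler0n _ _)) => h.
  have : 2 * `|x * q%:~R - p%:~R| <= N%:R * `|x * q%:~R - p%:~R| by rewrite ler_wpM2r.
  by lra.
have q1 : (1 : R) <= q%:~R by rewrite ler1z.
have N0' : 0 < N%:R :> R by rewrite ltr0n.
have pl : -1 <= p.
  by rewrite -(ler_int R) intrN; move: up; rewrite ler_norml; nra.
have pu : p <= q + 1.
  by rewrite -(ler_int R) intrD; move: up; rewrite ler_norml; nra.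
have eq0 : q = (absz q)%:Z by rewrite gez0_abs// ltW.
have [qd|qd] := leP (vbot N q) d.
  apply: (@le_trans _ _ (T x)); last first.
    by rewrite lerDr; apply: sumr_ge0 => i _; exact: sumr_ge0.
  have qn' : (absz q < n')%N.
    rewrite ltnS -(ler_nat R).
    have : (absz q)%:R <= d * N%:R.
      by move: qd; rewrite /vbot ler_pdivrMr// eq0.
    by rewrite ler_nat -truncn_ge_nat//.
  have ip : (absz (p + 1)%R < (absz q).+3)%N by clear -pl pu q0; lia.
  rewrite /T (bigD1 (Ordinal qn'))/=; last by clear -q0; lia.
  rewrite (bigD1 (Ordinal ip))//= /tight.
  have -> : (absz (p + 1)%R)%:Z - 1 = p by clear -pl; lia.
  rewrite -eq0 hu -addrA lerDl addr_ge0// sumr_ge0// => i _; exact: sumr_ge0.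
have rE : redset d E ((vbot N q, vbot N q'), vtop N x p q).
  by split=> //; apply/(EE x q0 det).
have [bq bq'] := bnd _ _ _ rE.
have qn : (absz q < n)%N.
  by rewrite -(ltr_nat R); move: bq; rewrite /vbot divfK ?gt_eqF// {1}eq0.
have q'n : (absz q' < n)%N.
  rewrite -(ltr_nat R); move: bq'; rewrite /vbot normrM normfV (gtr0_norm N0').
  by rewrite divfK ?gt_eqF// -intr_norm -abszE.
have cop : gcdz q q' = 1.
  have h : (gcdz q q' %| 1%R)%Z.
    rewrite -det; apply: rpredB; first by apply: dvdz_mull; exact: dvdz_gcdl.
    by apply: dvdz_mull; exact: dvdz_gcdr.
  by move: h; rewrite dvdz1 => /eqP; rewrite /gcdz/= => ->.
(* [q' = 0] would force [q = 1], hence [a = 1/N <= d] by [dN]. *)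
have q'0 : q' != 0.
  apply/eqP => q'0; move: qd.
  have q1' : q = 1 by move: cop; rewrite q'0 gcdz0; clear -q0; lia.
  rewrite /vbot q1' => h; move: dN; rewrite leNgt => /negP; apply.
  by rewrite -ltr_pdivlMr// mul1r; rewrite mul1r in h.
pose s := (q' < 0).
have esg : sgi s (absz q') = q'.
  rewrite /sgi /s; case: ltP => h; rewrite ?expr1 ?expr0; clear -h; lia.
pose i : idx n := (s, Ordinal qn, Ordinal q'n).
have gi : goodi i.
  apply/and3P; split=> /=; [clear -q0; lia|clear -q'0; lia|].
  by move: cop; rewrite /gcdz /coprime => -[->].
have [pw [P' Det]] := p0P q0 cop.
(* Both numerators solve [p q' = -1] modulo [q], where [q'] is invertible; [m] is the translate of
   the unit interval to be used. *)
have [m em] : exists m, p0 q q' - p = m * q.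
  have : (q %| (p0 q q' - p) * q')%Z.
    apply/dvdzP; exists (P' - p').
    have -> : (p0 q q' - p) * q' = (P' - p') * q - ((P' * q - p0 q q' * q') - (p' * q - p * q')) by ring.
    by rewrite Det det subrr subr0.
  rewrite Gauss_dvdzl; last by rewrite /coprimez cop.
  by move/dvdzP.
have m0 : 0 <= m by clear -em pw pu q0; nia.
have m4 : m <= 4 by clear -em pw pl q0; nia.
have m5 : (absz m < 5)%N by clear -m0 m4; lia.
apply: (@le_trans _ _ (\sum_(i : idx n | goodi i) \sum_(m < 5) (cell N (redset d E) i (x + m%:R))%:R)); last by rewrite lerDl.
rewrite pair_big/=.
apply: (@sum_bool_ge1 R _ _ (fun im : idx n * 'I_5 => cell N (redset d E) im.1 (x + im.2%:R)) (i, Ordinal m5)) => /=.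
  by rewrite gi.
apply/asboolP; rewrite /= esg vtop_shift -eq0.
have -> : p0 q q' - (absz m)%:Z * q = p by clear -em m0; lia.
exact: rE.
Qed.
End sandwich.

(** * Riemann sums over coprime pairs *)
Section riemann.
Context {R : realType}.
Notation mu := (@lebesgue_measure R).
Local Notation mR := (measurableTypeR R).

Lemma bounded_cvg_integral (D : set mR) (B : R) (f_ : nat -> R -> \bar R)
    (f : R -> \bar R) (Z : set R) :
  measurable D -> (mu D < +oo)%E ->
  (forall n, measurable_fun setT (f_ n)) -> measurable_fun setT f ->
  (forall n x, 0 <= f_ n x <= B%:E)%E -> countable Z ->
  (forall x, D x -> ~ Z x -> f_ ^~ x @ \oo --> f x) ->
  (fun n => \int[mu]_(x in D) f_ n x)%E @ \oo --> (\int[mu]_(x in D) f x)%E.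
Proof.
move=> mD Doo mf_ mf fB cZ fcvg.
have mZ : measurable (Z : set mR) by apply: countable_measurable => //; move=> x; exact: measurable_set1.
have ae1 : {ae mu, forall x, D x -> f_ ^~ x @ \oo --> f x}.
  exists Z; split=> //; first exact: countable_lebesgue_measure0.
  by move=> x /= h; apply: contrapT => nZ; apply: h => Dx; exact: fcvg.
have ig : mu.-integrable D (cst B%:E).
  apply/integrableP; split; first exact: measurable_cst.
  rewrite (_ : (fun x => _) = cst `|B%:E|%E)// integral_cst//=.
  by rewrite lte_mul_pinfty// ?lee_fin.
have ae2 : {ae mu, forall x n, D x -> `|f_ n x| <= cst B%:E x}%E.
  apply: aeW => /= x n _; have /andP[h1 h2] := fB n x.
  by rewrite gee0_abs.
by have [] := @dominated_convergence _ _ _ mu _ mD f_ f (cst B%:E)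
  (fun n => measurable_funTS (mf_ n)) (measurable_funTS mf) ae1 ig ae2.
Qed.

Lemma measure_itv_lty (x y : R) : (mu `[x, y[ < +oo)%E.
Proof. by rewrite lebesgue_measure_itv/=; case: ifP => _; rewrite // -EFinD ltry. Qed.

Lemma step_integral (h : R) (n : nat) (f : nat -> R) : 0 < h ->
  (forall i, 0 <= f i) ->
  (\int[mu]_(x in `[0%R, (h * n%:R)%R[) (f (Num.truncn (x / h)))%:E =
   (\sum_(i < n) h * f i)%R%:E)%E.
Proof.
move=> h0 f0.
have mI (i : nat) : measurable (`[h * i%:R, h * i.+1%:R[%classic : set mR) by exact: measurable_itv.
transitivity (\int[mu]_x (\sum_(i < n) f i * \1_(`[(h * i%:R)%R, (h * i.+1%:R)%R[%classic : set R) x)%:E)%E.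
  rewrite integral_mkcond; apply: eq_integral => x _; rewrite patchE.
  case: ifPn => [/set_mem/=|/negP nx].
    rewrite in_itv/= => /andP[x0 xn].
    have xh0 : 0 <= x / h by rewrite divr_ge0// ltW.
    have tn : (Num.truncn (x / h) < n)%N.
      by rewrite truncn_lt_nat// ltr_pdivrMr// mulrC.
    rewrite (bigD1 (Ordinal tn))//= big1 ?addr0.
      have /andP[h1 h2] := truncn_itv xh0.
      rewrite indicE mem_set/= ?mulr1// in_itv/= mulrC -ler_pdivlMr// h1/=.
      by rewrite mulrC -ltr_pdivrMr.
    move=> i it; rewrite indicE memNset/= ?mulr0// in_itv/= => /andP[h1 h2].
    move/eqP: it; apply; apply/val_inj => /=; apply/esym; apply: truncn_def.
    by rewrite ler_pdivlMr// ltr_pdivrMr// mulrC h1 mulrC.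
  congr EFin; apply/esym; apply: big1 => i _.
  rewrite indicE memNset/= ?mulr0// in_itv/= => /andP[h1 h2].
  apply: nx; apply/mem_set; rewrite /= in_itv/= (le_trans _ h1) ?mulr_ge0 ?(ltW h0)//=.
  by apply: lt_le_trans h2 _; rewrite ler_pM2l// ler_nat.
rewrite ge0_integral_fin//; last 2 first.
- by move=> i _; apply: measurable_funM => //; exact: measurable_indic.
- by move=> i x _; rewrite mulr_ge0.
rewrite -sumEFin; apply: eq_bigr => i _.
under eq_integral do rewrite EFinM.
rewrite ge0_integralZl//; last 2 first.
- by apply/measurable_EFinP; exact: measurable_indic.
- by rewrite lee_fin.
rewrite integral_indic// setIT/=.
have -> : mu `[(h * i%:R)%R, (h * i.+1%:R)%R[ = (h * i.+1%:R - h * i%:R)%:E.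
  by rewrite lebesgue_measure_itv/= lte_fin ltr_pM2l// ltr_nat ltnSn.
by rewrite -EFinM; congr EFin; rewrite -natr1; ring.
Qed.

(** The point of the progression [(M m + r)/N] attached to the mesh cell of width [M/N] containing
    [x]: a sum over a residue class becomes the integral of a step function. *)
Definition stepf (M r N : nat) (x : R) : R := (M * Num.truncn (x * N%:R / M%:R) + r)%:R / N%:R.

Lemma measurable_truncn : measurable_fun setT (fun x : R => (Num.truncn x)%:R : R).
Proof.
apply: nondecreasing_measurable => // x y xy; rewrite ler_nat.
exact: le_truncn.
Qed.

Lemma measurable_stepf M r N : measurable_fun setT (stepf M r N).
Proof.
rewrite (_ : stepf M r N = fun x => (M%:R * (Num.truncn (x * N%:R / M%:R))%:R + r%:R) / N%:R).
  apply: measurable_funM => //; apply: measurable_funD => //; apply: measurable_funM => //.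
  by apply: (measurableT_comp measurable_truncn); mfun.
by apply/funext => x; rewrite /stepf natrD natrM.
Qed.

Lemma stepf_cvg (M r : nat) (x : R) : (r < M)%N -> 0 <= x -> (stepf M r) ^~ x @ \oo --> x.
Proof.
move=> rM x0; have M0 : 0 < M%:R :> R by rewrite ltr0n (leq_ltn_trans _ rM).
have bnd N : (0 < N)%N -> `|stepf M r N x - x| <= M%:R * N%:R^-1.
  move=> N0; have N0' : 0 < N%:R :> R by rewrite ltr0n.
  have /andP[h1 h2] := truncn_itv (divr_ge0 (mulr_ge0 x0 (ler0n _ N)) (ltW M0)).
  have rM' : r%:R <= M%:R :> R by rewrite ler_nat ltnW.
  rewrite /stepf natrD natrM.
  set t : R := (Num.truncn _)%:R in h1 h2 *; rewrite -natr1 -/t in h2.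
  rewrite ler_pdivlMr// in h1; rewrite ltr_pdivrMr// in h2.
  rewrite (_ : _ / _ - x = (M%:R * t + r%:R - x * N%:R) / N%:R); last by field; rewrite gt_eqF.
  rewrite normrM normfV (gtr0_norm N0') ler_pM2r ?invr_gt0// ler_norml.
  have r0 : 0 <= r%:R :> R by [].
  by apply/andP; split; nra.
apply/cvgrPdist_le => e e0; near=> N.
have N0 : (0 < N)%N by near: N; exact: nbhs_infty_gt.
rewrite distrC (le_trans (bnd _ N0))// ler_pdivrMr ?ltr0n//.
rewrite -ler_pdivrMl//; near: N; exact: nbhs_infty_ger.
Unshelve. all: by end_near. Qed.
End riemann.

Section residues.
Context {R : realType}.
Notation mu := (@lebesgue_measure R).
Local Notation mR := (measurableTypeR R).

Lemma measurable_int_in d (T : measurableType d) (A : set mR) (f : T * R -> \bar R) :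
  measurable A -> measurable_fun setT f -> (forall z, 0 <= f z)%E ->
  measurable_fun setT (fun x => \int[mu]_(y in A) f (x, y))%E.
Proof.
move=> mA mf f0.
rewrite (_ : (fun x => _) = (fun x => \int[mu]_y (f (x, y) * (\1_A y)%:E))%E).
  apply: (@measurable_int2 R _ _ (fun z => f z * (\1_A z.2)%:E)%E).
    apply: emeasurable_funM => //; apply/measurable_EFinP.
    by apply: (measurableT_comp _ measurable_snd); exact: measurable_indic.
  by move=> z; rewrite mule_ge0// lee_fin.
apply/funext => x; rewrite integral_mkcond; apply: eq_integral => y _.
by rewrite patchE indicE; case: ifPn; rewrite ?mule1 ?mule0.
Qed.

(** The exceptional set of [b] may depend on [a]: dominated convergence is applied to [b] for fixed
    [a], then to [a], and countable sets are null each time. *)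
Definition ae_cont (Phi : R -> R -> R) : Prop :=
  exists Z0 : set R, countable Z0 /\ forall a, 0 <= a -> ~ Z0 a ->
  exists Z1 : set R, countable Z1 /\ forall b, 0 <= b -> ~ Z1 b ->
  forall a_ b_ : nat -> R, a_ @ \oo --> a -> b_ @ \oo --> b ->
  (fun n => Phi (a_ n) (b_ n)) @ \oo --> Phi a b.

Variables (Phi : R -> R -> R) (B : R).
Hypothesis mPhi : measurable_fun setT (fun z : R * R => Phi z.1 z.2).
Hypothesis Phi0 : forall a b, 0 <= Phi a b.
Hypothesis PhiB : forall a b, Phi a b <= B.
Hypothesis Phic : ae_cont Phi.

Definition Jint (L : R) : \bar R :=
  (\int[mu]_(a in `[0%R, L[) \int[mu]_(b in `[0%R, L[) (Phi a b)%:E)%E.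

Let mI (L : R) : measurable (`[0%R, L[%classic : set mR).
Proof. exact: measurable_itv. Qed.

Lemma integral_itv_bound (L : R) (g : R -> R) : measurable_fun setT g ->
  (forall x, 0 <= g x <= B) -> 0 <= L ->
  (0 <= \int[mu]_(b in `[0%R, L[) (g b)%:E <= (B * L)%:E)%E.
Proof.
move=> mg gB L0; apply/andP; split.
  by apply: integral_ge0 => x _; rewrite lee_fin; have /andP[] := gB x.
apply: (@le_trans _ _ (\int[mu]_(b in `[0%R, L[) (cst B%:E b))%E).
  apply: ge0_le_integral => //.
  - by move=> x _; rewrite lee_fin; have /andP[] := gB x.
  - exact/measurable_EFinP/measurable_funTS.
  - by move=> x _; rewrite lee_fin; have /andP[] := gB x.
rewrite integral_cst//= lebesgue_measure_itv/= lte_fin.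
case: ltgtP L0 => // [L0 _|<- _]; first by rewrite oppr0 adde0 -EFinM.
by rewrite mulr0 mule0.
Qed.

(** With mesh [h = M/N], the double sum times [h^2] is exactly the integral over the square [[0, M
    C[^2] of [Phi] composed with two step functions that tend to the identity. *)
Lemma residue_cvg (M r r' C : nat) : (r < M)%N -> (r' < M)%N ->
  (fun N : nat => ((N%:R^-1 ^+ 2 * \sum_(m < C * N) \sum_(m' < C * N)
      Phi ((M * m + r)%:R / N%:R) ((M * m' + r')%:R / N%:R))%:E)%E)
  @ \oo --> ((M%:R^-1 ^+ 2)%:E * Jint (M * C)%:R)%E.
Proof.
move=> rM r'M; have M0 : 0 < M%:R :> R by rewrite ltr0n (leq_ltn_trans _ rM).
set L : R := (M * C)%:R; have L0 : 0 <= L by rewrite ler0n.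
pose F_ N a := (\int[mu]_(b in `[0%R, L[) (Phi (stepf M r N a) (stepf M r' N b))%:E)%E.
pose F a := (\int[mu]_(b in `[0%R, L[) (Phi a b)%:E)%E.
have mstep N : measurable_fun setT (fun z : R * R => Phi (stepf M r N z.1) (stepf M r' N z.2)).
  apply: (@measurableT_comp _ _ _ _ _ _ (fun z : R * R => Phi z.1 z.2) setT
    (fun z : R * R => (stepf M r N z.1, stepf M r' N z.2))) => //.
  apply: measurable_fun_pair.
    exact: (measurableT_comp (measurable_stepf M r N) measurable_fst).
  exact: (measurableT_comp (measurable_stepf M r' N) measurable_snd).
have mPa a : measurable_fun setT (Phi a).
  by apply: (@measurableT_comp _ _ _ _ _ _ (fun z : R * R => Phi z.1 z.2) setT (pair a)) => //; mfun.
have mF_ N : measurable_fun setT (F_ N).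
  apply: (@measurable_int_in _ _ _ (fun z : R * R => (Phi (stepf M r N z.1) (stepf M r' N z.2))%:E)) => //.
    exact/measurable_EFinP.
  by move=> z; rewrite lee_fin.
have mF : measurable_fun setT F.
  apply: (@measurable_int_in _ _ _ (fun z : R * R => (Phi z.1 z.2)%:E)) => //.
    exact/measurable_EFinP.
  by move=> z; rewrite lee_fin.
have mPs N a : measurable_fun setT (fun b => Phi (stepf M r N a) (stepf M r' N b)).
  exact: (measurableT_comp (mPa _) (measurable_stepf M r' N)).
have PB a b : 0 <= Phi a b <= B by rewrite Phi0 PhiB.
have key : (fun N => \int[mu]_(a in `[0%R, L[) F_ N a)%E @ \oo --> (\int[mu]_(a in `[0%R, L[) F a)%E.
  have [Z0 [cZ0 hZ0]] := Phic.
  apply: (@bounded_cvg_integral R `[0%R, L[ (B * L) F_ F Z0) => //.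
  - exact: measure_itv_lty.
  - by move=> N a; apply: integral_itv_bound.
  move=> a /=; rewrite in_itv/= => /andP[a0 _] nZ0; have [Z1 [cZ1 hZ1]] := hZ0 a a0 nZ0.
  apply: (@bounded_cvg_integral R `[0%R, L[ B (fun N b => (Phi (stepf M r N a) (stepf M r' N b))%:E)
    (fun b => (Phi a b)%:E) Z1) => //.
  - exact: measure_itv_lty.
  - by move=> N; exact/measurable_EFinP.
  - exact/measurable_EFinP.
  - by move=> N b; rewrite !lee_fin.
  - move=> b /=; rewrite in_itv/= => /andP[b0 _] nZ1; apply: cvg_EFin; first exact: nearW.
    by apply: (hZ1 b b0 nZ1); exact: stepf_cvg.
have -> : ((M%:R^-1 ^+ 2)%:E * Jint L = (M%:R^-1 ^+ 2)%:E * \int[mu]_(a in `[0%R, L[) F a)%E by [].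
apply: (@cvg_trans _ ((fun N => (M%:R^-1 ^+ 2)%:E * \int[mu]_(a in `[0%R, L[) F_ N a)%E @ \oo)); last first.
  exact: cvgeZl key.
apply: near_eq_cvg; near=> N.
have N0 : (0 < N)%N by near: N; exact: nbhs_infty_gt.
have N0' : 0 < N%:R :> R by rewrite ltr0n.
pose h : R := M%:R / N%:R.
have h0 : 0 < h by rewrite divr_gt0.
have hL : L = h * (C * N)%:R.
  by rewrite /L /h !natrM; field; rewrite gt_eqF.
have st rr x : stepf M rr N x = (M * Num.truncn (x / h) + rr)%:R / N%:R.
  by rewrite /stepf /h invf_div mulrA.
have FE a : F_ N a = (\sum_(m' < C * N) h * Phi ((M * Num.truncn (a / h) + r)%:R / N%:R)
     ((M * m' + r')%:R / N%:R))%:E.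
  rewrite /F_ hL -(@step_integral R h (C * N)
    (fun m' => Phi ((M * Num.truncn (a / h) + r)%:R / N%:R) ((M * m' + r')%:R / N%:R)))//.
  by apply: eq_integral => b _; rewrite !st.
under [in LHS]eq_integral do rewrite FE.
rewrite hL (@step_integral R h (C * N) (fun m => \sum_(m' < C * N) h * Phi ((M * m + r)%:R / N%:R)
     ((M * m' + r')%:R / N%:R)))//; last first.
  by move=> m; apply: sumr_ge0 => m' _; rewrite mulr_ge0// ltW.
rewrite -EFinM; congr EFin.
under eq_bigr do rewrite -mulr_sumr mulrA.
rewrite -mulr_sumr mulrA; congr (_ * _).
by rewrite /h; field; rewrite !gt_eqF.
Unshelve. all: by end_near. Qed.
End residues.

(** * Sieving the coprimality condition *)

Section sieve.
Context {R : realType}.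
Notation mu := (@lebesgue_measure R).

Lemma sum_divmod (M n : nat) (F : nat -> R) :
  \sum_(q < M * n) F q = \sum_(m < n) \sum_(r < M) F (M * m + r)%N.
Proof.
rewrite -(big_mkord xpredT); elim: n => [|n IH]; first by rewrite muln0 big_ord0 big_geq.
rewrite big_ord_recr/= -IH (@big_cat_nat _ _ _ (M * n))//=; last by rewrite leq_mul2l leqnSn orbT.
congr (_ + _); rewrite -{1}[(M * n)%N]add0n big_addn mulnS addnK.
by rewrite big_mkord; apply: eq_bigr => r _; rewrite addnC.
Qed.

Lemma sum_divmod2 (M n : nat) (G : nat -> nat -> R) :
  \sum_(q < M * n) \sum_(j < M * n) G q j =
  \sum_(r < M) \sum_(r' < M) \sum_(m < n) \sum_(m' < n) G (M * m + r)%N (M * m' + r')%N.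
Proof.
rewrite (sum_divmod _ _ (fun q => \sum_(j < M * n) G q j)) exchange_big/=.
apply: eq_bigr => r _; rewrite [RHS]exchange_big/=; apply: eq_bigr => m _.
by rewrite sum_divmod exchange_big.
Qed.

Lemma cvg_fin_sum (I : Type) (s : seq I) (f : I -> nat -> R) (l : I -> R) :
  (forall i, f i @ \oo --> l i) ->
  (fun n => \sum_(i <- s) f i n) @ \oo --> \sum_(i <- s) l i.
Proof.
move=> fl; elim: s => [|i s IH].
  rewrite big_nil; under eq_fun do rewrite big_nil; exact: cvg_cst.
rewrite big_cons; under eq_fun do rewrite big_cons; exact: cvgD.
Qed.

(* For M = z! this says that no prime p <= z divides both q and j. *)
Definition chi (M q j : nat) : bool := coprime (gcdn q j) M.

Lemma chi_mod M q j m m' : chi M (M * m + q) (M * m' + j) = chi M q j.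
Proof.
have h a b : gcdn (gcdn a b) M = gcdn (gcdn (a %% M) (b %% M)) M.
  by rewrite -gcdnA -(gcdn_modl b) gcdnA gcdnAC -(gcdn_modl a) gcdnAC.
by rewrite /chi /coprime h [in RHS]h ![(M * _)%N]mulnC !modnMDl.
Qed.

Definition chi_density (M : nat) : R :=
  M%:R^-1 ^+ 2 * \sum_(r < M) \sum_(r' < M) (chi M r r')%:R.

Lemma chi_density_itv M : 0 <= chi_density M <= 1.
Proof.
have [->|M0] := posnP M; first by rewrite /chi_density big_ord0 mulr0 lexx ler01.
have M0' : 0 < M%:R :> R by rewrite ltr0n.
have S0 : 0 <= \sum_(r < M) \sum_(r' < M) (chi M r r')%:R :> R.
  by apply: sumr_ge0 => r _; exact: sumr_ge0.
rewrite /chi_density mulr_ge0 ?sqr_ge0//= exprVn mulrC ler_pdivrMr ?exprn_gt0// mul1r.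
apply: (@le_trans _ _ (\sum_(r < M) \sum_(r' < M) 1)).
  by apply: ler_sum => r _; apply: ler_sum => r' _; case: chi.
by rewrite !sumr_const !card_ord expr2 -[leLHS]mulr_natr.
Qed.

Variables (Phi : R -> R -> R) (B : R) (C : nat).
Hypothesis mPhi : measurable_fun setT (fun z : R * R => Phi z.1 z.2).
Hypothesis Phi0 : forall a b, 0 <= Phi a b.
Hypothesis PhiB : forall a b, Phi a b <= B.
Hypothesis Phic : ae_cont Phi.
Hypothesis PhiC : forall a b, Phi a b != 0 -> 0 < a < C%:R /\ 0 < b < C%:R.
Variable J : R.
Hypothesis JE : forall L : R, C%:R <= L -> Jint Phi L = J%:E.

Let B0 : 0 <= B. Proof. exact: le_trans (Phi0 0 0) (PhiB 0 0). Qed.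

Lemma chi_sum_cvg (M : nat) : (0 < M)%N ->
  (fun N : nat => N%:R^-1 ^+ 2 * \sum_(q < M * (C * N)) \sum_(j < M * (C * N))
      (chi M q j)%:R * Phi (q%:R / N%:R) (j%:R / N%:R))
  @ \oo --> chi_density M * J.
Proof.
move=> M0.
have rc (r r' : 'I_M) : (fun N : nat => N%:R^-1 ^+ 2 * \sum_(m < C * N) \sum_(m' < C * N)
      Phi ((M * m + r)%:R / N%:R) ((M * m' + r')%:R / N%:R))
  @ \oo --> (M%:R^-1 ^+ 2 * J).
  have := @residue_cvg R Phi B mPhi Phi0 PhiB Phic M r r' C (ltn_ord r) (ltn_ord r').
  rewrite JE; last by rewrite ler_nat leq_pmull.
  by move/fine_cvg.
have -> : chi_density M * J = \sum_(r < M) \sum_(r' < M) (chi M r r')%:R * (M%:R^-1 ^+ 2 * J).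
  rewrite /chi_density mulrAC mulr_sumr; apply: eq_bigr => r _.
  by rewrite mulr_sumr; apply: eq_bigr => r' _; rewrite mulrC.
rewrite (_ : (fun N => _) = (fun N : nat => \sum_(r < M) \sum_(r' < M) (chi M r r')%:R *
   (N%:R^-1 ^+ 2 * \sum_(m < C * N) \sum_(m' < C * N)
      Phi ((M * m + r)%:R / N%:R) ((M * m' + r')%:R / N%:R)))).
  apply: cvg_fin_sum => r; apply: cvg_fin_sum => r'.
  by apply: cvgM; [exact: cvg_cst|exact: rc].
apply/funext => N.
rewrite (sum_divmod2 _ _ (fun q j => (chi M q j)%:R * Phi (q%:R / N%:R) (j%:R / N%:R))).
rewrite mulr_sumr; apply: eq_bigr => r _; rewrite mulr_sumr; apply: eq_bigr => r' _.
rewrite mulrCA; congr (_ * _); rewrite mulr_sumr; apply: eq_bigr => m _.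
by rewrite mulr_sumr; apply: eq_bigr => m' _; rewrite chi_mod.
Qed.

(** Telescoping, from [1/d^2 <= 1/(d-1) - 1/d]. *)
Lemma sum_invsq_le (z K : nat) : (0 < z)%N ->
  \sum_(z.+1 <= d < K) (d%:R^-1 ^+ 2 : R) <= z%:R^-1.
Proof.
move=> z0; have [Kz|zK] := leqP K z.+1; first by rewrite big_geq// invr_ge0.
suff h n : \sum_(z.+1 <= d < z.+1 + n) (d%:R^-1 ^+ 2 : R) <= z%:R^-1 - (z + n)%:R^-1.
  rewrite -(subnKC (ltnW zK)); apply: le_trans (h _) _.
  by rewrite lerBlDr lerDl invr_ge0.
elim: n => [|n IH]; first by rewrite addn0 big_geq// addn0 subrr.
rewrite addnS big_nat_recr/=; last by rewrite leq_addr.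
apply: le_trans (lerD IH (lexx _)) _.
set x : R := (z + n)%:R.
have x0 : 0 < x by rewrite ltr0n addn_gt0 z0.
have -> : (z.+1 + n)%:R = x + 1 :> R by rewrite addSn -natr1.
have -> : (z + n.+1)%:R = x + 1 :> R by rewrite addnS -natr1.
clearbody x; rewrite -addrA lerD2l -subr_ge0.
rewrite (_ : _ - _ = (x * (x + 1) ^+ 2)^-1); last first.
  by field; apply/andP; split; rewrite gt_eqF// addr_gt0.
by rewrite invr_ge0 mulr_ge0 ?sqr_ge0 ?ltW.
Qed.

Lemma count_mult (d L : nat) : (0 < d)%N ->
  \sum_(q < L) ([&& 0 < q & d %| q]%N%:R : R) <= L%:R / d%:R.
Proof.
move=> d0; rewrite -(big_mkord xpredT (fun q => [&& 0 < q & d %| q]%N%:R : R)).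
case: L => [|L]; first by rewrite big_geq// mul0r.
rewrite big_nat_recl//= add0r.
have -> : \sum_(0 <= i < L) (d %| i.+1)%N%:R = (L %/ d)%:R :> R.
  by rewrite divn_count_dvd big_add1/= natr_sum.
rewrite ler_pdivlMr ?ltr0n// -natrM ler_nat.
by apply: leq_trans (leq_divM _ _) _.
Qed.

Definition copr (q j : nat) : bool := [&& 0 < q, 0 < j & coprime q j]%N.

(** A pair that passes the sieve without being coprime has a gcd [g > z], since otherwise [g] would
    divide [z!]; the term [d = g] of the sum is then 1. *)
Lemma chi_copr_diff (z L q j : nat) : (0 < z)%N -> (0 < q < L)%N -> (0 < j < L)%N ->
  0 <= (chi z`! q j)%:R - (copr q j)%:R :> R /\
  (chi z`! q j)%:R - (copr q j)%:R <=
  \sum_(z.+1 <= d < L) ([&& 0 < q & d %| q]%N%:R * [&& 0 < j & d %| j]%N%:R) :> R.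
Proof.
move=> z0 /andP[q0 qL] /andP[j0 jL]; rewrite /chi /copr q0 j0/=.
have S0 : 0 <= \sum_(z.+1 <= d < L) ((d %| q)%N%:R * (d %| j)%N%:R) :> R.
  by apply: sumr_ge0 => d _; rewrite mulr_ge0.
case cop : (coprime q j).
  by have -> : gcdn q j = 1%N; [exact/eqP|rewrite coprime1n subrr].
case ch : (coprime _ _); rewrite subr0; last by split.
split=> //; set g := gcdn q j in ch.
have g0 : (0 < g)%N by rewrite gcdn_gt0 q0.
have g1 : g != 1%N by apply/eqP => g1; move: cop; rewrite /coprime -/g g1.
have gq : (g %| q)%N by exact: dvdn_gcdl.
have gj : (g %| j)%N by exact: dvdn_gcdr.
have zg : (z < g)%N.
  rewrite ltnNge; apply/negP => gz.
  have : (g %| z`!)%N by apply: dvdn_fact; rewrite g0 gz.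
  by move/gcdn_idPl => h; move: ch; rewrite /coprime h (negbTE g1).
have gL : (g < L)%N by apply: leq_ltn_trans qL; exact: dvdn_leq.
rewrite (@big_cat_nat _ _ _ g)//=; last exact: ltnW.
rewrite [X in _ + X]big_ltn// gq gj mulr1 addrCA lerDl addr_ge0//; apply: sumr_ge0 => d _; exact: mulr_ge0.
Qed.

(** The support of [Phi] restricts to pairs below [L = C N]. At most [(L/d)^2] of them have [d] as a
    common divisor, and the sum of [1/d^2] over [d > z] is at most [1/z]. *)
Lemma copr_sum_err (z M N : nat) : M = z`! -> (0 < z)%N -> (0 < N)%N ->
  `|N%:R^-1 ^+ 2 * (\sum_(q < M * (C * N)) \sum_(j < M * (C * N))
      (copr q j)%:R * Phi (q%:R / N%:R) (j%:R / N%:R)) -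
   N%:R^-1 ^+ 2 * (\sum_(q < M * (C * N)) \sum_(j < M * (C * N))
      (chi M q j)%:R * Phi (q%:R / N%:R) (j%:R / N%:R))| <= B * C%:R ^+ 2 / z%:R.
Proof.
move=> ME z0 N0; have N0' : 0 < N%:R :> R by rewrite ltr0n.
set n := (M * (C * N))%N; pose L := (C * N)%N.
rewrite distrC -mulrBr -sumrB.
under eq_bigr do rewrite -sumrB.
pose w (q d : nat) : R := [&& 0 < q & d %| q]%N%:R.
have term (q j : nat) :
  0 <= (chi M q j)%:R * Phi (q%:R / N%:R) (j%:R / N%:R) - (copr q j)%:R * Phi (q%:R / N%:R) (j%:R / N%:R) /\
  (chi M q j)%:R * Phi (q%:R / N%:R) (j%:R / N%:R) - (copr q j)%:R * Phi (q%:R / N%:R) (j%:R / N%:R) <=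
  B * \sum_(z.+1 <= d < L) ((q < L)%N%:R * w q d) * ((j < L)%N%:R * w j d).
  rewrite -mulrBl; have [P0|P0] := eqVneq (Phi (q%:R / N%:R) (j%:R / N%:R)) 0.
    rewrite P0 mulr0; split=> //; rewrite mulr_ge0//; apply: sumr_ge0 => d _.
    by rewrite !mulr_ge0.
  have [/andP[a0 aC] /andP[b0 bC]] := PhiC P0.
  have q0 : (0 < q < L)%N.
    move: a0 aC; rewrite pmulr_lgt0 ?invr_gt0// ltr0n => ->/=.
    by rewrite ltr_pdivrMr// -natrM ltr_nat.
  have j0 : (0 < j < L)%N.
    move: b0 bC; rewrite pmulr_lgt0 ?invr_gt0// ltr0n => ->/=.
    by rewrite ltr_pdivrMr// -natrM ltr_nat.
  have := chi_copr_diff z0 q0 j0; rewrite -ME => -[h1 h2]; split; first by rewrite mulr_ge0.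
  have /andP[_ ->] := q0; have /andP[_ ->] := j0.
  under eq_bigr do rewrite !mul1r.
  by rewrite mulrC; apply: ler_pM.
rewrite ger0_norm; last first.
  rewrite mulr_ge0 ?sqr_ge0//; apply: sumr_ge0 => q _; apply: sumr_ge0 => j _.
  by have [] := term q j.
have cnt (d : nat) : (0 < d)%N -> 0 <= \sum_(q < n) (q < L)%N%:R * w q d <= L%:R / d%:R.
  move=> d0; rewrite sumr_ge0/=; last by move=> q _; rewrite mulr_ge0.
  have -> : \sum_(q < n) (q < L)%N%:R * w q d = \sum_(q < n | (q < L)%N) w q d.
    by rewrite [RHS]big_mkcond; apply: eq_bigr => q _; case: ifP; rewrite ?mul1r ?mul0r.
  have Ln : (L <= n)%N by rewrite leq_pmull// ME fact_gt0.
  have := count_mult L d0; rewrite (big_ord_widen _ (fun q => [&& 0 < q & d %| q]%N%:R) Ln).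
  by [].
apply: (@le_trans _ _ (N%:R^-1 ^+ 2 * (B * \sum_(z.+1 <= d < L) (L%:R / d%:R) ^+ 2))).
  rewrite ler_wpM2l ?sqr_ge0//.
  apply: (@le_trans _ _ (\sum_(q < n) \sum_(j < n) B * \sum_(z.+1 <= d < L) ((q < L)%N%:R * w q d) * ((j < L)%N%:R * w j d))).
    by apply: ler_sum => q _; apply: ler_sum => j _; have [] := term q j.
  under eq_bigr do rewrite -mulr_sumr exchange_big/=.
  rewrite -mulr_sumr exchange_big/= ler_wpM2l//.
  rewrite big_nat_cond [leRHS]big_nat_cond; apply: ler_sum => d /andP[/andP[zd _] _].
  under eq_bigr do rewrite -mulr_sumr.
  rewrite -mulr_suml expr2.
  have d0 : (0 < d)%N by exact: leq_ltn_trans zd.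
  have /andP[h1 h2] := cnt d d0.
  by apply: ler_pM.
rewrite (_ : N%:R^-1 ^+ 2 * _ = B * C%:R ^+ 2 * \sum_(z.+1 <= d < L) d%:R^-1 ^+ 2).
  by rewrite ler_wpM2l ?mulr_ge0 ?sqr_ge0// sum_invsq_le.
under eq_bigr do rewrite exprMn.
rewrite -mulr_sumr !mulrA; congr (_ * _).
by rewrite /L natrM; field; rewrite gt_eqF.
Qed.

Lemma copr_sum_approx (z : nat) (e : R) : (0 < z)%N -> 0 < e ->
  \forall N \near \oo, `|N%:R^-1 ^+ 2 * (\sum_(q < z`! * (C * N)) \sum_(j < z`! * (C * N))
      (copr q j)%:R * Phi (q%:R / N%:R) (j%:R / N%:R)) - chi_density z`! * J|
   <= B * C%:R ^+ 2 / z%:R + e.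
Proof.
move=> z0 e0; have := chi_sum_cvg (fact_gt0 z) => /cvgrPdist_le/(_ _ e0) hc.
near=> N.
have N0 : (0 < N)%N by near: N; exact: nbhs_infty_gt.
apply: le_trans (ler_distD _ _ _) (lerD (copr_sum_err erefl z0 N0) _).
by rewrite distrC; near: N.
Unshelve. all: by end_near. Qed.
End sieve.

(** * Counting primitive vectors *)
Section has_card.

Lemma has_card_image (T U : eqType) (f : T -> U) (X : set T) k : injective f ->
  has_card (f @` X) k <-> has_card X k.
Proof.
move=> fI; split=> [[s [us sk hs]]|[s [us sk hs]]].
  have [s' es] : exists s', map f s' = s.
    have : forall v, v \in s -> exists x, f x = v.
      by move=> v /hs [x _ <-]; exists x.
    elim: (s) => [|v t IH] h; first by exists [::].
    have [x <-] := h v (mem_head _ _).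
    have [t' <-] := IH (fun v' h' => h v' (mem_behead (s := v :: t) h')).
    by exists (x :: t').
  exists s'; split; [by rewrite -es map_inj_uniq in us|by rewrite -sk -es size_map|].
  move=> v; split=> [Xv|vs].
    have : f v \in s by apply/hs; exists v.
    by rewrite -es mem_map.
  have /hs[w Xw /fI <-//] : f v \in s by rewrite -es mem_map.
exists (map f s); split; [by rewrite map_inj_uniq|by rewrite size_map|].
move=> v; split=> [[x /hs xs <-]|/mapP[x /hs Xx ->]]; first by rewrite mem_map.
by exists x.
Qed.

Lemma has_card_bij (T U : eqType) (f : T -> U) (X : set T) (Y : set U) k :
  bijective f -> (forall w, X w <-> Y (f w)) -> has_card X k <-> has_card Y k.
Proof.
move=> [g fK gK] XY; rewrite -(has_card_image X k (can_inj fK)).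
suff -> : f @` X = Y by [].
apply/seteqP; split=> [_ [x /XY Yx <-]//|y Yy].
by exists (g y); rewrite ?gK//; apply/XY; rewrite gK.
Qed.

Lemma eq_has_card (T : eqType) (X Y : set T) k : (forall w, X w <-> Y w) ->
  has_card X k <-> has_card Y k.
Proof. by move=> h; rewrite (_ : X = Y)//; apply/seteqP; split=> w /h. Qed.

(** There are countably many candidate lists [s], and for each one the event is a countable
    intersection over [w]. *)
Lemma measurable_has_card d (T : measurableType d) (W : countType) (Q : T -> set W) k :
  (forall w, measurable [set z | Q z w]) -> measurable [set z | has_card (Q z) k].
Proof.
move=> mQ.
have -> : [set z | has_card (Q z) k] =
  \bigcup_(s : seq W) (if uniq s && (size s == k) then
     ~` \bigcup_(w : W) (if w \in s then ~` [set z | Q z w] else [set z | Q z w]) else set0).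
  apply/seteqP; split=> z /=.
    move=> [s [us sk hs]]; exists s => //; rewrite us sk eqxx/=.
    by move=> [w _]; case: ifPn => /= [/hs|/negP h /hs].
  move=> [s _]; case: ifPn => // /andP[us /eqP sk] h; exists s; split=> // w.
  split=> [Qw|ws].
    by apply: contrapT => /negP nws; apply: h; exists w => //; rewrite (negbTE nws).
  by apply: contrapT => nQ; apply: h; exists w => //; rewrite ws.
apply: countable_bigcupT_measurable; first exact: countableP.
move=> s; case: ifP => // _; apply: measurableC.
apply: countable_bigcupT_measurable; first exact: countableP.
by move=> w; case: ifP => _ //; exact: measurableC.
Qed.
End has_card.

Section lattice.
Context {R : realType}.
Variables (S : set (R * R)) (k : nat).

(** Coefficient pairs are counted instead of vectors, so that the index set is the same for all
    lattices; measurability and stability of the count rest on this. *)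
Definition pcount (f : int * int -> R * R) : Prop :=
  has_card [set w | gcdz w.1 w.2 = 1 /\ S (f w)] k.

Lemma latpt_mx2 (x x' y y' : R) (w : int * int) :
  latpt (mx2 x x' y y') w = (x * w.1%:~R + x' * w.2%:~R, y * w.1%:~R + y' * w.2%:~R).
Proof. by rewrite /latpt /mx2 !mxE. Qed.

Lemma pcount_prim_vecs (x x' y y' : R) : x * y' - x' * y != 0 ->
  has_card (prim_vecs (mx2 x x' y y') `&` S) k <-> pcount (latpt (mx2 x x' y y')).
Proof.
move=> D0; rewrite /pcount.
have inj : injective (latpt (mx2 x x' y y')).
  move=> [m n] [m' n']; rewrite !latpt_mx2/= => -[e1 e2].
  have h1 : (x * y' - x' * y) * (m%:~R - m'%:~R) = 0.
    transitivity (y' * (x * m%:~R + x' * n%:~R - (x * m'%:~R + x' * n'%:~R)) -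
                  x' * (y * m%:~R + y' * n%:~R - (y * m'%:~R + y' * n'%:~R))); first by ring.
    by rewrite e1 e2; ring.
  have h2 : (x * y' - x' * y) * (n%:~R - n'%:~R) = 0.
    transitivity (x * (y * m%:~R + y' * n%:~R - (y * m'%:~R + y' * n'%:~R)) -
                  y * (x * m%:~R + x' * n%:~R - (x * m'%:~R + x' * n'%:~R))); first by ring.
    by rewrite e1 e2; ring.
  move/eqP: h1; rewrite mulf_eq0 (negbTE D0)/= subr_eq0 eqr_int => /eqP ->.
  by move/eqP: h2; rewrite mulf_eq0 (negbTE D0)/= subr_eq0 eqr_int => /eqP ->.
rewrite -(has_card_image _ k inj); apply: eq_has_card => v; split.
  by move=> [[w [gw ->]] Sv]; exists w.
by move=> [w [gw Sw] <-]; split=> //; exists w.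
Qed.

(** The inverse matrix is integral too, so a common divisor of the new pair divides both entries of
    [w]. *)
Lemma gcdz_unimod (p q p' q' : int) (w : int * int) : p' * q - p * q' = 1 ->
  gcdz w.1 w.2 = 1 -> gcdz (w.1 * p + w.2 * p') (w.1 * q + w.2 * q') = 1.
Proof.
move=> det g1; set P := _ + _; set Q := _ + _.
have h : (gcdz P Q %| 1%R)%Z.
  rewrite -g1 dvdz_gcd; apply/andP; split.
    rewrite (_ : w.1 = p' * Q - q' * P); last by rewrite /P /Q -[LHS]mulr1 -det; ring.
    by apply: rpredB; apply: dvdz_mull; [exact: dvdz_gcdr|exact: dvdz_gcdl].
  rewrite (_ : w.2 = q * P - p * Q); last by rewrite /P /Q -[LHS]mulr1 -det; ring.
  by apply: rpredB; apply: dvdz_mull; [exact: dvdz_gcdl|exact: dvdz_gcdr].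
by move: h; rewrite dvdz1 => /eqP; rewrite /gcdz/= => ->.
Qed.

Lemma pcount_unimod (f : int * int -> R * R) (p q p' q' : int) : p' * q - p * q' = 1 ->
  pcount (fun w => f (w.1 * p + w.2 * p', w.1 * q + w.2 * q')) <-> pcount f.
Proof.
move=> det; pose h (w : int * int) := (w.1 * p + w.2 * p', w.1 * q + w.2 * q').
pose h' (w : int * int) := (w.2 * p' - w.1 * q', w.1 * q - w.2 * p).
have hK : cancel h h'.
  by move=> [x y]; rewrite /h /h'/=; congr pair; rewrite -[RHS]mulr1 -det; ring.
have h'K : cancel h' h.
  by move=> [x y]; rewrite /h /h'/=; congr pair; rewrite -[RHS]mulr1 -det; ring.
apply: (@has_card_bij _ _ h); first by exists h'.
move=> w /=; split=> -[g1 Sw]; split=> //; first exact: gcdz_unimod.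
rewrite -(hK w).
have h'E v : h' v = (v.1 * (- q') + v.2 * p', v.1 * q + v.2 * (- p)).
  by rewrite /h'; congr pair; ring.
by rewrite h'E; apply: gcdz_unimod => //; rewrite -det; ring.
Qed.

Lemma pcount_opp (f : int * int -> R * R) :
  pcount (fun w => f (- w.1, - w.2)) <-> pcount f.
Proof.
apply: (@has_card_bij _ _ (fun w : int * int => (- w.1, - w.2))).
  by exists (fun w => (- w.1, - w.2)) => -[x y]/=; rewrite !opprK.
by move=> w /=; rewrite gcdNz gcdzN.
Qed.

Definition lat3 (z : R * R * R) (w : int * int) : R * R :=
  latpt (mx2 z.2 (top2 z.1.1 z.1.2 z.2) z.1.1 z.1.2) w.

(** Since the count does not depend on the basis, it defines one set of triples [(a, b, u)] that
    serves all [N] and all bases. *)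
Lemma pcount_basis (N : nat) (alpha : R) (p q p' q' : int) : (0 < N)%N ->
  0 < q -> p' * q - p * q' = 1 ->
  pcount (fun w => (vtop N alpha w.1 w.2, vbot N w.2)) <->
  pcount (lat3 ((vbot N q, vbot N q'), vtop N alpha p q)).
Proof.
move=> N0 q0 det.
rewrite -(pcount_unimod (fun w => (vtop N alpha w.1 w.2, vbot N w.2)) det).
apply: eq_has_card => w; rewrite /= /lat3/= latpt_mx2/= (top2_basis _ N0 q0 det).
rewrite (_ : (_, _) = (vtop N alpha p q * w.1%:~R + vtop N alpha p' q' * w.2%:~R,
   vbot N q * w.1%:~R + vbot N q' * w.2%:~R))//.
by rewrite /vtop /vbot !intrD !intrM; congr pair; ring.
Qed.
End lattice.

(** * Stability of reducedness and of the count under small changes of the basis *)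

Section near.
Context {R : realType}.

Lemma near_ltr (x_ y_ : nat -> R) (x y : R) : x_ @ \oo --> x -> y_ @ \oo --> y ->
  x < y -> \forall n \near \oo, x_ n < y_ n.
Proof.
move=> xc yc xy; pose z := (x + y) / 2.
near=> n; apply: (@lt_trans _ _ z); near: n.
  by apply: (cvgr_lt _ xc); rewrite /z; lra.
by apply: (cvgr_gt _ yc); rewrite /z; lra.
Unshelve. all: by end_near. Qed.

Lemma near_ler (x_ y_ : nat -> R) (x y : R) : x_ @ \oo --> x -> y_ @ \oo --> y ->
  x != y -> \forall n \near \oo, (x_ n <= y_ n) = (x <= y).
Proof.
move=> xc yc; rewrite neq_lt => /orP[xy|yx].
  have := near_ltr xc yc xy; apply: filterS => n /ltW ->.
  by rewrite ltW.
have := near_ltr yc xc yx; apply: filterS => n h.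
by rewrite !leNgt h yx.
Qed.

Lemma near_seq (T : eqType) (s : seq T) (P : T -> nat -> Prop) :
  (forall w, w \in s -> \forall n \near \oo, P w n) ->
  \forall n \near \oo, forall w, w \in s -> P w n.
Proof.
elim: s => [|w s IH] h; first exact: nearW.
have h1 := h w (mem_head _ _).
have h2 := IH (fun w' h' => h w' (mem_behead (s := w :: s) h')).
near=> n; move=> w'; rewrite in_cons => /predU1P[->|]; first by near: n.
by move: w'; near: n.
Unshelve. all: by end_near. Qed.

Lemma countable_setU (T : Type) (A B : set T) : countable A -> countable B ->
  countable (A `|` B).
Proof.
move=> cA cB; rewrite (_ : _ `|` _ = \bigcup_(b in [set: bool]) (if b then A else B)).
  by apply: bigcup_countable => // -[].
apply/seteqP; split=> x; first by move=> [Ax|Bx]; [exists true|exists false].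
by move=> [[] _ h]; [left|right].
Qed.

Lemma countable_set2 (x y : R) : countable [set x; y].
Proof. by apply: finite_set_countable; exact: finite_set2. Qed.

(** Given one root [u0], Vieta's formula leaves [- be/al - u0] as the only other candidate; if
    [al = 0], [u0] is alone. *)
Lemma quad_countable (al be ga : R) : (al != 0) || (be != 0) ->
  countable [set u | al * u ^+ 2 + be * u + ga = 0].
Proof.
move=> ab.
have [[u0 h0]|none] := pselect (exists u, al * u ^+ 2 + be * u + ga = 0); last first.
  rewrite (_ : mkset _ = set0); first exact: countable0.
  by rewrite -subset0 => u h; apply: none; exists u.
apply: (@sub_countable _ _ _ [set u0; - be / al - u0]); last exact: countable_set2.
apply: subset_card_le => u /= h.
have : (u - u0) * (al * u + al * u0 + be) = 0.
  rewrite -[RHS](subrr (0 : R)) -{1}h -h0; ring.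
move/eqP; rewrite mulf_eq0 subr_eq0 => /orP[/eqP ->|/eqP h1]; [by left|right].
have al0 : al != 0.
  apply/eqP => al0; move: h1 ab; rewrite al0 !mul0r !add0r eqxx/= => ->.
  by rewrite eqxx.
have -> : u = (al * u) / al by field.
have -> : al * u = - be - al * u0 by rewrite -[LHS](addr0) -[X in _ + X](oppr0) -h1; ring.
by rewrite mulrDl; congr (_ + _); field.
Qed.

Lemma countable_bigcup_int (F : int * int -> set R) : (forall w, countable (F w)) ->
  countable (\bigcup_w F w).
Proof. by move=> h; apply: bigcup_countable => //; exact: countableP. Qed.

Definition red_bad (a b : R) : set R :=
  [set u | 2 * `|dotv a b u| = u ^+ 2 + a ^+ 2] `|`
  [set u | u ^+ 2 + a ^+ 2 = top2 a b u ^+ 2 + b ^+ 2].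

(** Multiplied by [a], respectively [a^2], the equalities become nontrivial quadratic equations in
    [u]: the first has linear coefficient [-2] for either sign of the scalar product, and in the
    second [a^2 - b^2] and [2 b] do not both vanish. *)
Lemma red_bad_countable (a b : R) : 0 < a -> countable (red_bad a b).
Proof.
move=> a0; have an0 : a != 0 by rewrite gt_eqF.
apply: countable_setU.
  apply: (@sub_countable _ _ _ ([set u | (2 * b - a) * u ^+ 2 + (- 2) * u + (2 * b * a ^+ 2 - a ^+ 3) = 0] `|`
     [set u | (2 * b + a) * u ^+ 2 + (- 2) * u + (2 * b * a ^+ 2 + a ^+ 3) = 0])).
    apply: subset_card_le => u /= h.
    have e : a * dotv a b u = b * (u ^+ 2 + a ^+ 2) - u.
      by rewrite /dotv /top2; field.
    have [d0|d0] := leP 0 (dotv a b u).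
      rewrite ger0_norm// in h; left; rewrite /=.
      transitivity (2 * (a * dotv a b u) - a * (u ^+ 2 + a ^+ 2)); first by rewrite e; ring.
      by rewrite -h; ring.
    rewrite ltr0_norm// in h; right; rewrite /=.
    transitivity (2 * (a * dotv a b u) + a * (u ^+ 2 + a ^+ 2)); first by rewrite e; ring.
    by rewrite -h; ring.
  by apply: countable_setU; apply: quad_countable; rewrite oppr_eq0 pnatr_eq0 orbT.
apply: (@sub_countable _ _ _ [set u | (a ^+ 2 - b ^+ 2) * u ^+ 2 + (2 * b) * u + (a ^+ 4 - 1 - a ^+ 2 * b ^+ 2) = 0]).
  apply: subset_card_le => u /= h.
  transitivity (a ^+ 2 * (u ^+ 2 + a ^+ 2) - a ^+ 2 * (top2 a b u ^+ 2 + b ^+ 2)).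
    by rewrite /top2; field.
  by rewrite h subrr.
apply: quad_countable; have [->|b0] := eqVneq b 0.
  by rewrite expr0n subr0 sqrf_eq0 an0.
by rewrite orbC mulf_neq0.
Qed.

Lemma top2_cvg (a b u : R) (a_ b_ : nat -> R) : a != 0 -> a_ @ \oo --> a -> b_ @ \oo --> b ->
  (fun n => top2 (a_ n) (b_ n) u) @ \oo --> top2 a b u.
Proof.
move=> a0 ac bc; apply: cvgM; last exact: cvgV.
by apply: cvgB; [apply: cvgM => //; exact: cvg_cst|exact: cvg_cst].
Qed.

Lemma red_near (a b u : R) (a_ b_ : nat -> R) : 0 < a -> a_ @ \oo --> a -> b_ @ \oo --> b ->
  ~ red_bad a b u -> \forall n \near \oo, red (a_ n) (b_ n) u = red a b u.
Proof.
move=> a0 ac bc nb; have an0 : a != 0 by rewrite gt_eqF.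
have tc := @top2_cvg a b u a_ b_ an0 ac bc.
have cu : (fun=> u) @ \oo --> u by exact: cvg_cst.
have Wc : (fun n => u ^+ 2 + a_ n ^+ 2) @ \oo --> u ^+ 2 + a ^+ 2.
  by apply: cvgD; [exact: cvg_cst|exact: cvgM].
have W'c : (fun n => top2 (a_ n) (b_ n) u ^+ 2 + b_ n ^+ 2) @ \oo --> top2 a b u ^+ 2 + b ^+ 2.
  by apply: cvgD; exact: cvgM.
have dc : (fun n => 2 * `|dotv (a_ n) (b_ n) u|) @ \oo --> 2 * `|dotv a b u|.
  apply: cvgM; first exact: cvg_cst.
  by apply: cvg_norm; apply: cvgD; exact: cvgM.
have n1 : 2 * `|dotv a b u| != u ^+ 2 + a ^+ 2 by apply/eqP => h; apply: nb; left.
have n2 : u ^+ 2 + a ^+ 2 != top2 a b u ^+ 2 + b ^+ 2 by apply/eqP => h; apply: nb; right.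
have h0 := near_ltr (@cvg_cst _ 0 _ \oo _) ac a0.
have h1 := near_ler dc Wc n1.
have h2 := near_ler Wc W'c n2.
near=> n; rewrite /red a0.
have -> : 0 < a_ n by near: n; exact: h0.
have e1 : (2 * `|dotv (a_ n) (b_ n) u| <= u ^+ 2 + a_ n ^+ 2) = (2 * `|dotv a b u| <= u ^+ 2 + a ^+ 2).
  by near: n.
have e2 : (u ^+ 2 + a_ n ^+ 2 <= top2 (a_ n) (b_ n) u ^+ 2 + b_ n ^+ 2) =
  (u ^+ 2 + a ^+ 2 <= top2 a b u ^+ 2 + b ^+ 2) by near: n.
by rewrite e1 e2.
Unshelve. all: by end_near. Qed.

Lemma red_sred_bad (a b u : R) : ~ red_bad a b u -> red a b u -> sred a b u.
Proof.
move=> nb /and3P[a0 h1 h2]; apply/and3P; split=> //; rewrite lt_neqAle ?h1 ?h2 andbT.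
  by apply/eqP => h; apply: nb; left.
by apply/eqP => h; apply: nb; right.
Qed.
End near.

Section region.
Context {R : realType}.
Variables (A l m : R) (h : R -> R).
Hypothesis l0 : 0 <= l.
Hypothesis hc : forall y, {for y, continuous h}.
Hypothesis h1 : forall y, l <= y <= m -> 1 <= h y.

(** A common form of both regions: [H_set A c] is [h = id], [l = 1], [m = c], and [R_set A] is
    [h = cst 1], [l = 0], [m = 1]. The bound [h >= 1] makes it bounded. *)
Definition region : set (R * R) := [set v | `|v.1| * h v.2 <= A /\ l <= v.2 <= m].

Lemma region_near (x y : R) (x_ y_ : nat -> R) : x_ @ \oo --> x -> y_ @ \oo --> y ->
  l != y -> y != m -> (l < y < m -> `|x| * h y != A) ->
  \forall n \near \oo, region (x_ n, y_ n) <-> region (x, y).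
Proof.
move=> xc yc ly ym hA.
have cl : (fun=> l) @ \oo --> l by exact: cvg_cst.
have cm : (fun=> m) @ \oo --> m by exact: cvg_cst.
have n1 := near_ler cl yc ly.
have n2 := near_ler yc cm ym.
have [/andP[ly' ym']|nlym] := boolP (l < y < m).
  have cA : (fun=> A) @ \oo --> A by exact: cvg_cst.
  have ch : (fun n => `|x_ n| * h (y_ n)) @ \oo --> `|x| * h y.
    apply: cvgM; first exact: cvg_norm.
    by apply: (@cvg_comp _ _ _ y_ h _ _ _ yc); exact: hc.
  have n3 := near_ler ch cA (hA (introT andP (conj ly' ym'))).
  near=> n; rewrite /region/=.
  have -> : (l <= y_ n) = (l <= y) by near: n.
  have -> : (y_ n <= m) = (y <= m) by near: n.
  have -> // : (`|x_ n| * h (y_ n) <= A) = (`|x| * h y <= A) by near: n.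
near=> n; rewrite /region/=.
have -> : (l <= y_ n) = (l <= y) by near: n.
have -> : (y_ n <= m) = (y <= m) by near: n.
have -> : (l <= y <= m) = false.
  by apply/negP => /andP[q1 q2]; move/negP: nlym; apply; rewrite !lt_neqAle ly ym q1.
by split=> -[].
Unshelve. all: by end_near. Qed.

Lemma region_bound (x y : R) : region (x, y) -> `|x| <= A /\ `|y| <= m.
Proof.
move=> [/= hA /andP[ly ym]]; split.
  have := h1 (introT andP (conj ly ym)) => h1y.
  by apply: le_trans hA; rewrite ler_peMr.
by rewrite ger0_norm// (le_trans l0).
Qed.

Variable k : nat.

(* No primitive vector lies on the boundary of the region or on y = l, y = m. *)
Definition lat_good (a b u : R) : Prop := forall w : int * int, gcdz w.1 w.2 = 1 ->
  let y := w.1%:~R * a + w.2%:~R * b in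
  [/\ l != y, y != m & l < y < m -> `|u * y - w.2%:~R| * h y != a * A].

Lemma lat3E (a b u : R) (w : int * int) : a != 0 ->
  lat3 ((a, b), u) w = ((u * (w.1%:~R * a + w.2%:~R * b) - w.2%:~R) / a,
                        w.1%:~R * a + w.2%:~R * b).
Proof.
move=> a0; rewrite /lat3 latpt_mx2/= /top2; congr pair; last by ring.
by field.
Qed.

Lemma lat3_inv (a b u : R) (w : int * int) : a != 0 ->
  w.1%:~R = b * (lat3 ((a, b), u) w).1 - top2 a b u * (lat3 ((a, b), u) w).2 /\
  w.2%:~R = u * (lat3 ((a, b), u) w).2 - a * (lat3 ((a, b), u) w).1.
Proof. by move=> a0; rewrite lat3E//= /top2; split; field. Qed.

(** Cramer's rule ([lat3_inv]) bounds the coefficients of a vector in the region, uniformly over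
    nearby bases. So finitely many [w] matter, and [region_near] settles each. *)
Lemma pcount_near (a b u : R) (a_ b_ : nat -> R) : 0 < a -> a_ @ \oo --> a -> b_ @ \oo --> b ->
  lat_good a b u ->
  \forall n \near \oo, pcount region k (lat3 ((a_ n, b_ n), u)) <-> pcount region k (lat3 ((a, b), u)).
Proof.
move=> a0 ac bc good; have an0 : a != 0 by rewrite gt_eqF.
have tc := @top2_cvg R a b u a_ b_ an0 ac bc.
(* The added 1 leaves room for nearby bases; [K] then exceeds [|b x - u' y|] and [|u y - a x|]
   whenever [|x| <= A] and [|y| <= m]. *)
pose T := `|top2 a b u| + 1; pose a1 := a + 1; pose b1 := `|b| + 1.
pose K := (Num.truncn ((b1 * A + T * m) + (`|u| * m + a1 * A))).+1.
pose rg := [seq i%:Z - K%:Z | i <- iota 0 (2 * K).+1].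
have in_rg (z : int) : `|z| <= K%:Z -> z \in rg.
  move=> zK; apply/mapP; exists (absz (z + K%:Z)); first by rewrite mem_iota; lia.
  by lia.
pose s := [seq (i, j) | i <- rg, j <- rg].
have in_s (a' b' : R) (w : int * int) : 0 < a' <= a1 -> `|b'| <= b1 -> `|top2 a' b' u| <= T ->
    region (lat3 ((a', b'), u) w) -> w \in s.
  move=> /andP[a'0 a'1] b'1 t'1; have a'n : a' != 0 by rewrite gt_eqF.
  have [e1 e2] := @lat3_inv a' b' u w a'n.
  move: e1 e2; case: (lat3 _ w) => x y /= e1 e2 /region_bound[xA ym].
  have A0 : 0 <= A by exact: le_trans xA.
  have m0 : 0 <= m by exact: le_trans ym.
  have KK : b1 * A + T * m + (`|u| * m + a1 * A) <= K%:R by rewrite ltW// truncnS_gt.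
  have p1 : 0 <= b1 * A + T * m by rewrite addr_ge0// mulr_ge0// addr_ge0.
  have p2 : 0 <= `|u| * m + a1 * A.
    by rewrite addr_ge0// mulr_ge0// addr_ge0// ltW.
  have w1 : `|w.1| <= K%:Z.
    rewrite -(ler_int R) intr_norm e1; apply: le_trans (ler_normB _ _) _.
    rewrite (normrM b') (normrM (top2 _ _ _)); apply: le_trans (_ : b1 * A + T * m <= _); last by move: KK p2; rewrite -pmulrn; lra.
    by apply: lerD; apply: ler_pM.
  have w2 : `|w.2| <= K%:Z.
    rewrite -(ler_int R) intr_norm e2; apply: le_trans (ler_normB _ _) _.
    rewrite !normrM; apply: le_trans (_ : `|u| * m + a1 * A <= _); last by move: KK p1; rewrite -pmulrn; lra.
    apply: lerD; first by apply: ler_pM.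
    by apply: ler_pM => //; rewrite gtr0_norm.
  by apply/(@allpairsP _ _ _ pair rg rg w); exists w; split; [exact: in_rg|exact: in_rg|case: (w)].
have na0 : \forall n \near \oo, 0 < a_ n by apply: (near_ltr (cvg_cst 0) ac a0).
have na1 : \forall n \near \oo, a_ n < a1.
  by apply: (cvgr_lt _ ac); rewrite /a1 ltrDl.
have nb1 : \forall n \near \oo, `|b_ n| < b1.
  by apply: (cvgr_lt _ (cvg_norm bc)); rewrite /b1 ltrDl.
have nt1 : \forall n \near \oo, `|top2 (a_ n) (b_ n) u| < T.
  by apply: (cvgr_lt _ (cvg_norm tc)); rewrite /T ltrDl.
have ns : \forall n \near \oo, forall w, w \in s -> gcdz w.1 w.2 = 1 ->
    (region (lat3 ((a_ n, b_ n), u) w) <-> region (lat3 ((a, b), u) w)).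
  apply: near_seq => w _.
  have [g1|g1] := pselect (gcdz w.1 w.2 = 1); last by apply: nearW => n /g1.
  have [q1 q2 q3] := good w g1.
  have yc : (fun n => w.1%:~R * a_ n + w.2%:~R * b_ n) @ \oo --> w.1%:~R * a + w.2%:~R * b.
    by apply: cvgD; apply: cvgM => //; exact: cvg_cst.
  have xc : (fun n => (u * (w.1%:~R * a_ n + w.2%:~R * b_ n) - w.2%:~R) / a_ n) @ \oo -->
     (u * (w.1%:~R * a + w.2%:~R * b) - w.2%:~R) / a.
    apply: cvgM; last exact: cvgV.
    by apply: cvgB; [apply: cvgM => //; exact: cvg_cst|exact: cvg_cst].
  have nr := region_near xc yc q1 q2.
  near=> n; move=> _.
  have an : a_ n != 0 by rewrite gt_eqF//; near: n.
  rewrite !lat3E//; near: n; apply: nr => /q3.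
  apply: contra => /eqP hA; apply/eqP; move: hA; rewrite normrM normfV (gtr0_norm a0).
  by move=> <-; field.
near=> n; apply: eq_has_card => w /=.
have a_n0 : 0 < a_ n by near: n.
have a_n1 : a_ n < a1 by near: n.
have b_n1 : `|b_ n| < b1 by near: n.
have t_n1 : `|top2 (a_ n) (b_ n) u| < T by near: n.
have nsn : forall w, w \in s -> gcdz w.1 w.2 = 1 ->
    (region (lat3 ((a_ n, b_ n), u) w) <-> region (lat3 ((a, b), u) w)) by near: n.
split=> -[g1 Sw]; split=> //.
  apply/(nsn w _ g1) => //; apply: (in_s _ _ _ _ _ _ Sw); rewrite ?a_n0 ?ltW//.
apply/(nsn w _ g1) => //; apply: (in_s _ _ _ _ _ _ Sw); rewrite ?a0/= ?ltW ?ltrDl//.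
Unshelve. all: by end_near. Qed.

(** If [w1 a + w2 b] is [l] or [m], this determines [a] when [w2 = 0] ([Z0]) and otherwise [b] in
    terms of [a] ([Z1]). Equality in [|x| h(y) <= A] leaves two values of [u] ([Z2]). Divisions by 0
    merely add points to countable sets. *)
Definition Z0 : set R := \bigcup_(w : int * int) [set l / w.1%:~R; m / w.1%:~R].
Definition Z1 (a : R) : set R := \bigcup_(w : int * int)
  [set (l - w.1%:~R * a) / w.2%:~R; (m - w.1%:~R * a) / w.2%:~R].
Definition Z2 (a b : R) : set R := \bigcup_(w : int * int)
  let y := w.1%:~R * a + w.2%:~R * b in
  [set (w.2%:~R + a * A / h y) / y; (w.2%:~R - a * A / h y) / y].

Lemma countable_Z0 : countable Z0.
Proof. by apply: countable_bigcup_int => w; exact: countable_set2. Qed.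
Lemma countable_Z1 a : countable (Z1 a).
Proof. by apply: countable_bigcup_int => w; exact: countable_set2. Qed.
Lemma countable_Z2 a b : countable (Z2 a b).
Proof. by apply: countable_bigcup_int => w; exact: countable_set2. Qed.

Lemma lat_good_ae (a b u : R) : 0 < a -> ~ Z0 a -> ~ Z1 a b -> ~ Z2 a b u -> lat_good a b u.
Proof.
move=> a0 n0 n1 n2 [w1 w2] g1 /=; set y := _ + _.
have key (t : R) : (t = l \/ t = m) -> t = y -> False.
  move=> tlm ty; have [w20|w20] := eqVneq w2 0.
    apply: n0; exists (w1, w2) => //=.
    have w10 : w1%:~R != 0 :> R.
      by rewrite intr_eq0; apply/eqP => w10; move: g1; rewrite w10 w20.
    have -> : a = t / w1%:~R by rewrite ty /y w20 mul0r addr0; field.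
    by case: tlm => ->; [left|right].
  have w20' : w2%:~R != 0 :> R by rewrite intr_eq0.
  apply: n1; exists (w1, w2) => //=.
  have -> : b = (t - w1%:~R * a) / w2%:~R by rewrite ty /y; field.
  by case: tlm => ->; [left|right].
split.
- by apply/eqP => e; apply: (key l) => //; left.
- by apply/eqP => e; apply: (key m) => //; right.
move=> /andP[ly ym]; apply/eqP => e; apply: n2; exists (w1, w2) => //=; rewrite -/y.
have y0 : 0 < y by exact: le_lt_trans ly.
have hy : 0 < h y by apply: (@lt_le_trans _ _ 1) => //; apply: h1; rewrite !ltW.
have [s0|s0] := leP 0 (u * y - w2%:~R).
  left; move: e; rewrite ger0_norm// => <-.
  by field; rewrite !gt_eqF.
right; move: e; rewrite ltr0_norm// => <-.
by field; rewrite !gt_eqF.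
Qed.
End region.

(** * Convergence of the probabilities *)
Section phi.
Context {R : realType}.
Notation mu := (@lebesgue_measure R).
Local Notation mR := (measurableTypeR R).

(** [u] stays fixed while [a] and [b] move, since only these two are discretised. *)
Definition ae_loc_const (E : set (R * R * R)) : Prop :=
  exists Z0 : set R, countable Z0 /\ forall a, 0 < a -> ~ Z0 a ->
  exists Z1 : set R, countable Z1 /\ forall b, ~ Z1 b ->
  exists Z2 : set R, countable Z2 /\ forall u, ~ Z2 u ->
  forall a_ b_ : nat -> R, a_ @ \oo --> a -> b_ @ \oo --> b ->
  \forall n \near \oo, E ((a_ n, b_ n), u) <-> E ((a, b), u).

Variables (d : R) (E : set (R * R * R)).
Hypothesis d0 : 0 < d.
Hypothesis mE : measurable E.
Hypothesis Eae : ae_loc_const E.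

Let X := redset d E.

Lemma measurable_redset : measurable X.
Proof.
rewrite (_ : X = [set z | red z.1.1 z.1.2 z.2] `&` E `&` [set z | d < z.1.1]).
  apply: measurableI; last by apply: measurable_set_lt; mfun.
  by apply: measurableI => //; exact: measurable_red.
by apply/seteqP; split=> z; [move=> [] | move=> [[]]].
Qed.

Let mX := measurable_redset.

Lemma measurable_sec (a b : R) : measurable [set u | X ((a, b), u)].
Proof.
pose f (u : R) : R * R * R := ((a, b), u).
have mf : measurable_fun setT f by rewrite /f; mfun.
by rewrite -[A in measurable A]setTI; exact: (mf measurableT _ mX).
Qed.

Lemma sec_le4 (a b : R) : (mu [set u | X ((a, b), u)] <= 4%:E)%E.
Proof.
apply: (@le_trans _ _ (mu `[(-2)%R, 2%R])).
  apply: le_measure; [by apply/mem_set; exact: measurable_sec|by apply/mem_set; exact: measurable_itv|].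
  by move=> u [/= /red_u2]; rewrite ler_norml in_itv.
rewrite lebesgue_measure_itv/= lte_fin ifT; last by lra.
by rewrite -EFinD lee_fin; lra.
Qed.

Definition ell (a b : R) : R := fine (mu [set u | X ((a, b), u)]).

Lemma ellE a b : mu [set u | X ((a, b), u)] = (ell a b)%:E.
Proof.
rewrite fineK// ge0_fin_numE//; apply: le_lt_trans (sec_le4 a b) _; exact: ltry.
Qed.

Lemma ell_itv a b : 0 <= ell a b <= 4.
Proof. by rewrite -!lee_fin -ellE sec_le4 measure_ge0. Qed.

Lemma ell_int a b : (\int[mu]_u (\1_X ((a, b), u))%:E = (ell a b)%:E)%E.
Proof.
rewrite -ellE; transitivity (\int[mu]_u (\1_[set u | X ((a, b), u)] u)%:E)%E.
  by apply: eq_integral => u _; rewrite !indicE.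
by rewrite integral_indic ?setIT//; exact: measurable_sec.
Qed.

Lemma measurable_ell : measurable_fun setT (fun z : R * R => ell z.1 z.2).
Proof.
rewrite (_ : (fun z => _) = (fun z : R * R => fine (\int[mu]_u (\1_X ((z.1, z.2), u))%:E)%E)); last first.
  by apply/funext => z; rewrite ell_int.
apply: measurableT_comp; first exact: fine_measurable.
apply: (@measurable_int2 R _ _ (fun zu : (R * R) * R => (\1_X ((zu.1.1, zu.1.2), zu.2))%:E)).
  apply/measurable_EFinP.
  rewrite (_ : (fun z => _) = (\1_X : _ -> R)); first exact: measurable_indic.
  by apply/funext => -[[a b] u].
by move=> z; rewrite lee_fin.
Qed.

Lemma ell_neq0 a b : ell a b != 0 -> exists u, X ((a, b), u).
Proof.
move=> e0; apply: contrapT => h; move/eqP: e0; apply.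
by rewrite /ell (_ : mkset _ = set0) ?measure0// -subset0 => u Xu; apply: h; exists u.
Qed.

(** In [b |v|^2 = a (v.v') + u] the first term is at most [|v|^2] by reducedness and [a <= 2], and
    [a |u| <= |v|^2] bounds the second by [|v|^2 / a]. *)
Lemma redset_bound (a b u : R) : X ((a, b), u) -> d < a <= 2 /\ `|b| <= 1 + d^-1.
Proof.
move=> [/= r _ da]; have /andP[a0 a2] := red_a2 r; rewrite da; split=> //.
have /and3P[_ r1 _] := r.
have e : a * dotv a b u = b * (u ^+ 2 + a ^+ 2) - u.
  by rewrite /dotv /top2; field; rewrite gt_eqF.
set W := u ^+ 2 + a ^+ 2 in r1 e.
have W0 : 0 < W by rewrite /W ltr_wpDl ?sqr_ge0// exprn_gt0.
have uW : `|u| <= a^-1 * W.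
  rewrite ler_pdivlMl//; rewrite /W -(real_normK (num_real u)).
  by have := sqr_ge0 (`|u| - a); have := sqr_ge0 `|u|; have := sqr_ge0 a; nra.
have : `|b| * W <= (1 + d^-1) * W.
  rewrite -(gtr0_norm W0) -normrM (gtr0_norm W0).
  rewrite (_ : b * W = a * dotv a b u + u); last by rewrite e; ring.
  apply: le_trans (ler_normD _ _) _; rewrite normrM (gtr0_norm a0) mulrDl mul1r.
  apply: lerD.
    by have := normr_ge0 (dotv a b u); nra.
  apply: le_trans uW _; rewrite ler_pM2r// lef_pV2 ?posrE//; exact: ltW.
by rewrite ler_pM2r.
Qed.

Definition bigC : nat := (Num.truncn (3 + d^-1)).+1.

Lemma bigC_gt : 3 + d^-1 < bigC%:R.
Proof. exact: truncnS_gt. Qed.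

(* The sign s of b is split off because the Riemann sums run over b > 0. *)
Definition phi (s : bool) (a b : R) : R := (0 < b)%R%:R * (a^-1 * ell a ((-1) ^+ s * b)).

Lemma phi_neq0 s a b : phi s a b != 0 -> 0 < b /\ exists u, X ((a, (-1) ^+ s * b), u).
Proof.
rewrite /phi; case: (ltP 0 b) => b0; last by rewrite mul0r eqxx.
rewrite mul1r mulf_eq0 negb_or => /andP[_ /ell_neq0 h]; by split.
Qed.

Lemma phi_ge0 s a b : 0 <= phi s a b.
Proof.
have [->//|/phi_neq0[b0 [u /redset_bound[/andP[da _] _]]]] := eqVneq (phi s a b) 0.
have /andP[e0 _] := ell_itv a ((-1) ^+ s * b).
by rewrite /phi !mulr_ge0// invr_ge0 ltW// (lt_trans d0).
Qed.

Lemma phi_le s a b : phi s a b <= 4 / d.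
Proof.
have [->|/phi_neq0[b0 [u /redset_bound[/andP[da _] _]]]] := eqVneq (phi s a b) 0.
  by rewrite divr_ge0// ltW.
have /andP[e0 e4] := ell_itv a ((-1) ^+ s * b).
have a0 : 0 < a by exact: lt_trans da.
rewrite /phi b0 mul1r mulrC; apply: ler_pM => //; first by rewrite invr_ge0 ltW.
by rewrite lef_pV2 ?posrE// ltW.
Qed.

Lemma phi_supp s a b : phi s a b != 0 -> 0 < a < bigC%:R /\ 0 < b < bigC%:R.
Proof.
move=> /phi_neq0[b0 [u /redset_bound[/andP[da a2] bb]]].
have dV : 0 < d^-1 by rewrite invr_gt0.
have := bigC_gt => hC.
rewrite normrM normrX normrN1 expr1n mul1r (gtr0_norm b0) in bb.
by rewrite (lt_trans d0 da) b0; split=> /=; lra.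
Qed.

Lemma measurable_phi s : measurable_fun setT (fun z : R * R => phi s z.1 z.2).
Proof.
apply: measurable_funM.
  have := @measurable_asboolR R _ (R * R)%type [set z | 0 < z.2].
  rewrite (_ : (fun x => `[< _ >]%:R : R) = (fun z : R * R => (0 < z.2)%R%:R)); last first.
    by apply/funext => z; rewrite asboolb.
  by apply; apply: measurable_set_lt; mfun.
apply: measurable_funM; first by mfun.
apply: (@measurableT_comp _ _ _ _ _ _ (fun z : R * R => ell z.1 z.2) setT
  (fun z : R * R => (z.1, (-1) ^+ s * z.2))); first exact: measurable_ell.
by mfun.
Qed.

(** Dominated convergence in [u]: off [red_bad a b] and [Z2] the indicator is eventually constant,
    [a != d] keeping the cutoff from jumping. *)
Lemma ell_cvg (a b : R) (Z2 : set R) (a_ b_ : nat -> R) : 0 < a -> a != d -> countable Z2 ->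
  a_ @ \oo --> a -> b_ @ \oo --> b ->
  (forall u, ~ Z2 u -> \forall n \near \oo, E ((a_ n, b_ n), u) <-> E ((a, b), u)) ->
  (fun n => ell (a_ n) (b_ n)) @ \oo --> ell a b.
Proof.
move=> a0 ad cZ2 ac bc hE.
have m1 a' b' : measurable_fun setT (fun u => (\1_X ((a', b'), u) : R)%:E).
  apply/measurable_EFinP.
  rewrite (_ : (fun u => _) = \1_[set u | X ((a', b'), u)]).
    by apply: measurable_indic; exact: measurable_sec.
  by apply/funext => u; rewrite !indicE.
have tr a' b' : (\int[mu]_(u in `[(-2)%R, 3%R[) (\1_X ((a', b'), u))%:E = (ell a' b')%:E)%E.
  rewrite -ell_int integral_mkcond; apply: eq_integral => u _; rewrite patchE.
  case: ifPn => // /negP nu; congr EFin; rewrite indicE memNset// => -[/= /red_u2 + _ _].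
  rewrite ler_norml => /andP[u1 u2]; apply: nu; apply/mem_set; rewrite /= in_itv/= u1/=.
  by lra.
suff H : (fun n => (ell (a_ n) (b_ n))%:E) @ \oo --> (ell a b)%:E by exact: fine_cvg H.
rewrite -tr (_ : (fun n => _) = (fun n => \int[mu]_(u in `[(-2)%R, 3%R[)
   (\1_X ((a_ n, b_ n), u))%:E)%E); last by apply/funext => n; rewrite tr.
apply: (@bounded_cvg_integral R `[(-2)%R, 3%R[ 1 (fun n u => (\1_X ((a_ n, b_ n), u))%:E)
  (fun u => (\1_X ((a, b), u))%:E) (red_bad a b `|` Z2)) => //.
- exact: measure_itv_lty.
- by move=> n u; rewrite !lee_fin indicE ler0n/=; case: (_ \in _).
- by apply: countable_setU => //; exact: red_bad_countable.
move=> u _ nb.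
have nr : ~ red_bad a b u by move=> h; apply: nb; left.
have n2 : ~ Z2 u by move=> h; apply: nb; right.
have r1 := red_near a0 ac bc nr.
have r2 := hE u n2.
have r3 := near_ler ac (cvg_cst d) ad.
apply: cvg_near_cst; near=> n; congr EFin; rewrite !indicE; congr (nat_of_bool _)%:R.
have e1 : red (a_ n) (b_ n) u = red a b u by near: n.
have e2 : E ((a_ n, b_ n), u) <-> E ((a, b), u) by near: n.
have e3 : (a_ n <= d) = (a <= d) by near: n; exact: r3.
have XX : X ((a_ n, b_ n), u) <-> X ((a, b), u).
  by rewrite /X /redset/= e1 !ltNge e3; split=> -[h1 /e2 h2 h3].
by apply/idP/idP => /set_mem/XX/mem_set.
Unshelve. all: by end_near. Qed.

Lemma phi_ae_cont s : ae_cont (phi s).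
Proof.
have [Z0 [cZ0 hZ0]] := Eae.
(* [0] is added because [ae_cont] admits [a = 0], and [d] because the cutoff jumps there. *)
exists (Z0 `|` [set 0; d]); split; first by apply: countable_setU => //; exact: countable_set2.
move=> a a0 na.
have {}a0 : 0 < a.
  by rewrite lt_neqAle a0 andbT; apply/eqP => h; apply: na; right; left.
have ad : a != d by apply/eqP => h; apply: na; right; right.
have na0 : ~ Z0 a by move=> h; apply: na; left.
have [Z1 [cZ1 hZ1]] := hZ0 a a0 na0.
exists (((fun b => (-1) ^+ s * b) @` Z1) `|` [set 0; 0]); split.
  by apply: countable_setU; [exact: sub_countable (card_image_le _ _) cZ1|exact: countable_set2].
move=> b b0 nb.
have {}b0 : 0 < b.
  by rewrite lt_neqAle b0 andbT; apply/eqP => h; apply: nb; right; left.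
have nb1 : ~ Z1 ((-1) ^+ s * b).
  by move=> h; apply: nb; left; exists ((-1) ^+ s * b) => //; rewrite mulrA -expr2 sqrr_sign mul1r.
have [Z2 [cZ2 hZ2]] := hZ1 _ nb1.
move=> a_ b_ ac bc; rewrite /phi; apply: cvgM.
  rewrite b0; apply: cvg_near_cst.
  have nb0 := near_ltr (@cvg_cst _ 0 _ \oo _) bc b0.
  by near=> n; have -> // : 0 < b_ n by near: n; exact: nb0.
apply: cvgM; first by apply: cvgV => //; rewrite gt_eqF.
have bc' : (fun n => (-1) ^+ s * b_ n) @ \oo --> (-1) ^+ s * b.
  by apply: cvgM => //; exact: cvg_cst.
by apply: (@ell_cvg a _ Z2) => // u nu; exact: hZ2.
Unshelve. all: by end_near. Qed.

Definition phi_tot s : \bar R := (\int[mu]_(a in `]0%R, +oo[) \int[mu]_b (phi s a b)%:E)%E.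

Lemma Jint_phi s (L : R) : bigC%:R <= L -> Jint (phi s) L = phi_tot s.
Proof.
move=> CL; rewrite /Jint /phi_tot [LHS]integral_mkcond [RHS]integral_mkcond.
apply: eq_integral => a _; rewrite !patchE.
have inner : (\int[mu]_(b in `[0%R, L[) (phi s a b)%:E = \int[mu]_b (phi s a b)%:E)%E.
  rewrite integral_mkcond; apply: eq_integral => b _; rewrite patchE.
  case: ifPn => // /negP nb; have [->//|/phi_supp[_ /andP[b0 bC]]] := eqVneq (phi s a b) 0.
  by exfalso; apply: nb; apply/mem_set; rewrite /= in_itv/= (ltW b0) (lt_le_trans bC).
rewrite inner; have [/existsNP[b pb]|az] := pselect (~ forall b, phi s a b = 0).
  have /phi_supp[/andP[a0 aC] _] : phi s a b != 0 by exact/eqP.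
  rewrite !mem_set//= in_itv/= ?a0// (ltW a0)/=; exact: lt_le_trans CL.
have {}az b : phi s a b = 0 by move/contrapT : az => ->.
have -> : (\int[mu]_b (phi s a b)%:E = 0)%E by apply: integral0_eq => b _; rewrite az.
by case: ifP; case: ifP.
Qed.

Lemma phi_tot_fin s : phi_tot s \is a fin_num.
Proof.
have mPa a : measurable_fun setT (phi s a).
  by apply: (@measurableT_comp _ _ _ _ _ _ (fun z : R * R => phi s z.1 z.2) setT (pair a));
    [exact: measurable_phi|mfun].
have PB a b : 0 <= phi s a b <= 4 / d by rewrite phi_ge0 phi_le.
rewrite -(Jint_phi s (lexx _)) /Jint.
pose F a := (\int[mu]_(b in `[0%R, bigC%:R[) (phi s a b)%:E)%E.
have FB a : (0 <= F a <= (4 / d * bigC%:R)%:E)%E by apply: integral_itv_bound.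
have mF : measurable_fun setT F.
  apply: (@measurable_int_in R _ _ _ (fun z : R * R => (phi s z.1 z.2)%:E)).
  - exact: measurable_itv.
  - by apply/measurable_EFinP; exact: measurable_phi.
  - by move=> z; rewrite lee_fin phi_ge0.
have Fr a : F a = (fine (F a))%:E.
  rewrite fineK// ge0_fin_numE; last by have /andP[] := FB a.
  by have /andP[_ h] := FB a; apply: le_lt_trans h _; exact: ltry.
rewrite (_ : (\int[mu]_(a in _) _)%E = (\int[mu]_(a in `[0%R, bigC%:R[) (fine (F a))%:E)%E);
  last by apply: eq_integral => a _; exact: Fr.
have : (0 <= \int[mu]_(a in `[0%R, bigC%:R[) (fine (F a))%:E <= (4 / d * bigC%:R * bigC%:R)%:E)%E.
  apply: integral_itv_bound => //.
    by apply: measurableT_comp => //; exact: fine_measurable.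
  by move=> a; rewrite -!lee_fin -Fr.
move=> /andP[h1 h2]; rewrite ge0_fin_numE//; apply: le_lt_trans h2 _; exact: ltry.
Qed.

(** The line of [b] is split at 0, a null set, and its negative half is reflected. *)
Lemma basis_vol_phi : basis_vol X = (phi_tot false + phi_tot true)%E.
Proof.
have mP s : measurable_fun setT (fun z : R * R => (phi s z.1 z.2)%:E).
  by apply/measurable_EFinP; exact: measurable_phi.
have mPa s a : measurable_fun setT (fun b => (phi s a b)%:E).
  by apply: (@measurableT_comp _ _ _ _ _ _ (fun z : R * R => (phi s z.1 z.2)%:E) setT (pair a)) => //; mfun.
have mI s : measurable_fun setT (fun a => \int[mu]_b (phi s a b)%:E)%E.
  by apply: (measurable_int2 (mP s)) => z; rewrite lee_fin phi_ge0.
have I0 s a : (0 <= \int[mu]_b (phi s a b)%:E)%E.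
  by apply: integral_ge0 => b _; rewrite lee_fin phi_ge0.
have mD : measurable (`]0%R, +oo[%classic : set mR) by exact: measurable_itv.
rewrite /phi_tot -(ge0_integralD mu mD (fun a _ => I0 false a) (measurable_funTS (mI false))
  (fun a _ => I0 true a) (measurable_funTS (mI true))).
apply: eq_integral => a /set_mem/=; rewrite in_itv/= andbT => a0.
have [ad|ad] := ltP d a; last first.
  rewrite !integral0_eq ?adde0//.
  - move=> b _; have [->//|/phi_neq0[_ [u /redset_bound[/andP[da _] _]]]] := eqVneq (phi true a b) 0.
    by move: (lt_le_trans da ad); rewrite ltxx.
  - move=> b _; have [->//|/phi_neq0[_ [u /redset_bound[/andP[da _] _]]]] := eqVneq (phi false a b) 0.
    by move: (lt_le_trans da ad); rewrite ltxx.
  - move=> b _; rewrite integral0_eq ?mule0// => u _; rewrite indicE memNset//.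
    by move=> /redset_bound[/andP[da _] _]; move: (lt_le_trans da ad); rewrite ltxx.
have m1 (s : bool) (a' : R) : measurable_fun setT (fun b : R => (a'^-1 * ell a' ((-1) ^+ s * b))%:E).
  apply/measurable_EFinP; apply: measurable_funM => //.
  apply: (@measurableT_comp _ _ _ _ _ _ (fun z : R * R => ell z.1 z.2) setT
    (fun b : R => (a', (-1) ^+ s * b))); first exact: measurable_ell.
  by mfun.
have e0 b : 0 <= a^-1 * ell a b.
  by rewrite mulr_ge0 ?invr_ge0 ?(ltW a0)//; have /andP[] := ell_itv a b.
pose g (s : bool) (b : R) := (0 < (-1) ^+ s * b)%R%:R * (a^-1 * ell a b).
have mg (s : bool) : measurable_fun setT (fun b : R => (g s b)%:E).
  apply/measurable_EFinP; apply: measurable_funM; last first.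
    have := m1 false a; under eq_fun do rewrite expr0 mul1r.
    by move/measurable_EFinP.
  have := @measurable_asboolR R _ R [set b | 0 < (-1) ^+ s * b].
  rewrite (_ : (fun x => `[< _ >]%:R : R) = (fun b => (0 < (-1) ^+ s * b)%R%:R)); last first.
    by apply/funext => z; rewrite asboolb.
  by apply; apply: measurable_set_lt; mfun.
have gp s : (\int[mu]_b (phi s a b)%:E = \int[mu]_b (g s b)%:E)%E.
  have := @ge0_integral_affine R ((-1) ^+ s) 0 (fun b => (g s b)%:E).
  rewrite signr_eq0 normrX normrN1 expr1n invr1 mul1e => <-//.
  - by apply: eq_integral => b _; rewrite addr0 /g signrMK.
  - by move=> b; rewrite lee_fin mulr_ge0.
have g0 (s : bool) b : (0 <= (g s b)%:E)%E by rewrite lee_fin mulr_ge0.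
rewrite !gp -(ge0_integralD mu measurableT (fun b _ => g0 false b) (mg false)
  (fun b _ => g0 true b) (mg true)).
transitivity (\int[mu]_b (a^-1 * ell a b)%:E)%E.
  by apply: eq_integral => b _; rewrite ell_int -EFinM.
apply: ge0_ae_eq_integral => //.
- by have := m1 false a; under eq_fun do rewrite expr0 mul1r.
- by apply: emeasurable_funD; exact: mg.
- by move=> b _; rewrite lee_fin.
- by move=> b _; rewrite -EFinD lee_fin addr_ge0// mulr_ge0.
exists [set 0]; split; [exact: measurable_set1|exact: lebesgue_measure_set1|].
move=> b /= h; apply: contrapT => b0; apply: h => _.
rewrite -EFinD /g expr0 expr1 mul1r mulN1r oppr_gt0; congr EFin.
by case: ltgtP b0 => // [b0 _|b0 _|->//]; rewrite ?mul1r ?mul0r ?addr0 ?add0r.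
Qed.
End phi.

(** * Cell sums as Riemann sums *)

Section approx.
Context {R : realType}.
Notation mu := (@lebesgue_measure R).
Local Notation mR := (measurableTypeR R).

Lemma measurable_sred : measurable [set z : R * R * R | sred z.1.1 z.1.2 z.2].
Proof.
rewrite (_ : mkset _ = [set z : R * R * R | 0 < z.1.1] `&`
  ([set z : R * R * R | 2 * `|dotv z.1.1 z.1.2 z.2| < z.2 ^+ 2 + z.1.1 ^+ 2]
  `&` [set z : R * R * R | z.2 ^+ 2 + z.1.1 ^+ 2 < top2 z.1.1 z.1.2 z.2 ^+ 2 + z.1.2 ^+ 2])).
  by apply: measurableI; [|apply: measurableI]; apply: measurable_set_lt; rewrite /dotv /top2; mfun.
by apply/seteqP; split=> z /=; [move=> /and3P[]|move=> [? [? ?]]; apply/and3P].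
Qed.

Variables (d : R) (E : set (R * R * R)).
Hypothesis d0 : 0 < d.
Hypothesis mE : measurable E.
Hypothesis Eae : ae_loc_const E.

Lemma measurable_sredset : measurable (sredset d E).
Proof.
rewrite (_ : sredset d E = [set z | sred z.1.1 z.1.2 z.2] `&` E `&` [set z | d < z.1.1]).
  apply: measurableI; last by apply: measurable_set_lt; mfun.
  by apply: measurableI => //; exact: measurable_sred.
by apply/seteqP; split=> z; [move=> [] | move=> [[]]].
Qed.

(** The two sections differ within the countable set [red_bad a b]; hence the lower and upper bounds
    share one cell sum. *)
Lemma sec_sred (a b : R) : 0 < a ->
  mu [set u | sredset d E ((a, b), u)] = mu [set u | redset d E ((a, b), u)].
Proof.
move=> a0; have cb := red_bad_countable b a0.
have mb : measurable (red_bad a b : set mR).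
  by apply: countable_measurable => // x; exact: measurable_set1.
have ms : measurable ([set u | sredset d E ((a, b), u)] : set mR).
  pose f (u : R) : R * R * R := ((a, b), u).
  have mf : measurable_fun setT f by rewrite /f; mfun.
  by rewrite -[A in measurable A]setTI; exact: (mf measurableT _ measurable_sredset).
have mr := measurable_sec d mE a b.
apply/eqP; rewrite eq_le; apply/andP; split.
  apply: le_measure; [exact/mem_set|exact/mem_set|].
  by move=> u [/= h1 h2 h3]; split=> //; exact: sred_red.
apply: (@le_trans _ _ (mu ([set u | sredset d E ((a, b), u)] `|` red_bad a b))).
  apply: le_measure; [exact/mem_set|by apply/mem_set; exact: measurableU|].
  move=> u [/= h1 h2 h3]; have [bad|nbad] := pselect (red_bad a b u); first by right.
  by left; split=> //; exact: red_sred_bad.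
apply: le_trans (measureU2 _ _ _) _ => //.
by rewrite [X in (_ + X)%E](countable_lebesgue_measure0 cb) adde0.
Qed.

Lemma cellsum_sred N n : (0 < N)%N -> cellsum N (sredset d E) n = cellsum N (redset d E) n.
Proof.
move=> N0; apply: eq_bigr => i gi; rewrite sec_sred//.
by have /and3P[q0 _ _] := gi; rewrite /vbot divr_gt0 ?ltr0n.
Qed.

(** With [a = q/N] the weight [1/(N q)] is [N^-2 a^-1], and [phi] contains the factor [a^-1]. *)
Lemma cellsum_phi N n : (0 < N)%N -> cellsum N (redset d E) n =
  (\sum_(s : bool) N%:R^-1 ^+ 2 * \sum_(q < n) \sum_(j < n)
     (copr q j)%:R * phi d E s (q%:R / N%:R) (j%:R / N%:R))%:E.
Proof.
move=> N0; have N0' : 0 < N%:R :> R by rewrite ltr0n.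
rewrite /cellsum big_mkcond/=.
pose F (s : bool) (q j : nat) : R := N%:R^-1 ^+ 2 * ((copr q j)%:R * phi d E s (q%:R / N%:R) (j%:R / N%:R)).
transitivity (\sum_(i : idx n) (F i.1.1 i.1.2 i.2)%:E)%E.
  apply: eq_bigr => -[[s q] j] _ /=; rewrite /F /goodi /copr/=.
  case: ifPn => [/and3P[q0 j0 _]|_]; last by rewrite mul0r mulr0.
  have q0' : 0 < q%:R :> R by rewrite ltr0n.
  have j0' : 0 < j%:R :> R by rewrite ltr0n.
  rewrite ellE// -EFinM; congr EFin.
  rewrite mul1r /phi divr_gt0// mul1r.
  have -> : vbot N q = q%:R / N%:R :> R by [].
  have -> : vbot N (sgi s j) = (-1) ^+ s * (j%:R / N%:R) :> R.
    by rewrite /vbot /sgi intrM mulrA; congr (_ * _ / _); rewrite rmorphXn rmorphN1.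
  by rewrite natrM; field; rewrite !gt_eqF.
rewrite sumEFin; congr EFin.
rewrite -(pair_bigA _ (fun (sq : bool * 'I_n) (j : 'I_n) => F sq.1 sq.2 j))/=.
rewrite -(pair_bigA _ (fun (s : bool) (q : 'I_n) => \sum_(j < n) F s q j))/=.
apply: eq_bigr => s _; rewrite mulr_sumr; apply: eq_bigr => q _.
by rewrite mulr_sumr.
Qed.

(** The outer 2 counts the signs of [b]; [4/d] bounds [phi] and [bigC d] its support. *)
Lemma cellsum_approx (z : nat) (e : R) : (0 < z)%N -> 0 < e ->
  \forall N \near \oo,
  `|fine (cellsum N (redset d E) (z`! * (bigC d * N))) - chi_density z`! * fine (basis_vol (redset d E))|
    <= 2 * (4 / d * (bigC d)%:R ^+ 2 / z%:R + e).
Proof.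
move=> z0 e0.
have [F HF] : exists F : bool -> R, forall s, phi_tot d E s = (F s)%:E.
  by exists (fun s => fine (phi_tot d E s)) => s; rewrite (fineK (phi_tot_fin d0 mE s)).
have H s := @copr_sum_approx R (phi d E s) (4 / d) (bigC d) (measurable_phi d mE s)
  (phi_ge0 d0 mE s) (phi_le d0 mE s) (phi_ae_cont d mE Eae s) (@phi_supp R d E d0 s) (F s).
have JE s (L : R) : (bigC d)%:R <= L -> Jint (phi d E s) L = (F s)%:E.
  by move=> CL; rewrite (Jint_phi E d0 s CL) HF.
have Ht := H true (JE true) z e z0 e0; have Hf := H false (JE false) z e z0 e0.
have -> : basis_vol (redset d E) = (F false + F true)%:E by rewrite (basis_vol_phi d0 mE) !HF.
rewrite [fine (_ + _)%:E]/=; move: (F true) (F false) Ht Hf => ft ff Ht Hf {H JE HF}.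
move: (chi_density _) (4 / d * _ / _) Ht Hf => x B Ht Hf.
near=> N.
have N0 : (0 < N)%N by near: N; exact: nbhs_infty_gt.
rewrite (cellsum_phi _ N0) /= big_bool /= mulrDr.
rewrite (addrC (x * ff)) opprD addrACA; apply: le_trans (ler_normD _ _) _.
rewrite mulr_natl mulr2n; apply: lerD; near: N; [exact: Ht|exact: Hf].
Unshelve. all: by end_near. Qed.
End approx.

(** * Removing the cutoff, and the total volume *)

Section volume.
Context {R : realType}.
Notation mu := (@lebesgue_measure R).
Local Notation mR := (measurableTypeR R).
Implicit Types E : set (R * R * R).

Definition sec_vol E (a : R) : \bar R := (\int[mu]_b (a^-1 * ell 0 E a b)%:E)%E.

Lemma sec_density_ge0 E (a b : R) : measurable E -> 0 <= a^-1 * ell 0 E a b.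
Proof.
move=> mE; have [->|/ell_neq0[u [/= _ _ a0]]] := eqVneq (ell 0 E a b) 0; first by rewrite mulr0.
by rewrite mulr_ge0 ?invr_ge0 ?(ltW a0)//; have /andP[] := ell_itv 0 mE a b.
Qed.

Lemma measurable_sec_density E : measurable E ->
  measurable_fun setT (fun z : R * R => (z.1^-1 * ell 0 E z.1 z.2)%:E).
Proof.
move=> mE; apply/measurable_EFinP; apply: measurable_funM; first by mfun.
exact: measurable_ell.
Qed.

Lemma measurable_sec_vol E : measurable E -> measurable_fun setT (sec_vol E).
Proof.
move=> mE; apply: (measurable_int2 (measurable_sec_density mE)) => z.
by rewrite lee_fin sec_density_ge0.
Qed.

Lemma sec_vol_ge0 E a : measurable E -> (0 <= sec_vol E a)%E.
Proof. by move=> mE; apply: integral_ge0 => b _; rewrite lee_fin sec_density_ge0. Qed.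

(** [d] occurs only in [d < a], so it moves from the integrand to the domain of integration, where
    letting it tend to 0 is monotone. *)
Lemma basis_vol_sec_vol E d : measurable E -> 0 <= d ->
  basis_vol (redset d E) = (\int[mu]_(a in `]d, +oo[) sec_vol E a)%E.
Proof.
move=> mE d0; rewrite /basis_vol [LHS]integral_mkcond [RHS]integral_mkcond.
apply: eq_integral => a _; rewrite !patchE !mem_setE !in_itv/= !andbT.
have [a0|a0] := ltP 0 a; last by rewrite ltNge (le_trans a0 d0).
have [da|ad] := ltP d a.
  apply: eq_integral => b _; rewrite EFinM -(ell_int 0 mE); congr (_ * _)%E.
  apply: eq_integral => u _; rewrite !indicE; congr (nat_of_bool _)%:R%:E.
  by apply/idP/idP => /set_mem[h1 h2 h3]; apply/mem_set; split.
rewrite integral0_eq// => b _; rewrite integral0_eq ?mule0// => u _.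
by rewrite indicE memNset// => -[_ _ /= da]; move: (lt_le_trans da ad); rewrite ltxx.
Qed.

Lemma basis_vol_cvg E : measurable E ->
  basis_vol (redset n.+1%:R^-1 E) @[n --> \oo] --> basis_vol (redset 0 E).
Proof.
move=> mE; rewrite (basis_vol_sec_vol mE (lexx 0)).
rewrite (_ : (fun n => _) = (fun n => \int[mu]_(a in `](n.+1%:R^-1)%R, +oo[) sec_vol E a)%E); last first.
  by apply/funext => n; apply: basis_vol_sec_vol => //; rewrite invr_ge0.
rewrite (_ : `]0%R, +oo[%classic = \bigcup_n `](n.+1%:R^-1)%R, +oo[%classic); last first.
  apply/seteqP; split=> a /=.
    rewrite in_itv/= andbT => a0.
    have aV : 0 < a^-1 by rewrite invr_gt0.
    exists (Num.truncn a^-1) => //=; rewrite in_itv/= andbT invf_plt ?posrE//.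
    exact: truncnS_gt.
  by move=> [n _] /=; rewrite !in_itv/= !andbT; apply: lt_trans; rewrite invr_gt0.
apply: ge0_nondecreasing_set_cvg_integral.
- move=> n m nm; apply/subsetPset => a /=; rewrite !in_itv/= !andbT; apply: le_lt_trans.
  by rewrite lef_pV2 ?posrE// ler_nat.
- by move=> i; exact: measurable_itv.
- by move=> i; apply: measurable_funTS; exact: measurable_sec_vol.
- by move=> i a _; exact: sec_vol_ge0.
Qed.

(** Half of [fund_volume], because of the factor 2 in [fund_integral]. *)
Lemma basis_vol_redset0_setT : basis_vol (redset 0 (@setT (R * R * R))) = (pi ^+ 2 / 6 : R)%:E.
Proof.
have H := @fund_integral R (redset 0 setT) setT (measurable_redset 0 measurableT) measurableT.
have {H} : (2%:E * basis_vol (redset 0 (@setT (R * R * R))) = (pi ^+ 2 / 3 : R)%:E)%E.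
  rewrite -H -?fund_volume.
  - by apply: eq_integral => v _; rewrite indicT mulr1.
  - by move=> a b u [].
  move=> x y t y0 /andP[t0 tpi]; rewrite /redset /fund_dom/= fund_red ?t0//.
  split=> [[[h1 [h2 _]] _]|[/andP[h1 h2] _ _]].
    split=> //; first exact/andP.
    by rewrite /fa divr_gt0 ?sqrtr_gt0 ?sin_gt0_pi// t0.
  by split=> //; split=> //; split=> //; split=> //; rewrite tpi (ltW t0).
case: (basis_vol _) => [r| |]; last 2 first.
- by rewrite gt0_muley// lte_fin.
- by rewrite gt0_muleNy// lte_fin.
by rewrite -EFinM => -[h]; congr EFin; lra.
Qed.

Lemma basis_vol_le E : measurable E -> (basis_vol (redset 0 E) <= (pi ^+ 2 / 6 : R)%:E)%E.
Proof.
move=> mE; rewrite -basis_vol_redset0_setT (basis_vol_sec_vol mE (lexx 0)) (basis_vol_sec_vol measurableT (lexx 0)).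
have le_ell a b : ell 0 E a b <= ell 0 setT a b.
  rewrite -lee_fin -(ellE 0 mE) -(ellE 0 measurableT).
  apply: le_measure; [by apply/mem_set; exact: measurable_sec|by apply/mem_set; exact: measurable_sec|].
  by move=> u [].
apply: ge0_le_integral => //.
- by move=> a _; exact: sec_vol_ge0.
- by apply: measurable_funTS; exact: measurable_sec_vol.
- by apply: measurable_funTS; exact: measurable_sec_vol.
move=> a; rewrite /= in_itv/= andbT => a0.
have ms E' : measurable E' -> measurable_fun setT (fun b : R => (a^-1 * ell 0 E' a b)%:E).
  move=> mE'; apply: (@measurableT_comp _ _ _ _ _ _ (fun z : R * R => (z.1^-1 * ell 0 E' z.1 z.2)%:E) setT (pair a)); last by mfun.
  exact: measurable_sec_density.
apply: ge0_le_integral => //.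
- by move=> b _; rewrite lee_fin sec_density_ge0.
- exact: ms.
- exact: ms.
by move=> b _; rewrite lee_fin ler_wpM2l// invr_ge0 ltW.
Qed.
End volume.

(** * Passage to the limit in [N], [z] and [d] *)

Section limit.
Context {R : realType}.
Notation mu := (@lebesgue_measure R).
Local Notation mR := (measurableTypeR R).
Implicit Types E : set (R * R * R).

(** Every basis with [q > 0] has to decide the event, so that it is immaterial which one the
    counting meets. *)
Definition lat_event (N : nat) (EN : set R) E : Prop :=
  forall (alpha : R) (p q p' q' : int), 0 < q -> p' * q - p * q' = 1 ->
    EN alpha <-> E ((vbot N q, vbot N q'), vtop N alpha p q).

(** The cell sums are taken up to [z! * (bigC d * N)], a whole number of periods of the sieve that
    exceeds every bottom entry at scale [N]. *)
Lemma prob_approx E (EN : nat -> set R) (d e : R) (z : nat) :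
  measurable E -> ae_loc_const E -> (forall N, measurable (EN N)) ->
  (\forall N \near \oo, lat_event N (EN N) E) ->
  0 < d -> 0 < e -> (0 < z)%N ->
  \forall N \near \oo,
  `|fine (mu (`[0, 1[ `&` EN N)) - chi_density z`! * fine (basis_vol (redset d E))|
    <= 16 * d + 2 * (4 / d * (bigC d)%:R ^+ 2 / z%:R + e).
Proof.
move=> mE Eae mEN nE d0 e0 z0.
have H := cellsum_approx d0 mE Eae z0 e0.
near=> N.
have N1 : (1 < N)%N by near: N; exact: nbhs_infty_gt.
have N0' : 0 < N%:R :> R by rewrite ltr0n ltnW.
have dN : 1 <= d * N%:R.
  rewrite mulrC -ler_pdivrMr// mul1r; apply: ltW; near: N; exact: nbhs_infty_gtr.
have EE : lat_event N (EN N) E by near: N.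
have := sandwich_lower N1 d0 (mEN N) EE (measurable_sredset d mE) (z`! * (bigC d * N)).
rewrite (cellsum_sred d mE _ (ltnW N1)).
have : (mu (`[0%R, 1%R[ `&` EN N) <=
  cellsum N (redset d E) (z`! * (bigC d * N)) + (16 * d)%:E)%E.
  apply: (sandwich_upper N1 d0 (mEN N) EE (measurable_redset d mE) dN) => a b u /(redset_bound d0)[/andP[_ a2] bd].
  have hC := bigC_gt d; have dV : 0 < d^-1 by rewrite invr_gt0.
  have h (x : R) : x < (bigC d)%:R -> x * N%:R < (z`! * (bigC d * N))%:R.
    move=> xC; apply: (@lt_le_trans _ _ ((bigC d)%:R * N%:R)); first by rewrite ltr_pM2r.
    by rewrite -natrM ler_nat leq_pmull// fact_gt0.
  by split; apply: h; lra.
have : `|fine (cellsum N (redset d E) (z`! * (bigC d * N))) - chi_density z`! * fine (basis_vol (redset d E))|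
    <= 2 * (4 / d * (bigC d)%:R ^+ 2 / z%:R + e) by near: N.
rewrite (cellsum_phi d mE _ (ltnW N1)).
move: (\sum_(s : bool) _) (2 * _) (chi_density _ * _) => S B X /= hS.
case: (mu _) => [r| |]//; rewrite ?leNye//= -EFinD !lee_fin => h1 h2.
move: hS; rewrite !ler_norml => /andP[h3 h4]; apply/andP; split; lra.
Unshelve. all: by end_near. Qed.

Lemma ae_loc_constT : ae_loc_const (@setT (R * R * R)).
Proof.
exists set0; split=> // a _ _; exists set0; split=> // b _; exists set0; split=> // u _ *.
by near=> n.
Unshelve. all: by end_near. Qed.

Lemma prob_cvg E (EN : nat -> set R) :
  measurable E -> ae_loc_const E -> (forall N, measurable (EN N)) ->
  (\forall N \near \oo, lat_event N (EN N) E) ->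
  mu (`[0, 1[ `&` EN N) @[N --> \oo] --> ((6 / pi ^+ 2)%:E * basis_vol (redset 0 E))%E.
Proof.
move=> mE Eae mEN nE.
have pi0 := @pi_gt0 R.
set V : R := pi ^+ 2 / 6.
have V0 : 0 < V by rewrite divr_gt0// exprn_gt0.
have [I IE] : exists I : R, basis_vol (redset 0 E) = I%:E.
  have := basis_vol_le mE; have : (0 <= basis_vol (redset 0 E))%E.
    rewrite (basis_vol_sec_vol mE (lexx 0)); apply: integral_ge0 => a _; exact: sec_vol_ge0.
  by case: (basis_vol _) => [r| |]// _ _; exists r.
have /andP[I0 IV] : 0 <= I <= V.
  rewrite -!lee_fin -IE (basis_vol_le mE) andbT.
  rewrite (basis_vol_sec_vol mE (lexx 0)); apply: integral_ge0 => a _; exact: sec_vol_ge0.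
have P1 N : (mu (`[0%R, 1%R[ `&` EN N) <= 1)%E.
  apply: (@le_trans _ _ (mu `[0%R, 1%R[)).
    have m0 : measurable (`[0%R, 1%R[%classic : set mR) by exact: measurable_itv.
    apply: le_measure; [apply/mem_set|exact/mem_set|exact: subIsetl].
    exact: (measurableI _ _ m0 (mEN N)).
  by rewrite lebesgue_measure_itv/= lte_fin ltr01 sube0.
have Pfin N : mu (`[0%R, 1%R[ `&` EN N) = (fine (mu (`[0%R, 1%R[ `&` EN N)))%:E.
  rewrite fineK// ge0_fin_numE//; apply: le_lt_trans (P1 N) _; exact: ltry.
rewrite IE (_ : (6 / pi ^+ 2)%:E * I%:E = (I / V)%:E)%E; last first.
  by rewrite -EFinM /V invf_div mulrC.
under eq_fun do rewrite Pfin.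
apply: cvg_EFin; first by near=> N.
apply/cvgrPdist_le => eps eps0.
(* Budget: [16 d], the sieve error and the convergence in [N] cost [eta] each, and replacing the
   volume at [d] by its limit costs another; this is spent for the event and again for the sure
   event. *)
pose eta := eps / 8; have eta0 : 0 < eta by rewrite divr_gt0.
have cI := basis_vol_cvg mE; rewrite IE in cI; have {}cI := @fine_cvg _ _ _ eventually_filter _ _ cI.
have cV := basis_vol_cvg (@measurableT _ (R * R * R)%type).
rewrite basis_vol_redset0_setT -/V in cV; have {}cV := @fine_cvg _ _ _ eventually_filter _ _ cV.
move/cvgrPdist_le : cI => /(_ _ eta0) cI.
move/cvgrPdist_le : cV => /(_ _ eta0) cV.
have c16 : \forall n \near \oo, 16 * n.+1%:R^-1 <= eta.
  near=> n; rewrite ler_pdivrMr// mulrC -ler_pdivrMr//; apply: ltW.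
  apply: (@lt_trans _ _ n%:R); last by rewrite ltr_nat.
  near: n; exact: nbhs_infty_gtr.
have [n _ /(_ n (leqnn n)) [/= [nI nV] n16]] := filterI (filterI cI cV) c16.
pose d : R := n.+1%:R^-1; have d0 : 0 < d by rewrite invr_gt0.
have [z z0 hz] : exists2 z, (0 < z)%N & 2 * (4 / d * (bigC d)%:R ^+ 2 / z%:R) <= eta.
  near \oo => z.
  have z0 : (0 < z)%N by near: z; exact: nbhs_infty_gt.
  exists z => //; rewrite [leLHS]mulrA ler_pdivrMr ?ltr0n// [leRHS]mulrC -ler_pdivrMr//; apply: ltW.
  near: z; exact: nbhs_infty_gtr.
have e0 : 0 < eta / 2 by rewrite divr_gt0.
have H1 := prob_approx mE Eae mEN nE d0 e0 z0.
have H2 := @prob_approx setT (fun=> setT) d (eta / 2) z measurableT ae_loc_constT (fun=> measurableT)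
   (nearW _ (fun N alpha p q p' q' _ _ => iff_refl True)) d0 e0 z0.
have := @filterI _ _ eventually_filter _ _ H1 (H2 eventually_filter); apply: filterS => N [] /[swap].
rewrite setIT lebesgue_measure_itv/= lte_fin ltr01 sube0/=.
have /andP[] := @chi_density_itv R z`!.
rewrite -/d in nI nV n16.
move: (chi_density _) nI nV => x nI nV x0 x1.
move: (basis_vol (redset d setT)) (basis_vol (redset d E)) nI nV => VD ID.
move: (fine VD) (fine ID) => {}VD {}ID nI nV.
move: (4 / d * _ / _) hz => B hz.
move: (mu _) => P; move: (fine P) => {}P h1 h2.
have {n16 hz} hb : 16 * d + 2 * (B + eta / 2) <= 3 * eta by lra.
have {h1} h1 : `|1 - x * VD| <= 3 * eta by exact: le_trans hb.
have {h2 hb} h2 : `|P - x * ID| <= 3 * eta by exact: le_trans hb.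
have xn (u v : R) : `|u - v| <= eta -> `|x * v - x * u| <= eta.
  move=> uv; rewrite -mulrBr normrM (ger0_norm x0) distrC.
  by apply: le_trans uv; rewrite ler_piMl.
have {h1} h1 : `|1 - x * V| <= 4 * eta.
  by apply: le_trans (ler_distD (x * VD) _ _) _; have := xn _ _ nV; lra.
have {h2} h2 : `|x * I - P| <= 4 * eta.
  by rewrite distrC; apply: le_trans (ler_distD (x * ID) _ _) _; have := xn _ _ nI; lra.
(* This eliminates the density [x]; as [0 <= I/V <= 1], the error of the sure event is not
   amplified. *)
rewrite (_ : I / V - P = (I / V) * (1 - x * V) + (x * I - P)); last first.
  by clearbody V; field; rewrite gt_eqF.
apply: le_trans (ler_normD _ _) _.
have -> : eps = 4 * eta + 4 * eta by rewrite /eta; lra.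
apply: lerD => //; rewrite normrM (ger0_norm (divr_ge0 I0 (ltW V0))).
by apply: le_trans h1; rewrite ler_piMl// ler_pdivrMr// mul1r.
Unshelve. all: by end_near. Qed.
End limit.

(** * The limit for counts in a region *)

Section region_limit.
Context {R : realType}.
Notation mu := (@lebesgue_measure R).
Local Notation mR := (measurableTypeR R).
Variables (A l m : R) (h : R -> R) (k : nat).
Hypothesis l0 : 0 <= l.
Hypothesis hc : forall y, {for y, continuous h}.
Hypothesis h1 : forall y, l <= y <= m -> 1 <= h y.
Let S := region A l m h.

Lemma measurable_pcount d (T : measurableType d) (f g : T -> int * int -> R) :
  (forall w, measurable_fun setT (f^~ w)) -> (forall w, measurable_fun setT (g^~ w)) ->
  measurable [set z | pcount S k (fun w => (f z w, g z w))].
Proof.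
move=> mf mg; apply: measurable_has_card => w.
have mh : measurable_fun setT (fun z => h (g z w)).
  by apply: measurableT_comp => //; apply: continuous_measurable_fun; exact: hc.
have [g1|g1] := pselect (gcdz w.1 w.2 = 1); last first.
  by rewrite (_ : mkset _ = set0)//; apply/seteqP; split=> z // -[].
rewrite (_ : mkset _ = [set z | `|f z w| * h (g z w) <= A] `&`
  ([set z | l <= g z w] `&` [set z | g z w <= m])); last first.
  by apply/seteqP; split=> z /=; [move=> [_ [? /andP[]]]|move=> [? [? ?]]; do 2!split=> //; exact/andP].
apply: measurableI; first by apply: measurable_set_le; mfun.
by apply: measurableI; apply: measurable_set_le; mfun.
Qed.

Definition pcount_set : set (R * R * R) := [set z | pcount S k (lat3 z)].

Lemma measurable_pcount_set : measurable pcount_set.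
Proof.
rewrite (_ : pcount_set = [set z | pcount S k (fun w =>
  (z.2 * w.1%:~R + top2 z.1.1 z.1.2 z.2 * w.2%:~R, z.1.1 * w.1%:~R + z.1.2 * w.2%:~R))]).
  by apply: measurable_pcount => w; rewrite /top2; mfun.
by apply/funext => z; apply/propext; apply: eq_has_card => w; rewrite /= /lat3 latpt_mx2.
Qed.

Lemma pcount_set_ae_loc_const : ae_loc_const pcount_set.
Proof.
exists (Z0 l m); split; first exact: countable_Z0.
move=> a a0 n0; exists (Z1 l m a); split; first exact: countable_Z1.
move=> b n1; exists (Z2 A h a b); split; first exact: countable_Z2.
move=> u n2 a_ b_ ac bc; apply: pcount_near => //.
exact: lat_good_ae.
Qed.

Lemma fund_matE (x y t : R) : fund_mat ((x, y), t) =
  mx2 (cos t / Num.sqrt y) (sin t * Num.sqrt y - x * cos t / Num.sqrt y)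
      (- fa y t) (x * fa y t + cos t * Num.sqrt y).
Proof.
rewrite /fund_mat/= /fa; apply/matrixP => i j.
rewrite !mxE !big_ord_recl big_ord0 !mxE !big_ord_recl !big_ord0 !mxE/=.
case: i => -[|[|i]]//= ?; case: j => -[|[|j]]//= ?; ring.
Qed.

(** The coordinates describe the basis opposite to the columns of [fund_mat], so coefficients change
    sign. *)
Lemma pcount_fund_mat (x y t : R) : 0 < y -> 0 < t < pi ->
  pcount S k (latpt (fund_mat ((x, y), t))) <->
  pcount_set ((fa y t, fb x y t), fu y t).
Proof.
move=> y0 tpi; rewrite /pcount_set/= -(pcount_opp _ _ (lat3 _)).
apply: eq_has_card => w; rewrite /= /lat3 fund_matE !latpt_mx2/= fund_top2// !intrN.
rewrite (_ : (_, _) = (fu y t * - w.1%:~R + (x * cos t / Num.sqrt y - sin t * Num.sqrt y) * - w.2%:~R,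
   fa y t * - w.1%:~R + fb x y t * - w.2%:~R))//.
by rewrite /fu /fb; congr pair; ring.
Qed.

(** The constant is [3/pi^2] from the normalisation times the 2 of [fund_integral]. *)
Lemma mu2_region : mu2 (fun g => has_card (prim_vecs g `&` S) k) =
  ((6 / pi ^+ 2)%:E * basis_vol (redset 0 pcount_set))%E.
Proof.
pose P := [set v : R * R * R | pcount S k (latpt (fund_mat v))].
have mP : measurable P.
  rewrite (_ : P = [set v | pcount S k (fun w =>
    (cos v.2 / Num.sqrt v.1.2 * w.1%:~R +
      (sin v.2 * Num.sqrt v.1.2 - v.1.1 * cos v.2 / Num.sqrt v.1.2) * w.2%:~R,
     - fa v.1.2 v.2 * w.1%:~R + (v.1.1 * fa v.1.2 v.2 + cos v.2 * Num.sqrt v.1.2) * w.2%:~R))]).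
    by apply: measurable_pcount => w; rewrite /fa; mfun.
  by apply/funext => -[[x y] t]; apply/propext; apply: eq_has_card => w; rewrite /= fund_matE latpt_mx2.
have -> : (6 / pi ^+ 2 : R)%:E = ((3 / pi ^+ 2)%:E * 2%:E)%E.
  by rewrite -EFinM; congr EFin; ring.
rewrite /mu2 -muleA -(fund_integral (measurable_redset 0 measurable_pcount_set) mP); first last.
- move=> x y t y0 tpi; rewrite /P/= (pcount_fund_mat _ y0 tpi) /redset /fund_dom/= fund_red//.
  have /andP[t0 tp] := tpi.
  split=> [[[q1 [q2 _]] q3]|[/andP[q1 q2] q3 _]].
    split=> //; first exact/andP.
    by rewrite /fa divr_gt0 ?sqrtr_gt0 ?sin_gt0_pi.
  by split=> //; split=> //; split=> //; split=> //; rewrite tp (ltW t0).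
- by move=> a b u [].
congr (_ * _)%E; apply: eq_integral => -[[x y] t] /set_mem[/= _ [_ [y0 _]]].
congr ((_ * _)%R%:E); rewrite !indicE; congr ((nat_of_bool _)%:R).
(* The determinant is [cos^2 t + sin^2 t = 1], so distinct coefficients give distinct vectors. *)
have D : (cos t / Num.sqrt y) * (x * fa y t + cos t * Num.sqrt y) -
   (sin t * Num.sqrt y - x * cos t / Num.sqrt y) * (- fa y t) != 0.
  rewrite (_ : _ - _ = 1) ?oner_eq0// -(cos2Dsin2 t) /fa.
  by field; rewrite gt_eqF// sqrtr_gt0.
have e := pcount_prim_vecs S k D; rewrite -fund_matE in e.
by apply/idP/idP => /set_mem/e/mem_set.
Qed.

Lemma region_cvg (EN : nat -> set R) :
  (\forall N \near \oo, forall alpha, EN N alpha <->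
     pcount S k (fun w => (vtop N alpha w.1 w.2, vbot N w.2))) ->
  mu [set alpha | `[0, 1]%classic alpha /\ EN N alpha] @[N --> \oo] -->
  mu2 (fun g => has_card (prim_vecs g `&` S) k).
Proof.
move=> nE; rewrite mu2_region.
pose EN' N := [set alpha : R | pcount S k (fun w => (vtop N alpha w.1 w.2, vbot N w.2))].
have mEN' N : measurable (EN' N) by apply: measurable_pcount => w; rewrite /vtop /vbot; mfun.
have lE : \forall N \near \oo, lat_event N (EN' N) pcount_set.
  near=> N; move=> alpha p q p' q' q0 det; apply: (pcount_basis _ _ _ _ q0 det).
  by near: N; exact: nbhs_infty_gt.
have := prob_cvg measurable_pcount_set pcount_set_ae_loc_const mEN' lE.
apply: cvg_trans; apply: near_eq_cvg; near=> N.
have eN : forall alpha, EN N alpha <-> EN' N alpha by near: N.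
have mi : measurable (`[0%R, 1%R[ `&` EN' N : set mR).
  have m0 : measurable (`[0%R, 1%R[%classic : set mR) by exact: measurable_itv.
  exact: (measurableI _ _ m0 (mEN' N)).
have m1 : measurable ([set 1] : set mR) by exact: measurable_set1.
have m2 := measurableI _ _ m1 (mEN' N).
(* The probabilities are over the closed interval; its extra point [alpha = 1] is null. *)
have -> : [set alpha | `[0, 1]%classic alpha /\ EN N alpha] =
  (`[0, 1[ `&` EN' N) `|` ([set 1] `&` EN' N).
  apply/seteqP; split=> a /=; rewrite !in_itv/=.
    move=> [/andP[a0 a1] /eN Ea]; have [a1E|a1'] := eqVneq a 1; last by left; rewrite a0 lt_neqAle a1' a1.
    by right.
  move=> [[/andP[a0 a1] /eN Ea]|[-> /eN Ea]]; split=> //; first by rewrite a0 ltW.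
  by rewrite ler01 lexx.
apply/esym/eqP; rewrite eq_le; apply/andP; split; last first.
  apply: le_measure; [exact/mem_set| |exact: subsetUl].
  by apply/mem_set; exact: (measurableU _ _ mi m2).
apply: le_trans (measureU2 mu mi m2) _.
rewrite -[leRHS]adde0 leeD2l//; apply: (@le_trans _ _ (mu [set 1])).
  by apply: le_measure; [exact/mem_set|exact/mem_set|exact: subIsetl].
by rewrite lebesgue_measure_set1.
Unshelve. all: by end_near. Qed.
End region_limit.

(** The scale cancels: [|N (alpha q - p)| (q/N) = q^2 |alpha - p/q|]. *)
Lemma EST_set_region (R : realType) (A c : R) (N : nat) (alpha : R) (w : int * int) : (0 < N)%N ->
  EST_set A c N alpha w <->
  gcdz w.1 w.2 = 1 /\ region A 1 c id (vtop N alpha w.1 w.2, vbot N w.2).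
Proof.
move=> N0; have N0' : 0 < N%:R :> R by rewrite ltr0n.
case: w => p q; rewrite /EST_set /region /vtop /vbot/=.
have -> : ((1 : R) <= q%:~R / (N%:R : R) <= c) = ((N%:R : R) <= q%:~R <= c * N%:R).
  by rewrite ler_pdivlMr// mul1r ler_pdivrMr.
have e : 0 < q%:~R :> R -> (`|alpha - p%:~R / q%:~R| <= A / q%:~R ^+ 2) =
   (`|N%:R * (alpha * q%:~R - p%:~R)| * (q%:~R / N%:R) <= A).
  move=> q0; rewrite ler_pdivlMr ?exprn_gt0//; congr (_ <= _).
  rewrite normrM (gtr0_norm N0') (_ : alpha - _ = (alpha * q%:~R - p%:~R) / q%:~R); last first.
    by field; rewrite gt_eqF.
  rewrite normrM normfV (gtr0_norm q0); move: `|_| => t.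
  by field; rewrite !gt_eqF.
split=> [[g1 [q1 [qN qA]]]|[g1 [qA qN]]].
  by do 2!split=> //; rewrite -e// ltr0z; lia.
have q0 : 0 < q%:~R :> R by have /andP[h _] := qN; exact: lt_le_trans h.
split=> //; split; last by rewrite e.
by move: q0; rewrite ltr0z; lia.
Qed.

(** The region contains points with [y = 0] while [K_set] asks for [q >= 1]. A primitive pair with
    [q = 0] has [|p| = 1], so its vector has first coordinate of size [N > A] and lies outside. *)
Lemma K_set_region (R : realType) (A : R) (N : nat) (alpha : R) (w : int * int) :
  (0 < N)%N -> A < N%:R ->
  K_set A N alpha w <->
  gcdz w.1 w.2 = 1 /\ region A 0 1 (cst 1) (vtop N alpha w.1 w.2, vbot N w.2).
Proof.
move=> N0 AN; have N0' : 0 < N%:R :> R by rewrite ltr0n.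
case: w => p q; rewrite /K_set /region /vtop /vbot/= mulr1.
have -> : (0 <= (q%:~R : R) / N%:R <= 1) = (0 <= q <= N%:Z).
  by rewrite ler_pdivlMr// mul0r ler_pdivrMr// mul1r ler0z -(ler_int R).
rewrite ler_pdivlMr// normrM (gtr0_norm N0') mulrC.
split=> [[g1 [q1 [qN qA]]]|[g1 [qA /andP[q0 qN]]]].
  by do 2!split=> //; rewrite qN andbT; lia.
do 2!split=> //.
have [q1|q1] := eqVneq q 0; last by lia.
exfalso; move: g1 qA; rewrite q1 gcdz0 abszE mulr0 sub0r normrN -intr_norm => ->.
by rewrite mulr1 leNgt AN.
Qed.

Theorem theorem1 (R : realType) (A c : R) (hA : 0 < A) (hc : 1 < c) (k : nat) :
  (prob_EST A c ^~ k @ \oo -->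
     mu2 (fun g => has_card (prim_vecs g `&` H_set A c) k))
  /\
  (prob_K A ^~ k @ \oo -->
     mu2 (fun g => has_card (prim_vecs g `&` R_set A) k)).
Proof.
split.
  apply: (@region_cvg R A 1 c id k ler01 _ _ (fun N => [set alpha | has_card (EST_set A c N alpha) k])).
  - by move=> y; exact: cvg_id.
  - by move=> y /andP[].
  near=> N; move=> alpha; apply: eq_has_card => w; apply: EST_set_region.
  by near: N; exact: nbhs_infty_gt.
rewrite (_ : R_set A = region A 0 1 (cst 1)); last first.
  by apply/seteqP; split=> v; rewrite /R_set /region/= mulr1.
apply: (@region_cvg R A 0 1 (cst 1) k (lexx 0) _ _ (fun N => [set alpha | has_card (K_set A N alpha) k])).
- by move=> y; exact: cvg_cst.
- by [].
near=> N; move=> alpha; apply: eq_has_card => w; apply: K_set_region.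
  by near: N; exact: nbhs_infty_gt.
by near: N; exact: nbhs_infty_gtr.
Unshelve. all: by end_near. Qed.
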